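(* Let $k$ be a real number, let $\Gamma$ be a finite index subgroup of $\mathrm{SL}_2(\mathbb{Z})$, and let $f$ be a non-zero modular function of weight $k$ for $\Gamma$ (with respect to some automorphy factors) which is holomorphic on the upper half plane $\mathfrak{H}$. If $k<0$, then $f$ is strongly non-lacunary.
   Context: Expansions. For $r\in\mathbb{R}$ let $\mathfrak{H}_r=\{z\in\mathbb{C} : \mathrm{Im}(z)>r\}$, and let $\mathfrak{H}=\mathfrak{H}_0$. Let $g$ be holomorphic on some $\mathfrak{H}_r$ and suppose there are a real $h>0$ and $u\in\mathbb{C}$ with $|u|=1$ and $g(z+h)=u\,g(z)$ for all $z\in\mathfrak{H}_r$. Then $g$ has a unique expansion $g(z)=\sum_{\lambda\in\Lambda}a(\lambda)e^{2\pi i\lambda z}$, where $\Lambda=\{\lambda\in\mathbb{R} : e^{2\pi i\lambda h}=u\}$, called the expansion of $g$ at $\infty$. We say $g$ has finite order at $\infty$ if $\{\lambda<0 : a(\lambda)\neq0\}$ is finite. If $g$ has finite order at $\infty$, its expansion at $\infty$ is strongly non-lacunary if there is a non-constant arithmetic progression $\Lambda'=\lambda_0+mh^{-1}\mathbb{N}$ (with $m\ge1$ an integer) contained in $\Lambda$ such that $a(\lambda)\ne0$ for all $\lambda\in\Lambda'$. These notions do not depend on the choice of $h$ and $u$. Modular functions. For $z\in\mathbb{C}^*$, $z^k=e^{k\log z}$ with the imaginary part of $\log z$ in $]-\pi,\pi]$. A meromorphic function $f$ on $\mathfrak{H}$ is a modular function of weight $k$ for $\Gamma$ if: (a) for each $\gamma=\begin{pmatrix}a&b\\c&d\end{pmatrix}\in\Gamma$,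 $f(\gamma z)=j(\gamma,z)f(z)$, where $\gamma z=\frac{az+b}{cz+d}$ and $j(\gamma,\cdot)$ (the automorphy factor) is a holomorphic function on $\mathfrak{H}$ with $|j(\gamma,z)|=|cz+d|^k$; (b) for any $\begin{pmatrix}a&b\\c&d\end{pmatrix}\in\mathrm{SL}_2(\mathbb{Z})$, the function $z\mapsto(cz+d)^{-k}f\left(\frac{az+b}{cz+d}\right)$ is holomorphic on some half plane $\mathfrak{H}_r$ (hence, by (a), it satisfies the conditions on $g$ above) and it has finite order at $\infty$. A modular function is said to be strongly non-lacunary if its expansion at $\infty$ is strongly non-lacunary. *)

(* Defs.v *)
(* Stdlib reals with Coquelicot's complex numbers. *)
From Stdlib Require Export Reals ZArith List.
From Stdlib Require Import Lia.
From Coquelicot Require Export Coquelicot.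
Open Scope R_scope.

(** ** Complex analysis *)

Definition half_plane (r : R) (z : C) : Prop := r < Im z.

Definition Cexp (z : C) : C :=
  (exp (Re z) * cos (Im z), exp (Re z) * sin (Im z)).

(* The argument in ]-PI, PI] of a nonzero z; the value at 0 is junk. *)
Definition Carg (z : C) : R :=
  if Rle_dec 0 (Im z) then acos (Re z / Cmod z) else - acos (Re z / Cmod z).

Definition Clog (z : C) : C := (ln (Cmod z), Carg z).

Definition Cpower (z : C) (k : R) : C := Cexp (RtoC k * Clog z)%C.

(* Complex differentiability; [holomorphic_on D] is only used for open [D]. *)
Definition holomorphic_on (D : C -> Prop) (f : C -> C) : Prop :=
  forall z : C, D z -> @ex_derive C_AbsRing C_NormedModule f z.

(* A meromorphic function is encoded as a total function normalised to take the
   value 0 at its poles, and to have no removable singularity. With this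
   convention two meromorphic functions coincide iff they agree pointwise, and
   a functional equation by a nowhere vanishing holomorphic factor may be
   stated pointwise, poles included. *)
Definition meromorphic_at (f : C -> C) (z0 : C) : Prop :=
  @locally C_UniformSpace z0
    (fun z => @ex_derive C_AbsRing C_NormedModule f z)
  \/ f z0 = RtoC 0 /\
     exists (n : nat) (g : C -> C),
       (1 <= n)%nat /\ g z0 <> RtoC 0 /\
       @locally C_UniformSpace z0 (fun z =>
         @ex_derive C_AbsRing C_NormedModule g z /\
         (z <> z0 -> f z = (g z / Cpow (z - z0) n)%C)).

Definition meromorphic_on (D : C -> Prop) (f : C -> C) : Prop :=
  forall z : C, D z -> meromorphic_at f z.

(** ** Expansions at infinity *)

(* Unordered sum of the family [F] over the set [P], i.e. the limit of the
   finite partial sums along the finite subsets of [P] ordered by inclusion;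
   for complex-valued families it exists iff the sum converges absolutely. *)
Definition is_sum_over (P : R -> Prop) (F : R -> C) (s : C) : Prop :=
  forall eps : posreal, exists l0 : list R,
    (forall x, In x l0 -> P x) /\
    forall l : list R, NoDup l -> (forall x, In x l -> P x) -> incl l0 l ->
      Cmod (fold_right Cplus (RtoC 0) (map F l) - s)%C < eps.

Definition exponents (h : R) (u : C) (lambda : R) : Prop :=
  Cexp (2 * PI * Ci * lambda * h)%C = u.

Definition quasi_periodic_on (r : R) (g : C -> C) (h : R) (u : C) : Prop :=
  0 < h /\ Cmod u = 1 /\
  holomorphic_on (half_plane r) g /\
  forall z, half_plane r z -> g (z + h)%C = (u * g z)%C.

(* [a], extended by 0 outside [exponents h u], is the family of coefficients of
   the expansion of [g] at infinity. *)
Definition is_expansion (g : C -> C) (h : R) (u : C) (a : R -> C) : Prop :=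
  exists r : R,
    quasi_periodic_on r g h u /\
    (forall lambda, ~ exponents h u lambda -> a lambda = RtoC 0) /\
    forall z, half_plane r z ->
      is_sum_over (exponents h u)
        (fun lambda => (a lambda * Cexp (2 * PI * Ci * lambda * z))%C) (g z).

Definition finitely_many_negative (a : R -> C) : Prop :=
  exists l : list R, forall lambda, lambda < 0 -> a lambda <> RtoC 0 ->
    In lambda l.

(* The expansion is unique and, up to extension by 0, independent of [r], [h]
   and [u]; hence the existential quantifiers pick the expansion of [g]. *)
Definition finite_order (g : C -> C) : Prop :=
  exists (h : R) (u : C) (a : R -> C),
    is_expansion g h u a /\ finitely_many_negative a.

Definition strongly_non_lacunary (g : C -> C) : Prop :=
  exists (h : R) (u : C) (a : R -> C),
    is_expansion g h u a /\ finitely_many_negative a /\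
    exists (m : nat) (lambda0 : R),
      (1 <= m)%nat /\
      forall n : nat,
        exponents h u (lambda0 + INR m * / h * INR n) /\
        a (lambda0 + INR m * / h * INR n) <> RtoC 0.

(** ** The modular group *)

Record SL2Z : Set := mkSL2Z {
  ma : Z; mb : Z; mc : Z; md : Z;
  SL2Z_det : (ma * md - mb * mc = 1)%Z
}.

Definition SL2Z_one : SL2Z := mkSL2Z 1 0 0 1 eq_refl.

Lemma SL2Z_mul_det (g g' : SL2Z) :
  ((ma g * ma g' + mb g * mc g') * (mc g * mb g' + md g * md g') -
   (ma g * mb g' + mb g * md g') * (mc g * ma g' + md g * mc g') = 1)%Z.
Proof.
  transitivity ((ma g * md g - mb g * mc g) *
                (ma g' * md g' - mb g' * mc g'))%Z; [ring|].
  now rewrite !SL2Z_det.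
Qed.

Definition SL2Z_mul (g g' : SL2Z) : SL2Z :=
  mkSL2Z (ma g * ma g' + mb g * mc g') (ma g * mb g' + mb g * md g')
         (mc g * ma g' + md g * mc g') (mc g * mb g' + md g * md g')
         (SL2Z_mul_det g g').

Lemma SL2Z_inv_det (g : SL2Z) : (md g * ma g - - mb g * - mc g = 1)%Z.
Proof. rewrite <- (SL2Z_det g); ring. Qed.

Definition SL2Z_inv (g : SL2Z) : SL2Z :=
  mkSL2Z (md g) (- mb g) (- mc g) (ma g) (SL2Z_inv_det g).

Definition is_subgroup (G : SL2Z -> Prop) : Prop :=
  G SL2Z_one /\
  (forall g g', G g -> G g' -> G (SL2Z_mul g g')) /\
  (forall g, G g -> G (SL2Z_inv g)).

(* Finitely many left cosets [s G] cover the modular group. *)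
Definition finite_index (G : SL2Z -> Prop) : Prop :=
  exists l : list SL2Z, forall g, exists s, In s l /\ G (SL2Z_mul (SL2Z_inv s) g).

Definition denom (g : SL2Z) (z : C) : C := (IZR (mc g) * z + IZR (md g))%C.

Definition moebius (g : SL2Z) (z : C) : C :=
  ((IZR (ma g) * z + IZR (mb g)) / denom g z)%C.

(** ** Modular functions *)

Definition is_automorphy_factor (k : R) (g : SL2Z) (j : C -> C) : Prop :=
  holomorphic_on (half_plane 0) j /\
  forall z, half_plane 0 z -> Cmod (j z) = Rpower (Cmod (denom g z)) k.

Definition slash (k : R) (f : C -> C) (g : SL2Z) (z : C) : C :=
  (Cpower (denom g z) (- k) * f (moebius g z))%C.

Definition modular_function (k : R) (G : SL2Z -> Prop) (f : C -> C) : Prop :=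
  meromorphic_on (half_plane 0) f /\
  (exists j : SL2Z -> C -> C, forall g, G g ->
     is_automorphy_factor k g (j g) /\
     forall z, half_plane 0 z -> f (moebius g z) = (j g z * f z)%C) /\
  (forall g : SL2Z,
     (exists r : R, 0 <= r /\ holomorphic_on (half_plane r) (slash k f g)) /\
     finite_order (slash k f g)).

(* Main.v *)
(* Negative weight forces a pole at some cusp: otherwise [|f z| (Im z)^(k/2)] is bounded on the upper
   half plane, [f] tends to 0 at the real axis and all its Fourier coefficients vanish.  Let [mu]
   be the order of the pole at the cusp [a/c] and let [M0] be the largest of the numbers [mu / c^2]; it is
   attained exactly at certain dominant cusps, all of which lie in [(1/L) Z].  Near such a cusp [x0] one has
   [f (x0 + t) ~ A |t|^(-k) exp (2 pi i M0 / t)], and everywhere else [f] is exponentially smaller.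
   Integrating over the line [Im z = y] with [lambda = M0 / y^2], the saddle point method gives
   [a lambda = P (S lambda + o(1))], where [P > 0] and [S lambda] is a finite sum of the terms
   [A exp (- 2 pi i lambda x0)] over the dominant cusps modulo the period.  [S] has period [L] and,
   characters being independent, does not vanish identically; so [a] does not vanish on the tail of some
   progression of step [L]. *)
Require Import Defs.
From Stdlib Require Import Lia Lra ClassicalEpsilon Classical Eqdep_dec FunctionalExtensionality.
Open Scope R_scope.

(** The automorphy factors come with known moduli but unknown arguments, and no cocycle relation
    between them is available. Cusps are therefore compared through moduli only ([habs]), where the
    relation for [denom] suffices. One factor is used as a function: that of a translation by [N] in
    the group. It has modulus 1, hence is constant, and supplies the [u] of the expansion. Finite
    index gives uniformity: up to modulus there are finitely many functions [slash k f g], so one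
    constant and one finite list of pole orders serve all cusps at once. Near a dominant cusp the
    power of the denominator still has a varying phase; but the saddle sits in a sector closing up
    around the vertical, where this phase tends to a constant that is absorbed in [A]. The factor
    [P] is one and the same integral for all dominant cusps, so no Gaussian has to be evaluated: it
    is enough that everything else is exponentially smaller. The expansion is given only as an
    unordered sum on some high half plane, whereas the saddle height tends to 0. The coefficient
    integral is therefore established high up and brought down by Cauchy's theorem. *)

Lemma C_eq (z w : C) : Re z = Re w -> Im z = Im w -> z = w.
Proof. destruct z, w; simpl; congruence. Qed.

Lemma im_le_Cmod (z : C) : Rabs (Im z) <= Cmod z.
Proof. apply Rle_trans with (2 := Rmax_Cmod z). apply Rmax_r. Qed.

Lemma Cmod_le_sum (z : C) : Cmod z <= Rabs (Re z) + Rabs (Im z).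
Proof.
  assert (E : z = (RtoC (Re z) + RtoC (Im z) * Ci)%C) by (apply C_eq; simpl; ring).
  rewrite E at 1. eapply Rle_trans; [apply Cmod_triangle|].
  rewrite Cmod_mult, !Cmod_R, Cmod_Ci. lra.
Qed.

Lemma Cmod_sqr (z : C) : Cmod z * Cmod z = Re z * Re z + Im z * Im z.
Proof. generalize (Cmod2_alt z). simpl. intros H. nra. Qed.

Lemma Cmod_minus_sym (z w : C) : Cmod (z - w) = Cmod (w - z).
Proof. rewrite <- Cmod_opp. f_equal. ring. Qed.

Lemma Cmod_triangle_minus (x y z : C) : Cmod (x - z) <= Cmod (x - y) + Cmod (y - z).
Proof. replace (x - z)%C with ((x - y) + (y - z))%C by ring. apply Cmod_triangle. Qed.

Lemma Cmod_triangle_inv (x y : C) : Cmod x - Cmod y <= Cmod (x - y).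
Proof.
  assert (H := Cmod_triangle (x - y) y). replace (x - y + y)%C with x in H by ring. lra.
Qed.

(** * The exponential function *)

Lemma Cexp_plus (z w : C) : Cexp (z + w) = (Cexp z * Cexp w)%C.
Proof.
  unfold Cexp, Re, Im. apply C_eq; simpl; rewrite exp_plus, ?cos_plus, ?sin_plus; ring.
Qed.

Lemma Cexp_0 : Cexp 0 = 1.
Proof. unfold Cexp, Re, Im; simpl. rewrite exp_0, cos_0, sin_0. apply C_eq; simpl; ring. Qed.

Lemma Cmod_Cexp (z : C) : Cmod (Cexp z) = exp (Re z).
Proof.
  unfold Cmod, Cexp; simpl.
  replace (_ + _) with (exp (Re z) * exp (Re z)).
  - apply sqrt_square. left; apply exp_pos.
  - generalize (sin2_cos2 (Im z)). unfold Rsqr, Re, Im. intros H.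
    transitivity (exp (fst z) * exp (fst z) * (sin (snd z) * sin (snd z) + cos (snd z) * cos (snd z))); [|ring].
    rewrite H. ring.
Qed.

Lemma Cexp_neq_0 (z : C) : Cexp z <> 0.
Proof. apply Cmod_gt_0. rewrite Cmod_Cexp. apply exp_pos. Qed.

Lemma one_minus_cos_bound (y : R) : 0 <= 1 - cos y <= y * y / 2.
Proof.
  replace y with (2 * (y / 2)) at 1 2 by field. rewrite cos_2a_sin.
  assert (H : Rabs (sin (y / 2)) <= Rabs (y / 2)).
  { destruct (Rtotal_order (y / 2) 0) as [H|[H|H]].
    - rewrite <- (Ropp_involutive (y / 2)), sin_neg, !Rabs_Ropp.
      assert (H0 : 0 < - (y / 2)) by lra.
      assert (H1 := sin_lt_x _ H0).
      rewrite (Rabs_left (y / 2)) by lra. apply Rabs_le. split; [|lra].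
      destruct (Rle_dec (- (y / 2)) PI).
      + assert (0 <= sin (- (y / 2))) by (apply sin_ge_0; lra). lra.
      + generalize (SIN_bound (- (y / 2))) PI2_1. unfold PI2. lra.
    - rewrite H, sin_0. lra.
    - assert (H1 := sin_lt_x _ H).
      rewrite (Rabs_right (y / 2)) by lra. apply Rabs_le. split; [|lra].
      destruct (Rle_dec (y / 2) PI).
      + assert (0 <= sin (y / 2)) by (apply sin_ge_0; lra). lra.
      + generalize (SIN_bound (y / 2)) PI2_1. unfold PI2. lra. }
  assert (H2 := Rsqr_le_abs_1 _ _ H). unfold Rsqr in H2.
  split; nra.
Qed.

Lemma sin_minus_id_bound (y : R) : Rabs (sin y - y) <= Rabs y * (y * y).
Proof.
  destruct (MVT_gen (fun t => sin t - t) 0 y (fun t => cos t - 1)) as [c [Hc E]].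
  - intros x _. auto_derive; trivial. ring.
  - intros x _. apply continuity_pt_minus; [apply continuity_sin|].
    apply derivable_continuous_pt, derivable_pt_id.
  - rewrite sin_0 in E. replace (sin y - y) with ((cos c - 1) * y) by lra.
    rewrite Rabs_mult, Rmult_comm. apply Rmult_le_compat_l; [apply Rabs_pos|].
    destruct (one_minus_cos_bound c).
    assert (c * c <= y * y).
    { unfold Rmin, Rmax in Hc. destruct (Rle_dec 0 y); nra. }
    rewrite Rabs_left1; lra.
Qed.

(** Since [exp x * exp (- x) = 1], the tangent inequality at [- x] gives exp x <= 1/(1 - x), and
    1/(1 - x) - 1 - x = x^2/(1 - x) <= 2 x^2 for x <= 1/2. *)
Lemma exp_minus_bound (x : R) : Rabs x <= 1 / 2 -> Rabs (exp x - 1 - x) <= 2 * (x * x).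
Proof.
  intros H. apply Rabs_le_between in H as [H1 H2].
  assert (A := exp_ineq1_le x). assert (B := exp_ineq1_le (- x)).
  assert (E : exp x * exp (- x) = 1) by (rewrite <- exp_plus, Rplus_opp_r; apply exp_0).
  assert (P := exp_pos x).
  rewrite Rabs_right by lra.
  assert (exp x * (1 - x) <= 1) by nra. nra.
Qed.

Lemma Cexp_minus_bound (z : C) : Cmod z <= 1 / 2 ->
  Cmod (Cexp z - 1 - z) <= 16 * (Cmod z * Cmod z).
Proof.
  intros H. assert (Hr := re_le_Cmod z). assert (Hi := im_le_Cmod z).
  assert (Hx := exp_minus_bound (Re z) (Rle_trans _ _ _ Hr H)).
  assert (Hs := sin_minus_id_bound (Im z)). assert (Hc := one_minus_cos_bound (Im z)).
  assert (Q := Cmod_sqr z).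
  eapply Rle_trans; [apply Cmod_le_sum|]. unfold Cexp; simpl.
  set (x := Re z) in *. set (y := Im z) in *. fold x y in Q.
  change (fst z) with x. change (snd z) with y.
  set (E := exp x) in *. set (c := cos y) in *. set (s := sin y) in *.
  rewrite Q.
  replace (E * c + - (1) + - x) with ((E - 1 - x) * c + (1 + x) * (c - 1)) by ring.
  replace (E * s + - 0 + - y) with ((E - 1 - x) * s + x * s + (s - y)) by ring.
  assert (Bc : Rabs c <= 1) by (apply Rabs_le; generalize (COS_bound y); unfold c; lra).
  assert (Bs : Rabs s <= 1) by (apply Rabs_le; generalize (SIN_bound y); unfold s; lra).
  assert (Cx : Rabs (c - 1) <= y * y / 2) by (rewrite Rabs_left1; lra).
  assert (X1 : Rabs (1 + x) <= 2).
  { eapply Rle_trans; [apply Rabs_triang|]. rewrite Rabs_R1. lra. }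
  assert (xx : Rabs x * Rabs x = x * x) by (rewrite <- Rabs_mult, Rabs_right; nra).
  assert (yy : Rabs y * Rabs y = y * y) by (rewrite <- Rabs_mult, Rabs_right; nra).
  assert (Sy : Rabs s <= 2 * Rabs y).
  { replace s with ((s - y) + y) by ring. eapply Rle_trans; [apply Rabs_triang|].
    assert (Rabs y * (y * y) <= Rabs y); [|lra].
    assert (y * y <= 1) by (rewrite <- yy; assert (0 <= Rabs y) by apply Rabs_pos; nra).
    assert (0 <= Rabs y) by apply Rabs_pos. nra. }
  assert (T1 : Rabs ((E - 1 - x) * c + (1 + x) * (c - 1)) <= 2 * (x * x) * 1 + 2 * (y * y / 2)).
  { eapply Rle_trans; [apply Rabs_triang|]. rewrite !Rabs_mult.
    apply Rplus_le_compat; apply Rmult_le_compat; auto using Rabs_pos. }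
  assert (T2 : Rabs ((E - 1 - x) * s + x * s + (s - y)) <=
    2 * (x * x) * 1 + Rabs x * (2 * Rabs y) + Rabs y * (y * y)).
  { eapply Rle_trans; [apply Rabs_triang|]. apply Rplus_le_compat; [|assumption].
    eapply Rle_trans; [apply Rabs_triang|]. rewrite !Rabs_mult.
    apply Rplus_le_compat; apply Rmult_le_compat; auto using Rabs_pos; lra. }
  assert (0 <= Rabs y <= 1/2) by (split; [apply Rabs_pos|lra]).
  assert (Rabs y * (y * y) <= y * y) by nra.
  assert (2 * (Rabs x * Rabs y) <= x * x + y * y) by (rewrite <- xx, <- yy; generalize (Rle_0_sqr (Rabs x - Rabs y)); unfold Rsqr; lra).
  nra.
Qed.

(** The constant is 9 = 1 + 16/2: the hypothesis absorbs one factor of the quadratic remainder. *)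
Lemma Cexp_minus_1_bound (z : C) : Cmod z <= 1 / 2 -> Cmod (Cexp z - 1) <= 9 * Cmod z.
Proof.
  intros H. replace (Cexp z - 1)%C with ((Cexp z - 1 - z) + z)%C by ring.
  eapply Rle_trans; [apply Cmod_triangle|].
  assert (H1 := Cexp_minus_bound z H). assert (0 <= Cmod z) by apply Cmod_ge_0. nra.
Qed.

(** * Complex differentiability *)

(** The derivative of Coquelicot unfolded into an explicit estimate; the weak inequality lets it
    hold at [w = z] as well. *)
Definition cdiff (f : C -> C) (z : C) : Prop :=
  exists d : C, forall eps, 0 < eps -> exists delta, 0 < delta /\
    forall w, Cmod (w - z) < delta ->
      Cmod (f w - f z - d * (w - z)) <= eps * Cmod (w - z).

Lemma ex_derive_cdiff (f : C -> C) (z : C) :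
  @ex_derive C_AbsRing C_NormedModule f z -> cdiff f z.
Proof.
  intros [d [_ H]]. exists d. intros eps He.
  specialize (H z (fun P HP => HP) (mkposreal eps He)).
  destruct H as [delta H]. exists delta. split; [apply cond_pos|].
  intros w Hw. specialize (H w Hw).
  change (Cmod (minus (minus (f w) (f z)) (scal (minus w z) d)) <= eps * Cmod (w - z)) in H.
  replace (f w - f z - d * (w - z))%C
    with (f w - f z - (w - z) * d)%C by ring. exact H.
Qed.

Definition ccont (f : C -> C) (z : C) : Prop :=
  forall eps, 0 < eps -> exists delta, 0 < delta /\
    forall w, Cmod (w - z) < delta -> Cmod (f w - f z) < eps.

Lemma cdiff_ccont (f : C -> C) (z : C) : cdiff f z -> ccont f z.
Proof.
  intros [d H] eps He. destruct (H 1 Rlt_0_1) as [delta [Hd H1]].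
  assert (K : 0 < 1 + Cmod d) by (generalize (Cmod_ge_0 d); lra).
  exists (Rmin delta (eps / (1 + Cmod d))). split.
  { apply Rmin_pos; [assumption|]. apply Rdiv_lt_0_compat; assumption. }
  intros w Hw. assert (H2 := Rlt_le_trans _ _ _ Hw (Rmin_l _ _)).
  assert (H3 := Rlt_le_trans _ _ _ Hw (Rmin_r _ _)).
  specialize (H1 w H2).
  replace (f w - f z)%C with ((f w - f z - d * (w - z)) + d * (w - z))%C by ring.
  eapply Rle_lt_trans; [apply Cmod_triangle|]. rewrite Cmod_mult.
  apply Rlt_div_r in H3; [|assumption]. lra.
Qed.

Lemma cdiff_mult (f g : C -> C) (z : C) :
  cdiff f z -> cdiff g z -> cdiff (fun w => f w * g w)%C z.
Proof.
  intros Hf Hg. assert (Cg := cdiff_ccont _ _ Hg).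
  destruct Hf as [d Hf]. destruct Hg as [e Hg].
  exists (d * g z + f z * e)%C. intros eps He.
  set (K := 1 + Cmod d + Cmod (f z) + Cmod (g z)).
  assert (Kd := Cmod_ge_0 d). assert (Kf := Cmod_ge_0 (f z)). assert (Kg := Cmod_ge_0 (g z)).
  assert (K1 : 1 <= K) by (unfold K; lra).
  (* One tolerance for the three error terms below: being at most 1 it keeps |g w| <= K, and each
     term is then at most k K |w - z| with 3 k K <= eps. *)
  assert (Hk : 0 < Rmin 1 (eps / (4 * K))).
  { apply Rmin_pos; [lra|]. apply Rdiv_lt_0_compat; lra. }
  destruct (Hf _ Hk) as [d1 [P1 H1]]. destruct (Hg _ Hk) as [d2 [P2 H2]].
  destruct (Cg _ Hk) as [d3 [P3 H3]].
  exists (Rmin d1 (Rmin d2 d3)). split; [repeat apply Rmin_pos; assumption|].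
  intros w Hw.
  assert (W1 := Rlt_le_trans _ _ _ Hw (Rmin_l _ _)).
  assert (W' := Rlt_le_trans _ _ _ Hw (Rmin_r _ _)).
  assert (W2 := Rlt_le_trans _ _ _ W' (Rmin_l _ _)).
  assert (W3 := Rlt_le_trans _ _ _ W' (Rmin_r _ _)).
  specialize (H1 w W1). specialize (H2 w W2). specialize (H3 w W3).
  set (k := Rmin 1 (eps / (4 * K))) in *.
  assert (k1 : k <= 1) by apply Rmin_l.
  assert (k2 : k * (4 * K) <= eps).
  { apply Rle_div_r; [lra|]. apply Rmin_r. }
  replace (f w * g w - f z * g z - (d * g z + f z * e) * (w - z))%C
    with ((f w - f z - d * (w - z)) * g w + d * (w - z) * (g w - g z)
          + f z * (g w - g z - e * (w - z)))%C by ring.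
  set (r := Cmod (w - z)) in *. assert (Hr : 0 <= r) by apply Cmod_ge_0.
  eapply Rle_trans; [apply Cmod_triangle|].
  eapply Rle_trans; [apply Rplus_le_compat_r, Cmod_triangle|].
  rewrite !Cmod_mult. fold r.
  assert (Gw : Cmod (g w) <= K).
  { assert (X := Cmod_triangle_inv (g w) (g z)). unfold K. lra. }
  assert (T1 : Cmod (f w - f z - d * (w - z)) * Cmod (g w) <= k * r * K)
    by (apply Rmult_le_compat; auto using Cmod_ge_0).
  assert (T2 : Cmod d * r * Cmod (g w - g z) <= K * r * k).
  { apply Rmult_le_compat; try lra; auto using Cmod_ge_0; try nra.
    apply Rmult_le_compat_r; unfold K; lra. }
  assert (T3 : Cmod (f z) * Cmod (g w - g z - e * (w - z)) <= K * (k * r)).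
  { apply Rmult_le_compat; auto using Cmod_ge_0. unfold K; lra. }
  apply Rle_trans with (3 * (k * K) * r); [lra|].
  apply Rmult_le_compat_r; nra.
Qed.

Lemma cdiff_Cexp_lin (c z : C) : cdiff (fun w => Cexp (c * w)) z.
Proof.
  exists (c * Cexp (c * z))%C. intros eps He.
  set (M := 1 + Cmod c). assert (Hc := Cmod_ge_0 c).
  set (A := 16 * (M * M) * Cmod (Cexp (c * z)) + 1).
  assert (HA : 0 < A). { unfold A. assert (0 <= Cmod (Cexp (c * z))) by apply Cmod_ge_0.
    assert (0 <= M * M) by nra. nra. }
  exists (Rmin (1 / (2 * M)) (eps / A)). split.
  { apply Rmin_pos; apply Rdiv_lt_0_compat; unfold M; lra. }
  intros w Hw.
  assert (W1 := Rlt_le_trans _ _ _ Hw (Rmin_l _ _)).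
  assert (W2 := Rlt_le_trans _ _ _ Hw (Rmin_r _ _)).
  apply Rlt_div_r in W1; [|unfold M; lra]. apply Rlt_div_r in W2; [|assumption].
  set (r := Cmod (w - z)) in *. assert (Hr : 0 <= r) by apply Cmod_ge_0.
  replace (c * w)%C with (c * z + c * (w - z))%C by ring. rewrite Cexp_plus.
  replace (_ - _ - _)%C with (Cexp (c * z) * (Cexp (c * (w - z)) - 1 - c * (w - z)))%C by ring.
  rewrite Cmod_mult.
  assert (B : Cmod (c * (w - z)) <= M * r).
  { rewrite Cmod_mult. fold r. apply Rmult_le_compat_r; unfold M; lra. }
  assert (H := Cexp_minus_bound (c * (w - z)) ltac:(lra)).
  assert (B2 : Cmod (c * (w - z)) * Cmod (c * (w - z)) <= (M * r) * (M * r))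
    by (apply Rmult_le_compat; auto using Cmod_ge_0).
  apply Rle_trans with (Cmod (Cexp (c * z)) * (16 * ((M * r) * (M * r)))).
  { apply Rmult_le_compat_l; [apply Cmod_ge_0|]. lra. }
  apply Rle_trans with ((r * A) * r).
  { unfold A. assert (0 <= r * r) by nra. nra. }
  apply Rmult_le_compat_r; lra.
Qed.

Lemma exp_monotone (x y : R) : x <= y -> exp x <= exp y.
Proof. intros [H | ->]; [left; now apply exp_increasing|lra]. Qed.

(** * Bisection of rectangles *)

Lemma nested_intervals (u v : nat -> R) :
  (forall n, u n <= u (S n)) -> (forall n, v (S n) <= v n) -> (forall n, u n <= v n) ->
  exists x, forall n, u n <= x <= v n.
Proof.
  intros Hu Hv Huv.
  assert (Mu : forall n m, (n <= m)%nat -> u n <= u m).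
  { intros n m H. induction H; [lra|]. apply Rle_trans with (1 := IHle), Hu. }
  assert (Mv : forall n m, (n <= m)%nat -> v m <= v n).
  { intros n m H. induction H; [lra|]. apply Rle_trans with (2 := IHle), Hv. }
  assert (B : forall n m, u n <= v m).
  { intros n m. destruct (Nat.le_ge_cases n m) as [H|H].
    - apply Rle_trans with (u m); auto.
    - apply Rle_trans with (v n); auto. }
  destruct (completeness (fun x => exists n, x = u n)) as [x [H1 H2]].
  - exists (v 0%nat). intros t [n ->]. apply B.
  - exists (u 0%nat), 0%nat. reflexivity.
  - exists x. intros n. split.
    + apply H1. now exists n.
    + apply H2. intros t [m ->]. apply B.
Qed.

Lemma pow_half_small (A delta : R) : 0 < delta -> exists n, A / 2 ^ n < delta.
Proof.
  intros Hd.
  destruct (Pow_x_infinity 2) with (b := Rabs A / delta + 1) as [n Hn].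
  { rewrite Rabs_right; lra. }
  exists n. specialize (Hn n (le_n _)).
  assert (P : 0 < 2 ^ n) by (apply pow_lt; lra).
  rewrite Rabs_right in Hn by lra.
  apply Rlt_div_l; [assumption|].
  assert (A <= Rabs A) by apply Rle_abs.
  assert (Rabs A / delta < 2 ^ n) by lra. apply Rlt_div_l in H0; lra.
Qed.

(** Compactness by bisection: if [P] failed, some quarter would fail again, and the nested failing
    rectangles would shrink to a point at which the local hypothesis applies. It serves for Cauchy's
    theorem, for boundedness on rectangles and for functions with zero derivative. *)
Lemma rect_bisection (P : R -> R -> R -> R -> Prop) (a b c d : R) :
  a <= b -> c <= d ->
  (forall a' b' c' d', a <= a' -> a' <= b' -> b' <= b -> c <= c' -> c' <= d' -> d' <= d ->
    P a' ((a' + b') / 2) c' ((c' + d') / 2) -> P ((a' + b') / 2) b' c' ((c' + d') / 2) ->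
    P a' ((a' + b') / 2) ((c' + d') / 2) d' -> P ((a' + b') / 2) b' ((c' + d') / 2) d' ->
    P a' b' c' d') ->
  (forall x y, a <= x <= b -> c <= y <= d -> exists delta, 0 < delta /\
    forall a' b' c' d', a <= a' <= x -> x <= b' <= b -> c <= c' <= y -> y <= d' <= d ->
      b' - a' < delta -> d' - c' < delta -> P a' b' c' d') ->
  P a b c d.
Proof.
  intros Hab Hcd Hsub Hloc. apply NNPP. intros HP.
  set (Q := fun s : R * R * R * R => let '(a, b, c, d) := s in P a b c d).
  (* A failing quarter is selected; the fourth one is taken without a test, because it must fail
     when the other three satisfy [P]. *)
  set (step := fun s : R * R * R * R => let '(a, b, c, d) := s in
    let m := (a + b) / 2 in let n := (c + d) / 2 in
    if excluded_middle_informative (P a m c n) then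
    if excluded_middle_informative (P m b c n) then
    if excluded_middle_informative (P a m n d) then (m, b, n, d)
    else (a, m, n, d) else (m, b, c, n) else (a, m, c, n)).
  set (s := fix s n := match n with O => (a, b, c, d) | S n => step (s n) end).
  set (A := fun n => fst (fst (fst (s n)))). set (B := fun n => snd (fst (fst (s n)))).
  set (U := fun n => snd (fst (s n))). set (V := fun n => snd (s n)).
  assert (Inv : forall n, ~ P (A n) (B n) (U n) (V n) /\ a <= A n /\ A n <= B n /\ B n <= b
    /\ c <= U n /\ U n <= V n /\ V n <= d /\ B n - A n = (b - a) / 2 ^ n
    /\ V n - U n = (d - c) / 2 ^ n /\ A n <= A (S n) /\ B (S n) <= B n
    /\ U n <= U (S n) /\ V (S n) <= V n).
  { induction n as [|n IH].
    - unfold A, B, U, V. simpl.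
      repeat destruct excluded_middle_informative; simpl; repeat split; try assumption; try lra.
    - destruct IH as (I1 & I2 & I3 & I4 & I5 & I6 & I7 & I8 & I9 & I10).
      assert (Hs := Hsub _ _ _ _ I2 I3 I4 I5 I6 I7).
      assert (St : forall m, s (S m) = step (s m)) by reflexivity.
      assert (Gen : forall s0, let '(a1, b1, c1, d1) := s0 in a1 <= b1 -> c1 <= d1 ->
        let '(a2, b2, c2, d2) := step s0 in
        a1 <= a2 /\ b2 <= b1 /\ c1 <= c2 /\ d2 <= d1 /\ b2 - a2 = (b1 - a1) / 2
        /\ d2 - c2 = (d1 - c1) / 2).
      { intros [[[a1 b1] c1] d1] X1 X2. simpl.
        repeat destruct excluded_middle_informative; repeat split; lra. }
      assert (G1 := Gen (s n)). assert (G2 := Gen (s (S n))). rewrite <- St in G1, G2.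
      assert (NP : ~ Q (s (S n))).
      { rewrite St. unfold A, B, U, V in I1, Hs.
        destruct (s n) as [[[a1 b1] c1] d1]. simpl in I1, Hs |- *.
        repeat destruct excluded_middle_informative; simpl; tauto. }
      unfold A, B, U, V in *.
      destruct (s n) as [[[a1 b1] c1] d1]. destruct (s (S n)) as [[[a2 b2] c2] d2].
      destruct (s (S (S n))) as [[[a3 b3] c3] d3]. simpl in *.
      specialize (G1 I3 I6). decompose [and] G1.
      assert (Y1 : b2 - a2 = (b - a) / (2 * 2 ^ n)).
      { rewrite H3, I8. field. apply pow_nonzero; lra. }
      assert (Y2 : d2 - c2 = (d - c) / (2 * 2 ^ n)).
      { rewrite H5, I9. field. apply pow_nonzero; lra. }
      assert (G2' := G2 ltac:(lra) ltac:(lra)).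
      repeat split; tauto || lra. }
  destruct (nested_intervals A B) as [x Hx]; try (intros n; apply (Inv n)).
  destruct (nested_intervals U V) as [y Hy]; try (intros n; apply (Inv n)).
  assert (Hx0 := Hx 0%nat). assert (Hy0 := Hy 0%nat).
  destruct (Hloc x y Hx0 Hy0) as [delta [Hd H]].
  destruct (pow_half_small (Rmax (b - a) (d - c)) delta Hd) as [n Hn].
  assert (P2 : 0 < / 2 ^ n) by (apply Rinv_0_lt_compat, pow_lt; lra).
  specialize (Hx n). specialize (Hy n).
  destruct (Inv n) as (I1 & I2 & I3 & I4 & I5 & I6 & I7 & I8 & I9 & I10).
  apply I1, H; try lra.
  - rewrite I8. eapply Rle_lt_trans; [|exact Hn].
    apply Rmult_le_compat_r; [lra|]. apply Rmax_l.
  - rewrite I9. eapply Rle_lt_trans; [|exact Hn].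
    apply Rmult_le_compat_r; [lra|]. apply Rmax_r.
Qed.

(** * Integrals of complex-valued functions *)

Definition CInt (f : R -> C) (a b : R) : C := @RInt C_R_CompleteNormedModule f a b.
Definition ex_CInt (f : R -> C) (a b : R) : Prop := @ex_RInt C_R_NormedModule f a b.
Definition is_CInt (f : R -> C) (a b : R) (l : C) : Prop := @is_RInt C_R_NormedModule f a b l.

Lemma CInt_correct f a b : ex_CInt f a b -> is_CInt f a b (CInt f a b).
Proof. apply (@RInt_correct C_R_CompleteNormedModule). Qed.

Lemma is_CInt_unique f a b l : is_CInt f a b l -> CInt f a b = l.
Proof. apply (@is_RInt_unique C_R_CompleteNormedModule). Qed.

Lemma is_CInt_components f a b (l : C) :
  is_RInt (fun x => Re (f x)) a b (Re l) -> is_RInt (fun x => Im (f x)) a b (Im l) ->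
  is_CInt f a b l.
Proof.
  destruct l as [l1 l2]. intros H1 H2.
  apply (@is_RInt_fct_extend_pair R_NormedModule R_NormedModule f a b l1 l2 H1 H2).
Qed.

Lemma is_CInt_Re f a b (l : C) : is_CInt f a b l -> is_RInt (fun x => Re (f x)) a b (Re l).
Proof. apply (@is_RInt_fct_extend_fst R_NormedModule R_NormedModule). Qed.

Lemma is_CInt_Im f a b (l : C) : is_CInt f a b l -> is_RInt (fun x => Im (f x)) a b (Im l).
Proof. apply (@is_RInt_fct_extend_snd R_NormedModule R_NormedModule). Qed.

Lemma is_CInt_plus f g a b l m : is_CInt f a b l -> is_CInt g a b m ->
  is_CInt (fun x => f x + g x)%C a b (l + m)%C.
Proof. apply (@is_RInt_plus C_R_NormedModule). Qed.

Lemma is_CInt_minus f g a b l m : is_CInt f a b l -> is_CInt g a b m ->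
  is_CInt (fun x => f x - g x)%C a b (l - m)%C.
Proof. apply (@is_RInt_minus C_R_NormedModule). Qed.

(** A complex factor is not a scalar of the real module in which the integral is taken, so real and
    imaginary parts are recombined by hand. *)
Lemma is_CInt_scal (k : C) f a b l : is_CInt f a b l -> is_CInt (fun x => k * f x)%C a b (k * l)%C.
Proof.
  intros H. assert (H1 := is_CInt_Re _ _ _ _ H). assert (H2 := is_CInt_Im _ _ _ _ H).
  apply is_CInt_components.
  - apply (is_RInt_minus (fun x => scal (Re k) (Re (f x))) (fun x => scal (Im k) (Im (f x)))
      a b (scal (Re k) (Re l)) (scal (Im k) (Im l))); apply (@is_RInt_scal R_NormedModule); assumption.
  - apply (is_RInt_plus (fun x => scal (Re k) (Im (f x))) (fun x => scal (Im k) (Re (f x)))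
      a b (scal (Re k) (Im l)) (scal (Im k) (Re l))); apply (@is_RInt_scal R_NormedModule); assumption.
Qed.

Lemma is_CInt_Chasles f a b c l m : is_CInt f a b l -> is_CInt f b c m -> is_CInt f a c (l + m)%C.
Proof. apply (@is_RInt_Chasles C_R_NormedModule). Qed.

Lemma is_CInt_ext f g a b l : a <= b -> (forall x, a <= x <= b -> f x = g x) ->
  is_CInt f a b l -> is_CInt g a b l.
Proof.
  intros Hab H. apply (@is_RInt_ext C_R_NormedModule). intros x Hx.
  rewrite Rmin_left, Rmax_right in Hx by assumption. apply H. lra.
Qed.

Lemma is_CInt_bound f g a b l m : a <= b -> (forall x, a <= x <= b -> Cmod (f x) <= g x) ->
  is_CInt f a b l -> is_RInt g a b m -> Cmod l <= m.
Proof.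
  intros Hab H H1 H2. rewrite Cmod_norm.
  apply (@norm_RInt_le C_R_NormedModule f g a b l m Hab); try assumption.
  intros x Hx. eapply Rle_trans; [right; symmetry; apply Cmod_norm|auto].
Qed.

Lemma is_CInt_bound_const f M a b l : a <= b -> (forall x, a <= x <= b -> Cmod (f x) <= M) ->
  is_CInt f a b l -> Cmod l <= (b - a) * M.
Proof.
  intros Hab H H1. apply is_CInt_bound with f (fun _ => M) a b; trivial.
  apply (@is_RInt_const R_NormedModule).
Qed.

Lemma is_CInt_const a b k : is_CInt (fun _ => k) a b (RtoC (b - a) * k)%C.
Proof.
  apply is_CInt_components.
  - replace (Re (RtoC (b - a) * k)) with (scal (b - a) (Re k)); [apply (@is_RInt_const R_NormedModule)|].
    unfold Re, Im, scal; simpl; unfold mult; simpl; ring.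
  - replace (Im (RtoC (b - a) * k)) with (scal (b - a) (Im k)); [apply (@is_RInt_const R_NormedModule)|].
    unfold Re, Im, scal; simpl; unfold mult; simpl; ring.
Qed.

Lemma is_CInt_translate f a b v l :
  is_CInt f (a + v) (b + v) l -> is_CInt (fun x => f (x + v)) a b l.
Proof.
  intros H.
  assert (X := @is_RInt_comp_lin C_R_NormedModule f 1 v a b l).
  rewrite !Rmult_1_l in X. specialize (X H).
  eapply (@is_RInt_ext C_R_NormedModule); [|exact X].
  intros x _. simpl. rewrite Rmult_1_l. apply (@scal_one R_Ring C_R_ModuleSpace).
Qed.

Lemma is_CInt_derive (F f : R -> C) a b :
  (forall x, is_derive (fun t => Re (F t)) x (Re (f x))) ->
  (forall x, is_derive (fun t => Im (F t)) x (Im (f x))) ->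
  (forall x, continuous (fun t => Re (f t)) x) ->
  (forall x, continuous (fun t => Im (f t)) x) ->
  is_CInt f a b (F b - F a)%C.
Proof.
  intros H1 H2 H3 H4. apply is_CInt_components.
  - apply (is_RInt_derive (fun t => Re (F t)) (fun t => Re (f t))); auto.
  - apply (is_RInt_derive (fun t => Im (F t)) (fun t => Im (f t))); auto.
Qed.

Definition rcont (f : R -> C) (x : R) : Prop :=
  forall eps, 0 < eps -> exists delta, 0 < delta /\
    forall t, Rabs (t - x) < delta -> Cmod (f t - f x) < eps.

Lemma ex_CInt_rcont f a b : a <= b -> (forall x, a <= x <= b -> rcont f x) -> ex_CInt f a b.
Proof.
  intros Hab H. apply (@ex_RInt_continuous C_R_CompleteNormedModule).
  rewrite Rmin_left, Rmax_right by assumption. intros x Hx P [eps HP].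
  destruct (H x Hx eps (cond_pos eps)) as [delta [Hd H1]].
  exists (mkposreal delta Hd). intros t Ht. apply HP. specialize (H1 t Ht).
  split.
  - eapply Rle_lt_trans; [|exact H1]. eapply Rle_trans; [|apply re_le_Cmod]. right. reflexivity.
  - eapply Rle_lt_trans; [|exact H1]. eapply Rle_trans; [|apply im_le_Cmod]. right. reflexivity.
Qed.

Lemma rcont_comp (F : C -> C) (l : R -> C) (x : R) :
  ccont F (l x) -> (forall t, Cmod (l t - l x) <= Rabs (t - x)) -> rcont (fun t => F (l t)) x.
Proof.
  intros H Hl eps He. destruct (H eps He) as [delta [Hd H1]].
  exists delta. split; [assumption|]. intros t Ht. apply H1.
  eapply Rle_lt_trans; [apply Hl|assumption].
Qed.

Lemma rcont_horizontal (F : C -> C) (x y : R) : ccont F (x, y) -> rcont (fun t => F (t, y)) x.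
Proof.
  intros H. apply (rcont_comp F (fun t => (t, y))); trivial. intros t.
  replace ((t, y) - (x, y))%C with (RtoC (t - x)) by (apply C_eq; simpl; ring).
  rewrite Cmod_R. lra.
Qed.

Lemma rcont_vertical (F : C -> C) (x y : R) : ccont F (x, y) -> rcont (fun t => F (x, t)) y.
Proof.
  intros H. apply (rcont_comp F (fun t => (x, t))); trivial. intros t.
  replace ((x, t) - (x, y))%C with (RtoC (t - y) * Ci)%C by (apply C_eq; simpl; ring).
  rewrite Cmod_mult, Cmod_R, Cmod_Ci. lra.
Qed.

(** * Cauchy's theorem for rectangles *)

Definition boundary_integral (F : C -> C) (a b c d : R) : C :=
  (CInt (fun x => F (x, c)) a b + Ci * CInt (fun y => F (b, y)) c d
   - CInt (fun x => F (x, d)) a b - Ci * CInt (fun y => F (a, y)) c d)%C.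

Lemma is_CInt_affine_horizontal (p q : C) (a b y : R) :
  is_CInt (fun x => p + q * (x, y))%C a b
    (p * (b, y) + q * (b, y) * (b, y) / 2 - (p * (a, y) + q * (a, y) * (a, y) / 2))%C.
Proof.
  destruct p as [p1 p2], q as [q1 q2].
  set (F := fun t => (p1 * t + (q1 * (t * t) / 2 - q2 * (t * y)),
                      p2 * t + (q1 * (t * y) + q2 * (t * t) / 2)) : C).
  replace (_ - _)%C with (F b - F a)%C.
  2:{ unfold F. apply C_eq; simpl; field. }
  apply (is_CInt_derive F); unfold F; simpl; intros x.
  - auto_derive; trivial. field.
  - auto_derive; trivial. field.
  - apply (@ex_derive_continuous R_AbsRing R_NormedModule). auto_derive; trivial.
  - apply (@ex_derive_continuous R_AbsRing R_NormedModule). auto_derive; trivial.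
Qed.

(** On a vertical segment dz = i dy, so the increment of the primitive p z + q z^2/2 is multiplied
    by 1/i = -i. *)
Lemma is_CInt_affine_vertical (p q : C) (x c d : R) :
  is_CInt (fun y => p + q * (x, y))%C c d
    (- Ci * (p * (x, d) + q * (x, d) * (x, d) / 2 - (p * (x, c) + q * (x, c) * (x, c) / 2)))%C.
Proof.
  destruct p as [p1 p2], q as [q1 q2].
  set (F := fun t => (p1 * t + (q1 * (x * t) - q2 * (t * t) / 2),
                      p2 * t + (q1 * (t * t) / 2 + q2 * (x * t))) : C).
  replace (- Ci * _)%C with (F d - F c)%C.
  2:{ unfold F. apply C_eq; simpl; field. }
  apply (is_CInt_derive F); unfold F; simpl; intros t.
  - auto_derive; trivial. field.
  - auto_derive; trivial. field.
  - apply (@ex_derive_continuous R_AbsRing R_NormedModule). auto_derive; trivial.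
  - apply (@ex_derive_continuous R_AbsRing R_NormedModule). auto_derive; trivial.
Qed.

Section Rectangle.

Variables (F : C -> C) (a b c d : R).
Hypothesis HF : forall x y, a <= x <= b -> c <= y <= d -> cdiff F (x, y).

Lemma ex_CInt_horizontal a' b' y : a <= a' -> a' <= b' -> b' <= b -> c <= y <= d ->
  ex_CInt (fun x => F (x, y)) a' b'.
Proof.
  intros H1 H2 H3 H4. apply ex_CInt_rcont; trivial. intros x Hx.
  apply rcont_horizontal, cdiff_ccont, HF; lra.
Qed.

Lemma ex_CInt_vertical c' d' x : c <= c' -> c' <= d' -> d' <= d -> a <= x <= b ->
  ex_CInt (fun y => F (x, y)) c' d'.
Proof.
  intros H1 H2 H3 H4. apply ex_CInt_rcont; trivial. intros y Hy.
  apply rcont_vertical, cdiff_ccont, HF; lra.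
Qed.

Lemma CInt_horizontal_split a' m b' y : a <= a' -> a' <= m -> m <= b' -> b' <= b -> c <= y <= d ->
  CInt (fun x => F (x, y)) a' b' = (CInt (fun x => F (x, y)) a' m + CInt (fun x => F (x, y)) m b')%C.
Proof.
  intros. apply is_CInt_unique, is_CInt_Chasles with m; apply CInt_correct, ex_CInt_horizontal; lra.
Qed.

Lemma CInt_vertical_split c' m d' x : c <= c' -> c' <= m -> m <= d' -> d' <= d -> a <= x <= b ->
  CInt (fun y => F (x, y)) c' d' = (CInt (fun y => F (x, y)) c' m + CInt (fun y => F (x, y)) m d')%C.
Proof.
  intros. apply is_CInt_unique, is_CInt_Chasles with m; apply CInt_correct, ex_CInt_vertical; lra.
Qed.

(** An affine function has a primitive, so its contributions to the four sides cancel; only the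
    deviation [M] times the perimeter remains. *)
Lemma boundary_integral_small (a' b' c' d' M : R) (p q : C) :
  a <= a' -> a' <= b' -> b' <= b -> c <= c' -> c' <= d' -> d' <= d ->
  (forall x y, a' <= x <= b' -> c' <= y <= d' -> Cmod (F (x, y) - (p + q * (x, y)))%C <= M) ->
  Cmod (boundary_integral F a' b' c' d') <= 2 * ((b' - a') + (d' - c')) * M.
Proof.
  intros Ha Hab Hb Hc Hcd Hd HM. unfold boundary_integral.
  assert (X1 := CInt_correct _ _ _ (ex_CInt_horizontal a' b' c' ltac:(lra) ltac:(lra) ltac:(lra) ltac:(lra))).
  assert (X2 := CInt_correct _ _ _ (ex_CInt_horizontal a' b' d' ltac:(lra) ltac:(lra) ltac:(lra) ltac:(lra))).
  assert (X3 := CInt_correct _ _ _ (ex_CInt_vertical c' d' a' ltac:(lra) ltac:(lra) ltac:(lra) ltac:(lra))).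
  assert (X4 := CInt_correct _ _ _ (ex_CInt_vertical c' d' b' ltac:(lra) ltac:(lra) ltac:(lra) ltac:(lra))).
  assert (Y1 := is_CInt_minus _ _ _ _ _ _ X1 (is_CInt_affine_horizontal p q a' b' c')).
  assert (Y2 := is_CInt_minus _ _ _ _ _ _ X2 (is_CInt_affine_horizontal p q a' b' d')).
  assert (Y3 := is_CInt_minus _ _ _ _ _ _ X3 (is_CInt_affine_vertical p q a' c' d')).
  assert (Y4 := is_CInt_minus _ _ _ _ _ _ X4 (is_CInt_affine_vertical p q b' c' d')).
  apply is_CInt_bound_const with (M := M) in Y1; [|lra|intros; apply HM; lra].
  apply is_CInt_bound_const with (M := M) in Y2; [|lra|intros; apply HM; lra].
  apply is_CInt_bound_const with (M := M) in Y3; [|lra|intros; apply HM; lra].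
  apply is_CInt_bound_const with (M := M) in Y4; [|lra|intros; apply HM; lra].
  set (I1 := CInt (fun x => F (x, c')) a' b') in *.
  set (I2 := CInt (fun x => F (x, d')) a' b') in *.
  set (I3 := CInt (fun y => F (a', y)) c' d') in *.
  set (I4 := CInt (fun y => F (b', y)) c' d') in *.
  set (G := fun z => (p * z + q * z * z / 2)%C).
  change (Cmod (I1 - (G (b', c') - G (a', c')))%C <= (b' - a') * M) in Y1.
  change (Cmod (I2 - (G (b', d') - G (a', d')))%C <= (b' - a') * M) in Y2.
  change (Cmod (I3 - (- Ci * (G (a', d') - G (a', c'))))%C <= (d' - c') * M) in Y3.
  change (Cmod (I4 - (- Ci * (G (b', d') - G (b', c'))))%C <= (d' - c') * M) in Y4.
  assert (II : (Ci * Ci = - (1))%C) by (apply C_eq; simpl; ring).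
  replace (I1 + Ci * I4 - I2 - Ci * I3)%C with
    ((I1 - (G (b', c') - G (a', c'))) + Ci * (I4 - (- Ci * (G (b', d') - G (b', c'))))
     - (I2 - (G (b', d') - G (a', d'))) - Ci * (I3 - (- Ci * (G (a', d') - G (a', c')))))%C.
  2:{ ring_simplify. replace (Ci ^ 2)%C with (- (1))%C; [ring|]. rewrite <- II. simpl. ring. }
  unfold Cminus at 1 2. eapply Rle_trans; [apply Cmod_triangle|].
  eapply Rle_trans; [apply Rplus_le_compat_r, Cmod_triangle|].
  eapply Rle_trans; [apply Rplus_le_compat_r, Rplus_le_compat_r, Cmod_triangle|].
  rewrite !Cmod_opp, !Cmod_mult, !Cmod_Ci. lra.
Qed.

(** The bisected property is |integral| <= eps s^2 with s the half perimeter. Under bisection the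
    inner sides cancel and s^2 falls to a quarter, so four quarters add up to the whole; near a
    point the derivative supplies an affine approximation with error (eps/2) s. *)
Theorem goursat : a <= b -> c <= d -> boundary_integral F a b c d = 0.
Proof.
  intros Hab Hcd. apply Cmod_eq_0.
  assert (H : forall eps, 0 < eps ->
    Cmod (boundary_integral F a b c d) <= eps * (((b - a) + (d - c)) * ((b - a) + (d - c)))).
  { intros eps He.
    apply (rect_bisection (fun a b c d => Cmod (boundary_integral F a b c d)
             <= eps * (((b - a) + (d - c)) * ((b - a) + (d - c))))); trivial.
    - intros a' b' c' d' H1 H2 H3 H4 H5 H6.
      set (m := (a' + b') / 2). set (n := (c' + d') / 2).
      assert (m1 : m - a' = (b' - a') / 2) by (unfold m; field).
      assert (m2 : b' - m = (b' - a') / 2) by (unfold m; field).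
      assert (n1 : n - c' = (d' - c') / 2) by (unfold n; field).
      assert (n2 : d' - n = (d' - c') / 2) by (unfold n; field).
      rewrite m1, m2, n1, n2. intros K1 K2 K3 K4.
      replace (boundary_integral F a' b' c' d') with
        (boundary_integral F a' m c' n + boundary_integral F m b' c' n
         + boundary_integral F a' m n d' + boundary_integral F m b' n d')%C.
      2:{ unfold boundary_integral.
          rewrite (CInt_horizontal_split a' m b' c'), (CInt_horizontal_split a' m b' d'),
            (CInt_vertical_split c' n d' a'), (CInt_vertical_split c' n d' b') by lra. ring. }
      eapply Rle_trans; [apply Cmod_triangle|].
      eapply Rle_trans; [apply Rplus_le_compat_r, Cmod_triangle|].
      eapply Rle_trans; [apply Rplus_le_compat_r, Rplus_le_compat_r, Cmod_triangle|].
      lra.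
    - intros x y Hx Hy. destruct (HF x y Hx Hy) as [q Hq].
      destruct (Hq (eps / 2) ltac:(lra)) as [delta [Hd H1]].
      exists (delta / 2). split; [lra|].
      intros a' b' c' d' A1 A2 A3 A4 A5 A6.
      set (s := (b' - a') + (d' - c')).
      replace (eps * (s * s)) with (2 * s * (eps / 2 * s)) by field.
      apply boundary_integral_small with (F (x, y) - q * (x, y))%C q; try lra.
      intros x' y' Hx' Hy'.
      assert (D : Cmod ((x', y') - (x, y))%C <= s).
      { eapply Rle_trans; [apply Cmod_le_sum|]. simpl. unfold s.
        apply Rplus_le_compat; apply Rabs_le; lra. }
      replace (F (x', y') - _)%C with (F (x', y') - F (x, y) - q * ((x', y') - (x, y)))%C by ring.
      eapply Rle_trans; [apply H1; unfold s in D; lra|].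
      apply Rmult_le_compat_l; lra. }
  set (S := ((b - a) + (d - c)) * ((b - a) + (d - c))) in *.
  assert (HS : 0 <= S) by (unfold S; nra).
  destruct (Rle_lt_or_eq_dec _ _ (Cmod_ge_0 (boundary_integral F a b c d))) as [P|P]; [|auto].
  specialize (H (Cmod (boundary_integral F a b c d) / (2 * (S + 1)))).
  assert (0 < Cmod (boundary_integral F a b c d) / (2 * (S + 1))) by (apply Rdiv_lt_0_compat; lra).
  specialize (H H0).
  replace (_ / _ * S) with (Cmod (boundary_integral F a b c d) * (S / (2 * (S + 1)))) in H by (field; lra).
  assert (S / (2 * (S + 1)) < 1) by (apply Rlt_div_l; lra). nra.
Qed.

End Rectangle.

Lemma CInt_period_horizontal (F : C -> C) (N a y : R) :
  (forall z, half_plane 0 z -> cdiff F z) -> 0 < N -> 0 < y ->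
  ex_CInt (fun x => F (x, y)) a (a + N).
Proof.
  intros HF HN Hy. apply ex_CInt_rcont; [lra|]. intros x _.
  apply rcont_horizontal, cdiff_ccont, HF. exact Hy.
Qed.

(** In Cauchy's theorem for a rectangle of width [N] the two vertical sides cancel by
    periodicity. *)
Lemma CInt_period_shift (F : C -> C) (N : R) :
  (forall z, half_plane 0 z -> cdiff F z) -> 0 < N ->
  (forall z, half_plane 0 z -> F (z + N)%C = F z) ->
  forall a c d, 0 < c -> 0 < d ->
  CInt (fun x => F (x, c)) a (a + N) = CInt (fun x => F (x, d)) a (a + N).
Proof.
  intros HF HN HP a.
  assert (K : forall c d, 0 < c -> c <= d ->
    CInt (fun x => F (x, c)) a (a + N) = CInt (fun x => F (x, d)) a (a + N)).
  { intros c d Hc Hcd.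
    assert (G : boundary_integral F a (a + N) c d = 0).
    { apply goursat; try lra. intros x y _ Hy. apply HF. unfold half_plane; simpl; lra. }
    unfold boundary_integral in G.
    assert (E : CInt (fun y => F (a + N, y)) c d = CInt (fun y => F (a, y)) c d).
    { apply is_CInt_unique. apply is_CInt_ext with (fun y => F (a, y)); trivial.
      - intros y Hy. rewrite <- HP by (unfold half_plane; simpl; lra).
        f_equal. apply C_eq; simpl; ring.
      - apply CInt_correct, ex_CInt_rcont; trivial. intros y Hy.
        apply rcont_vertical, cdiff_ccont, HF. unfold half_plane; simpl; lra. }
    rewrite E in G.
    match goal with |- ?l = ?r => replace l with (l + (Ci * CInt (fun y => F (a, y)) c d - Ci * CInt (fun y => F (a, y)) c d))%C by ring; replace r with (r + 0)%C by ring; rewrite <- G; ring end. }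
  intros c d Hc Hd. destruct (Rle_dec c d); [auto|].
  symmetry. apply K; lra.
Qed.

(** * Absolutely convergent families *)

Definition csum {T : Type} (F : T -> C) (l : list T) : C := fold_right Cplus (RtoC 0) (map F l).
Definition rsum {T : Type} (F : T -> R) (l : list T) : R := fold_right Rplus 0 (map F l).

Lemma csum_app {T} (F : T -> C) l1 l2 : csum F (l1 ++ l2) = (csum F l1 + csum F l2)%C.
Proof. induction l1 as [|x l IH]; unfold csum in *; simpl; [|rewrite IH]; ring. Qed.

Lemma csum_cons {T} (F : T -> C) x l : csum F (x :: l) = (F x + csum F l)%C.
Proof. reflexivity. Qed.

Lemma rsum_cons {T} (F : T -> R) x l : rsum F (x :: l) = F x + rsum F l.
Proof. reflexivity. Qed.

Lemma csum_bound {T} (F : T -> C) l : Cmod (csum F l) <= rsum (fun x => Cmod (F x)) l.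
Proof.
  induction l as [|x l IH]; unfold csum, rsum in *; simpl; [rewrite Cmod_0; lra|].
  eapply Rle_trans; [apply Cmod_triangle|]. lra.
Qed.

Lemma rsum_le {T} (F G : T -> R) l : (forall x, In x l -> F x <= G x) -> rsum F l <= rsum G l.
Proof.
  induction l as [|x l IH]; intros H; unfold rsum in *; simpl; [lra|].
  apply Rplus_le_compat; [apply H; now left|]. apply IH. intros y Hy; apply H; now right.
Qed.

Lemma rsum_ge_0 {T} (F : T -> R) l : (forall x, In x l -> 0 <= F x) -> 0 <= rsum F l.
Proof.
  induction l as [|x l IH]; intros H; unfold rsum in *; simpl; [lra|].
  apply Rplus_le_le_0_compat; [apply H; now left|]. apply IH. intros y Hy; apply H; now right.
Qed.

Lemma csum_scal {T} (F : T -> C) k l : csum (fun x => k * F x)%C l = (k * csum F l)%C.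
Proof. induction l as [|x l IH]; unfold csum in *; simpl; [|rewrite IH]; ring. Qed.

Lemma csum_ext {T} (F G : T -> C) l : (forall x, In x l -> F x = G x) -> csum F l = csum G l.
Proof.
  induction l as [|x l IH]; intros H; unfold csum in *; simpl; [reflexivity|].
  rewrite (H x), IH; trivial; [|now left]. intros y Hy; apply H; now right.
Qed.

Definition pbool (P : Prop) : bool := if excluded_middle_informative P then true else false.

Lemma pbool_true (P : Prop) : pbool P = true <-> P.
Proof. unfold pbool. destruct excluded_middle_informative; split; auto; discriminate. Qed.

Lemma pbool_false (P : Prop) : pbool P = false <-> ~ P.
Proof. unfold pbool. destruct excluded_middle_informative; split; auto; tauto || discriminate. Qed.

Definition sel (P : R -> Prop) (l : list R) : list R := filter (fun x => pbool (P x)) l.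

Lemma sel_In P l x : In x (sel P l) <-> In x l /\ P x.
Proof. unfold sel. rewrite filter_In, pbool_true. tauto. Qed.

Lemma sel_NoDup P l : NoDup l -> NoDup (sel P l).
Proof. apply NoDup_filter. Qed.

Lemma csum_sel (F : R -> C) P l : csum F l = (csum F (sel P l) + csum F (sel (fun x => ~ P x) l))%C.
Proof.
  induction l as [|x l IH]; [unfold csum; simpl; ring|].
  rewrite csum_cons, IH. unfold sel. simpl.
  destruct (pbool (P x)) eqn:E1; destruct (pbool (~ P x)) eqn:E2;
    rewrite ?csum_cons; try ring; exfalso;
    apply (proj1 (pbool_true _)) in E1 || apply (proj1 (pbool_false _)) in E1;
    apply (proj1 (pbool_true _)) in E2 || apply (proj1 (pbool_false _)) in E2; tauto.
Qed.

Lemma rsum_sel (F : R -> R) P l : rsum F l = rsum F (sel P l) + rsum F (sel (fun x => ~ P x) l).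
Proof.
  induction l as [|x l IH]; [unfold rsum; simpl; ring|].
  rewrite rsum_cons, IH. unfold sel. simpl.
  destruct (pbool (P x)) eqn:E1; destruct (pbool (~ P x)) eqn:E2;
    rewrite ?rsum_cons; try ring; exfalso;
    apply (proj1 (pbool_true _)) in E1 || apply (proj1 (pbool_false _)) in E1;
    apply (proj1 (pbool_true _)) in E2 || apply (proj1 (pbool_false _)) in E2; tauto.
Qed.

Lemma csum_nonmember (F : R -> C) l l0 : NoDup l0 -> NoDup l -> incl l0 l ->
  csum F l = (csum F l0 + csum F (sel (fun x => ~ In x l0) l))%C.
Proof.
  intros H0 H. revert l H. induction H0 as [|x l0 Hx H0 IH]; intros l H Hi.
  - replace (sel _ l) with l; [unfold csum; simpl; ring|].
    clear. induction l as [|x l IH]; [reflexivity|]. unfold sel in *. cbn [filter].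
    destruct (pbool _) eqn:E; [now rewrite <- IH|]. apply (proj1 (pbool_false _)) in E. simpl in E. tauto.
  - destruct (in_split x l) as [l1 [l2 ->]]; [apply Hi; now left|].
    assert (H' := NoDup_remove_1 _ _ _ H). assert (Hn := NoDup_remove_2 _ _ _ H).
    assert (Hi' : incl l0 (l1 ++ l2)).
    { intros y Hy. assert (Hy' := Hi y (or_intror Hy)). apply in_app_iff in Hy'.
      apply in_app_iff. simpl in Hy'. destruct Hy' as [?|[<-|?]]; tauto. }
    rewrite csum_app, csum_cons.
    transitivity (F x + csum F (l1 ++ l2))%C; [rewrite csum_app; ring|].
    rewrite (IH _ H' Hi'), csum_cons.
    replace (sel (fun y => ~ In y (x :: l0)) (l1 ++ x :: l2))
      with (sel (fun y => ~ In y l0) (l1 ++ l2)); [ring|].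
    unfold sel. rewrite !filter_app. simpl.
    destruct (pbool _) eqn:E; [apply (proj1 (pbool_true _)) in E; simpl in E; tauto|].
    f_equal; apply filter_ext_in; intros y Hy.
    + destruct (pbool (~ In y l0)) eqn:E1; symmetry; [apply pbool_true|apply pbool_false].
      * apply (proj1 (pbool_true _)) in E1. simpl. intros [->|K]; [|tauto]. apply Hn, in_app_iff. tauto.
      * apply (proj1 (pbool_false _)) in E1. simpl. tauto.
    + destruct (pbool (~ In y l0)) eqn:E1; symmetry; [apply pbool_true|apply pbool_false].
      * apply (proj1 (pbool_true _)) in E1. simpl. intros [->|K]; [|tauto]. apply Hn, in_app_iff. tauto.
      * apply (proj1 (pbool_false _)) in E1. simpl. tauto.
Qed.

Lemma is_sum_over_nodup P F s : is_sum_over P F s -> forall eps, 0 < eps -> exists l0,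
  NoDup l0 /\ (forall x, In x l0 -> P x) /\
  forall l, NoDup l -> (forall x, In x l -> P x) -> incl l0 l -> Cmod (csum F l - s) < eps.
Proof.
  intros H eps He. destruct (H (mkposreal eps He)) as [l0 [H1 H2]].
  exists (nodup Req_EM_T l0). split; [apply NoDup_nodup|]. split.
  - intros x Hx. apply nodup_In in Hx. auto.
  - intros l L1 L2 L3. apply H2; trivial. intros x Hx. apply L3. now apply nodup_In.
Qed.

Lemma Re_csum {T} (F : T -> C) l : Re (csum F l) = rsum (fun x => Re (F x)) l.
Proof. induction l as [|x l IH]; [reflexivity|]. rewrite csum_cons, rsum_cons, <- IH. reflexivity. Qed.

Lemma Im_csum {T} (F : T -> C) l : Im (csum F l) = rsum (fun x => Im (F x)) l.
Proof. induction l as [|x l IH]; [reflexivity|]. rewrite csum_cons, rsum_cons, <- IH. reflexivity. Qed.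

(** The hypothesis is applied to the terms of either sign separately; within each group no
    cancellation occurs. *)
Lemma rsum_abs_le (G : R -> R) (B : R) (l : list R) :
  (forall P, Rabs (rsum G (sel P l)) <= B) -> rsum (fun x => Rabs (G x)) l <= 2 * B.
Proof.
  intros H. rewrite (rsum_sel _ (fun x => 0 <= G x)).
  assert (A : forall (s : R) l, (forall x, In x l -> Rabs (G x) = s * G x) ->
    rsum (fun x => Rabs (G x)) l = s * rsum G l).
  { intros s l'. induction l' as [|x l' IH]; intros H'; [unfold rsum; simpl; ring|].
    rewrite !rsum_cons, IH, H'; [ring|now left|]. intros; apply H'; now right. }
  rewrite (A 1), (A (-1)).
  - assert (H1 := H (fun x => 0 <= G x)). assert (H2 := H (fun x => ~ 0 <= G x)).
    apply Rabs_le_between in H1. apply Rabs_le_between in H2. lra.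
  - intros x Hx. apply sel_In in Hx as [_ Hx]. rewrite Rabs_left; lra.
  - intros x Hx. apply sel_In in Hx as [_ Hx]. rewrite Rabs_right; lra.
Qed.

(** Unordered convergence is absolute. Adding to [l0] any finite set disjoint from it hardly changes
    the sum, so every sublist of [l] has a small sum; splitting by sign turns this into a bound for
    absolute values. A partial-sum error of eps/8 gives eps/4 for sublists, then eps/2 each for real
    and imaginary parts. *)
Lemma is_sum_over_tail P F s : is_sum_over P F s -> forall eps, 0 < eps -> exists l0,
  NoDup l0 /\ (forall x, In x l0 -> P x) /\
  forall l, NoDup l -> (forall x, In x l -> P x) -> (forall x, In x l -> ~ In x l0) ->
    rsum (fun x => Cmod (F x)) l <= eps.
Proof.
  intros H eps He. destruct (is_sum_over_nodup _ _ _ H (eps / 8) ltac:(lra)) as [l0 [N0 [P0 H0]]].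
  exists l0. repeat split; trivial. intros l N1 P1 D1.
  assert (K : forall Q, Cmod (csum F (sel Q l)) <= eps / 4).
  { intros Q.
    replace (csum F (sel Q l)) with ((csum F (l0 ++ sel Q l) - s) - (csum F l0 - s))%C
      by (rewrite csum_app; ring).
    unfold Cminus at 1. eapply Rle_trans; [apply Cmod_triangle|]. rewrite Cmod_opp.
    assert (X1 := H0 l0 N0 P0 (incl_refl _)).
    assert (X2 : Cmod (csum F (l0 ++ sel Q l) - s) < eps / 8).
    { apply H0.
      - apply NoDup_app; trivial; [now apply sel_NoDup|]. intros x Hx Hx'.
        apply sel_In in Hx' as [Hx' _]. now apply (D1 x).
      - intros x Hx. apply in_app_iff in Hx as [Hx|Hx]; [auto|].
        apply sel_In in Hx as [Hx _]. auto.
      - intros x Hx. apply in_app_iff. now left. }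
    lra. }
  assert (K1 : rsum (fun x => Rabs (Re (F x))) l <= 2 * (eps / 4)).
  { apply rsum_abs_le. intros Q. rewrite <- (Re_csum F). eapply Rle_trans; [apply re_le_Cmod|apply K]. }
  assert (K2 : rsum (fun x => Rabs (Im (F x))) l <= 2 * (eps / 4)).
  { apply rsum_abs_le. intros Q. rewrite <- (Im_csum F). eapply Rle_trans; [apply im_le_Cmod|apply K]. }
  apply Rle_trans with (rsum (fun x => Rabs (Re (F x)) + Rabs (Im (F x))) l).
  - apply rsum_le. intros; apply Cmod_le_sum.
  - assert (E : forall l, rsum (fun x => Rabs (Re (F x)) + Rabs (Im (F x))) l =
      rsum (fun x => Rabs (Re (F x))) l + rsum (fun x => Rabs (Im (F x))) l).
    { clear. induction l as [|x l IH]; [unfold rsum; simpl; ring|]. rewrite !rsum_cons, IH. ring. }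
    rewrite E. lra.
Qed.

Lemma exists_superlist (P : R -> Prop) (l1 l2 : list R) :
  (forall x, In x l1 -> P x) -> (forall x, In x l2 -> P x) ->
  exists l, NoDup l /\ (forall x, In x l -> P x) /\ incl l1 l /\ incl l2 l.
Proof.
  intros H1 H2. exists (nodup Req_EM_T (l1 ++ l2)). repeat split.
  - apply NoDup_nodup.
  - intros x Hx. apply nodup_In, in_app_iff in Hx. destruct Hx; auto.
  - intros x Hx. apply nodup_In, in_app_iff. now left.
  - intros x Hx. apply nodup_In, in_app_iff. now right.
Qed.

(** * The characters [exp (2 pi i lambda z)] *)

Definition ee (lambda : R) (z : C) : C := Cexp (2 * PI * Ci * lambda * z)%C.

Lemma ee_arg (lambda : R) (z : C) :
  (2 * PI * Ci * lambda * z)%C = (- 2 * PI * lambda * Im z, 2 * PI * lambda * Re z).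
Proof. apply C_eq; unfold Re, Im; simpl; ring. Qed.

Lemma Cmod_ee (lambda : R) (z : C) : Cmod (ee lambda z) = exp (- 2 * PI * lambda * Im z).
Proof. unfold ee. rewrite Cmod_Cexp, ee_arg. reflexivity. Qed.

Lemma ee_plus_l (l m : R) (z : C) : ee (l + m) z = (ee l z * ee m z)%C.
Proof. unfold ee. rewrite <- Cexp_plus. f_equal. rewrite RtoC_plus. ring. Qed.

Lemma ee_plus_r (l : R) (z w : C) : ee l (z + w) = (ee l z * ee l w)%C.
Proof. unfold ee. rewrite <- Cexp_plus. f_equal. ring. Qed.

Lemma ee_0_l (z : C) : ee 0 z = 1.
Proof. unfold ee. replace (_ * z)%C with (RtoC 0) by ring. apply Cexp_0. Qed.

Lemma ee_0_r (l : R) : ee l 0 = 1.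
Proof. unfold ee. replace (_ * 0)%C with (RtoC 0) by ring. apply Cexp_0. Qed.

Lemma ee_neq_0 (l : R) (z : C) : ee l z <> 0.
Proof. apply Cexp_neq_0. Qed.

Lemma ee_opp_l (l : R) (z : C) : (ee (- l) z * ee l z = 1)%C.
Proof. rewrite <- ee_plus_l, Rplus_opp_l. apply ee_0_l. Qed.

Lemma Cmod_ee_real (l x : R) : Cmod (ee l x) = 1.
Proof. rewrite Cmod_ee. simpl. rewrite Rmult_0_r. apply exp_0. Qed.

Lemma cdiff_ee (l : R) (z : C) : cdiff (ee l) z.
Proof. apply (cdiff_Cexp_lin (2 * PI * Ci * l)). Qed.

Lemma exp_decay (alpha K eps : R) : 0 < alpha -> 0 < eps ->
  exists Y, forall y, Y < y -> K * exp (- (alpha * y)) < eps.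
Proof.
  intros Ha He. exists (Rabs K / (eps * alpha)). intros y Hy.
  apply Rlt_div_l in Hy; [|nra].
  assert (E := exp_ineq1_le (alpha * y)). assert (P := exp_pos (alpha * y)).
  rewrite exp_Ropp. change (K / exp (alpha * y) < eps). apply Rlt_div_l; [assumption|].
  assert (K <= Rabs K) by apply Rle_abs. nra.
Qed.

Lemma ee_components (l x y : R) : ee l (x, y) =
  (exp (- 2 * PI * l * y) * cos (2 * PI * l * x), exp (- 2 * PI * l * y) * sin (2 * PI * l * x)).
Proof. unfold ee. rewrite ee_arg. reflexivity. Qed.

Lemma is_CInt_ee_period (alpha h x0 y : R) : alpha <> 0 -> ee alpha h = 1 ->
  is_CInt (fun x => ee alpha (x, y)) x0 (x0 + h) 0.
Proof.
  intros Ha Hh.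
  assert (P : PI <> 0) by apply PI_neq0.
  set (F := fun t => (Im (ee alpha (t, y)) / (2 * PI * alpha), - Re (ee alpha (t, y)) / (2 * PI * alpha)) : C).
  assert (E : F (x0 + h) = F x0).
  { unfold F. replace (ee alpha (x0 + h, y)) with (ee alpha (x0, y)); [reflexivity|].
    replace (x0 + h, y) with ((x0, y) + h)%C by (apply C_eq; simpl; ring).
    rewrite ee_plus_r, Hh. ring. }
  replace (RtoC 0) with (F (x0 + h)%R - F x0)%C by (rewrite E; ring).
  apply (is_CInt_derive F); intros x; unfold F.
  - apply is_derive_ext with (fun t => (exp (- 2 * PI * alpha * y) * sin (2 * PI * alpha * t)) / (2 * PI * alpha)).
    { intros t. rewrite ee_components. reflexivity. }
    rewrite ee_components. simpl. auto_derive; trivial. field. auto.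
  - apply is_derive_ext with (fun t => - (exp (- 2 * PI * alpha * y) * cos (2 * PI * alpha * t)) / (2 * PI * alpha)).
    { intros t. rewrite ee_components. reflexivity. }
    rewrite ee_components. simpl. auto_derive; trivial. field. auto.
  - apply continuous_ext with (fun t => exp (- 2 * PI * alpha * y) * cos (2 * PI * alpha * t)).
    { intros t. rewrite ee_components. reflexivity. }
    apply (@ex_derive_continuous R_AbsRing R_NormedModule). auto_derive; trivial.
  - apply continuous_ext with (fun t => exp (- 2 * PI * alpha * y) * sin (2 * PI * alpha * t)).
    { intros t. rewrite ee_components. reflexivity. }
    apply (@ex_derive_continuous R_AbsRing R_NormedModule). auto_derive; trivial.
Qed.

Lemma exponents_diff (h : R) (u : C) (l m : R) :
  exponents h u l -> exponents h u m -> ee (l - m) h = 1.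
Proof.
  intros Hl Hm. change (ee l h = u) in Hl. change (ee m h = u) in Hm.
  unfold Rminus. rewrite ee_plus_l, Hl, <- Hm, Cmult_comm. apply ee_opp_l.
Qed.

(** Orthogonality: for two exponents of the same [u] the quotient of the characters has period [h],
    so all terms but the one at [m] integrate to 0. *)
Lemma is_CInt_csum_period (h : R) (u : C) (a : R -> C) (x0 y m : R) (l : list R) :
  NoDup l -> (forall x, In x l -> exponents h u x) -> exponents h u m ->
  is_CInt (fun x => csum (fun k => a k * ee k (x, y)) l * ee (- m) (x, y))%C x0 (x0 + h)
    (if in_dec Req_EM_T m l then h * a m else 0)%C.
Proof.
  intros N P Hm. induction N as [|k l Hk N IH].
  - simpl. apply (@is_RInt_ext C_R_NormedModule (fun _ => RtoC 0)).
    { intros x _. unfold csum; simpl. ring. }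
    assert (E := is_CInt_const x0 (x0 + h) 0). rewrite Cmult_0_r in E. exact E.
  - specialize (IH (fun x Hx => P x (or_intror Hx))).
    assert (K : is_CInt (fun x => a k * ee (k - m) (x, y))%C x0 (x0 + h)
                  (if Req_EM_T k m then h * a m else 0)%C).
    { destruct (Req_EM_T k m) as [->|Hkm].
      - apply (@is_RInt_ext C_R_NormedModule (fun _ => a m)).
        { intros x _. rewrite Rminus_diag, ee_0_l. symmetry; apply Cmult_1_r. }
        assert (E := is_CInt_const x0 (x0 + h) (a m)).
        replace (x0 + h - x0)%R with h in E by ring. exact E.
      - replace (RtoC 0) with (a k * 0)%C by ring. apply is_CInt_scal, is_CInt_ee_period; [lra|].
        apply exponents_diff with u; [apply P; now left|assumption]. }
    assert (S := is_CInt_plus _ _ _ _ _ _ K IH).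
    replace (if in_dec Req_EM_T m (k :: l) then (h * a m)%C else 0%C)
      with ((if Req_EM_T k m then h * a m else 0) + (if in_dec Req_EM_T m l then h * a m else 0))%C.
    + eapply (@is_RInt_ext C_R_NormedModule); [|exact S].
      intros x _. cbv beta. rewrite csum_cons. unfold Rminus. rewrite ee_plus_l. match goal with |- ?p = ?q => change (@eq C p q) end. ring.
    + destruct (in_dec Req_EM_T m (k :: l)) as [I|I]; destruct (Req_EM_T k m) as [E|E];
        destruct (in_dec Req_EM_T m l) as [J|J]; simpl in I; subst; try ring; tauto.
Qed.

(** Uniform convergence along the line is not given but follows from absolute convergence: the
    moduli of the terms do not depend on [x], so a finite set chosen at the single point (0, y)
    controls the tail for all [x]. *)
Lemma expansion_coefficient (g : C -> C) (h : R) (u : C) (a : R -> C) (r x0 y m : R) :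
  quasi_periodic_on r g h u ->
  (forall z, half_plane r z -> is_sum_over (exponents h u) (fun l => a l * ee l z)%C (g z)) ->
  r < y -> exponents h u m ->
  is_CInt (fun x => g (x, y) * ee (- m) (x, y))%C x0 (x0 + h) (h * a m)%C.
Proof.
  intros [Hh [Hu [Hg Hp]]] HS Hy Hm.
  assert (Ex : ex_CInt (fun x => g (x, y) * ee (- m) (x, y))%C x0 (x0 + h)).
  { apply ex_CInt_rcont; [lra|]. intros x _.
    apply (rcont_horizontal (fun z => g z * ee (- m) z)%C), cdiff_ccont, cdiff_mult.
    - apply ex_derive_cdiff, Hg. exact Hy.
    - apply cdiff_ee. }
  apply CInt_correct in Ex.
  replace (h * a m)%C with (CInt (fun x => g (x, y) * ee (- m) (x, y))%C x0 (x0 + h)); [exact Ex|].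
  set (I := CInt _ _ _) in *.
  set (K := exp (2 * PI * m * y)).
  assert (HK : 0 < K) by apply exp_pos.
  assert (B : forall eps, 0 < eps -> Cmod (I - h * a m) <= h * (2 * eps * K)).
  { intros eps He.
    destruct (is_sum_over_tail _ _ _ (HS (0, y) Hy) eps He) as [l0 [N0 [P0 T0]]].
    destruct (exists_superlist (exponents h u) l0 (m :: nil)) as [l1 [N1 [P1 [I1 I2]]]]; trivial.
    { intros x [<-|[]]; assumption. }
    assert (S := is_CInt_csum_period h u a x0 y m l1 N1 P1 Hm).
    destruct (in_dec Req_EM_T m l1) as [J|J]; [|exfalso; apply J, I2; now left].
    assert (D := is_CInt_minus _ _ _ _ _ _ Ex S).
    replace h with (x0 + h - x0) at 2 by ring.
    refine (is_CInt_bound_const _ _ _ _ _ _ _ D); [lra|].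
    intros x Hx.
    replace (_ - _)%C with ((g (x, y) - csum (fun k => a k * ee k (x, y)) l1) * ee (- m) (x, y))%C by ring.
    rewrite Cmod_mult, Cmod_ee. simpl.
    replace (exp _) with K by (unfold K; f_equal; ring).
    apply Rmult_le_compat_r; [lra|].
    (* The set [l2] depends on [x] and only serves to replace g (x, y) by a finite sum; the terms of
       that sum outside [l1] are bounded through [l0], uniformly in [x]. *)
    destruct (is_sum_over_nodup _ _ _ (HS (x, y) Hy) eps He) as [l2 [N2 [P2 T2]]].
    destruct (exists_superlist (exponents h u) l1 l2) as [l3 [N3 [P3 [I3 I4]]]]; trivial.
    specialize (T2 l3 N3 P3 I4).
    assert (E := csum_nonmember (fun k => a k * ee k (x, y))%C l3 l1 N1 N3 I3).
    assert (T : Cmod (csum (fun k => a k * ee k (x, y))%C (sel (fun k => ~ In k l1) l3)) <= eps).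
    { eapply Rle_trans; [apply csum_bound|].
      eapply Rle_trans; [|apply (T0 (sel (fun k => ~ In k l1) l3))].
      - apply rsum_le. intros k _. rewrite !Cmod_mult, !Cmod_ee. simpl. lra.
      - now apply sel_NoDup.
      - intros k Hk. apply sel_In in Hk. apply P3, Hk.
      - intros k Hk. apply sel_In in Hk. intros Hk'. apply (proj2 Hk), I1, Hk'. }
    rewrite Cmod_minus_sym.
    replace (csum (fun k => a k * ee k (x, y))%C l1 - g (x, y))%C with
      ((csum (fun k => a k * ee k (x, y))%C l3 - g (x, y))
        - csum (fun k => a k * ee k (x, y))%C (sel (fun k => ~ In k l1) l3))%C by (rewrite E; ring).
    unfold Cminus at 1. eapply Rle_trans; [apply Cmod_triangle|]. rewrite Cmod_opp. lra. }
  destruct (Req_dec (Cmod (I - h * a m)) 0) as [Z|Z].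
  { apply Cmod_eq_0 in Z. replace I with (I - h * a m + h * a m)%C by ring. rewrite Z. ring. }
  assert (Pz : 0 < Cmod (I - h * a m)) by (generalize (Cmod_ge_0 (I - h * a m)); lra).
  specialize (B (Cmod (I - h * a m) / (4 * (h * K)))).
  assert (hK : 0 < h * K) by (apply Rmult_lt_0_compat; assumption).
  assert (0 < Cmod (I - h * a m) / (4 * (h * K))) by (apply Rdiv_lt_0_compat; lra).
  specialize (B H).
  replace (h * _) with (Cmod (I - h * a m) / 2) in B by (field; lra). lra.
Qed.

(** * Behaviour at infinity *)

Definition bounded_at_infinity (g : C -> C) : Prop :=
  exists K Y : R, forall z, Y < Im z -> Cmod (g z) <= K.

(* [g z ~ b exp (- 2 pi i mu z)] as [Im z] tends to infinity, uniformly in [Re z]. *)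
Definition pole_at_infinity (g : C -> C) (mu : R) (b : C) : Prop :=
  0 < mu /\ b <> 0 /\
  forall eps, 0 < eps -> exists Y, forall z, Y < Im z -> Cmod (g z * ee mu z - b) < eps.

(** Outside the finite list [l] the exponents with nonzero coefficient are nonnegative, so the
    moduli of their terms decrease with Im z, and the absolute sum at the one height [Y] bounds the
    remainder everywhere above. *)
Lemma expansion_principal_part (g : C -> C) (h : R) (u : C) (a : R -> C) :
  is_expansion g h u a -> finitely_many_negative a ->
  exists (l : list R) (K Y : R), NoDup l /\ (forall k, In k l -> k < 0 /\ a k <> 0) /\
    forall z, Y < Im z -> Cmod (g z - csum (fun k => a k * ee k z)%C l) <= K.
Proof.
  intros [r [[Hh [Hu [Hg Hp]]] [H0 HS]]] [ln Hln].
  set (l := sel (fun k => k < 0 /\ a k <> 0) (nodup Req_EM_T ln)).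
  set (Y := Rmax r 0 + 1).
  assert (Yr : r < Y) by (unfold Y; generalize (Rmax_l r 0); lra).
  destruct (is_sum_over_tail _ _ _ (HS (0, Y) Yr) 1 Rlt_0_1) as [l0 [N0 [P0 T0]]].
  set (M := fun k => Cmod (a k * ee k (0, Y))%C).
  assert (Pl : forall k, In k l -> exponents h u k).
  { intros k Hk. apply sel_In in Hk. apply NNPP. intros K. apply (proj2 (proj2 Hk)), H0, K. }
  exists l, (1 + (rsum M l0 + 1)), Y. split; [apply sel_NoDup, NoDup_nodup|]. split.
  { intros k Hk. apply sel_In in Hk. tauto. }
  intros z Hz.
  destruct (is_sum_over_nodup _ _ _ (HS z ltac:(unfold half_plane; lra)) 1 Rlt_0_1) as [l1 [N1 [P1 T1]]].
  destruct (exists_superlist (exponents h u) l l1) as [l2 [N2 [P2 [I1 I2]]]]; trivial.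
  specialize (T1 l2 N2 P2 I2).
  change (fun lambda => (a lambda * Cexp (2 * PI * Ci * lambda * z))%C)
    with (fun k => (a k * ee k z)%C) in T1.
  assert (E := csum_nonmember (fun k => a k * ee k z)%C l2 l (sel_NoDup _ _ (NoDup_nodup _ _)) N2 I1).
  set (l3 := sel (fun k => ~ In k l) l2) in *.
  assert (T : Cmod (csum (fun k => a k * ee k z)%C l3) <= rsum M l0 + 1).
  { eapply Rle_trans; [apply csum_bound|].
    apply Rle_trans with (rsum M l3).
    { apply rsum_le. intros k Hk. apply sel_In in Hk as [Hk1 Hk2]. unfold M.
      rewrite !Cmod_mult. destruct (Req_dec (Cmod (a k)) 0) as [Z|Z]; [rewrite Z; lra|].
      apply Rmult_le_compat_l; [apply Cmod_ge_0|]. rewrite !Cmod_ee. simpl.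
      assert (0 <= k).
      { apply Rnot_lt_le. intros Hk. apply Hk2, sel_In.
        assert (a k <> 0) by (intros Q; apply Z; rewrite Q; apply Cmod_0).
        split; [|tauto]. apply nodup_In. auto. }
      assert (PI > 0) by apply PI_RGT_0.
      apply exp_monotone. assert (0 <= PI * k * (Im z - Y)).
      { apply Rmult_le_pos; [apply Rmult_le_pos|]; lra. }
      lra. }
    assert (N3 : NoDup l3) by now apply sel_NoDup.
    rewrite (rsum_sel M (fun k => In k l0) l3). apply Rplus_le_compat.
    - assert (Sub : forall l l0, NoDup l -> incl l l0 -> rsum M l <= rsum M l0).
      { clear. intros l l0 H. revert l0. induction H as [|x l Hx H IH]; intros l0 Hi.
        - apply rsum_ge_0. intros; apply Cmod_ge_0.
        - destruct (in_split x l0) as [l1 [l2 ->]]; [apply Hi; now left|].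
          assert (A : rsum M (l1 ++ x :: l2) = M x + rsum M (l1 ++ l2)).
          { clear. induction l1 as [|y l1 IH]; [reflexivity|].
            simpl. rewrite !rsum_cons, IH. ring. }
          rewrite A, rsum_cons. apply Rplus_le_compat_l, IH.
          intros y Hy. assert (Hy' := Hi y (or_intror Hy)). apply in_app_iff in Hy'.
          apply in_app_iff. simpl in Hy'. destruct Hy' as [?|[<-|?]]; tauto. }
      apply Sub; [now apply sel_NoDup|]. intros k Hk. now apply sel_In in Hk.
    - apply T0; [now apply sel_NoDup|..].
      + intros k Hk. apply sel_In in Hk as [Hk _]. apply sel_In in Hk as [Hk _]. auto.
      + intros k Hk. apply sel_In in Hk. tauto. }
  rewrite Cmod_minus_sym.
  replace (csum (fun k => a k * ee k z)%C l - g z)%C with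
    ((csum (fun k => a k * ee k z)%C l2 - g z) - csum (fun k => a k * ee k z)%C l3)%C by (rewrite E; ring).
  unfold Cminus at 1. eapply Rle_trans; [apply Cmod_triangle|]. rewrite Cmod_opp. lra.
Qed.

Lemma exists_min_element (l : list R) : l <> nil -> exists x, In x l /\ forall y, In y l -> x <= y.
Proof.
  induction l as [|x l IH]; [congruence|]. intros _. destruct l as [|y l].
  - exists x. split; [now left|]. intros y [<-|[]]. lra.
  - destruct IH as [m [I H]]; [congruence|]. destruct (Rle_dec x m) as [L|L].
    + exists x. split; [now left|]. intros z [<-|Hz]; [lra|]. apply Rle_trans with (1 := L); auto.
    + exists m. split; [now right|]. intros z [<-|Hz]; [lra|auto].
Qed.

Lemma csum_relative_decay (a : R -> C) (k0 : R) (l : list R) : (forall k, In k l -> k0 < k) ->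
  forall eps, 0 < eps -> exists Y, forall z, Y < Im z ->
    Cmod (csum (fun k => a k * ee k z)%C l * ee (- k0) z) < eps.
Proof.
  induction l as [|k l IH]; intros H eps He.
  - exists 0. intros z _. unfold csum; simpl. rewrite Cmult_0_l, Cmod_0. assumption.
  - destruct (IH (fun x Hx => H x (or_intror Hx)) (eps / 2) ltac:(lra)) as [Y1 H1].
    assert (k0 < k) by (apply H; now left).
    destruct (exp_decay (2 * PI * (k - k0)) (Cmod (a k)) (eps / 2)) as [Y2 H2]; [|lra|].
    { generalize PI_RGT_0. intros. apply Rmult_lt_0_compat; lra. }
    exists (Rmax Y1 Y2). intros z Hz.
    specialize (H1 z (Rle_lt_trans _ _ _ (Rmax_l _ _) Hz)).
    specialize (H2 (Im z) (Rle_lt_trans _ _ _ (Rmax_r _ _) Hz)).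
    rewrite csum_cons, Cmult_plus_distr_r.
    eapply Rle_lt_trans; [apply Cmod_triangle|].
    assert (E : Cmod (a k * ee k z * ee (- k0) z) = Cmod (a k) * exp (- (2 * PI * (k - k0) * Im z))).
    { rewrite <- Cmult_assoc, <- ee_plus_l, Cmod_mult, Cmod_ee. f_equal. f_equal. ring. }
    rewrite E. lra.
Qed.

(** The order of the pole is minus the least exponent of the principal part; the other terms and the
    bounded remainder are exponentially smaller. It is a real number, since the exponents need not
    be rational. *)
Theorem finite_order_dichotomy (g : C -> C) : finite_order g ->
  bounded_at_infinity g \/ exists mu b, pole_at_infinity g mu b.
Proof.
  intros [h [u [a [He Hf]]]].
  destruct (expansion_principal_part g h u a He Hf) as [l [K [Y [N [Hl HK]]]]].
  destruct l as [|k0' l'] eqn:El.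
  { left. exists K, Y. intros z Hz. specialize (HK z Hz). unfold csum in HK; simpl in HK.
    replace (g z) with (g z - 0)%C by ring. exact HK. }
  right. rewrite <- El in *.
  destruct (exists_min_element l) as [k0 [I0 M0]]; [congruence|]. clear El k0' l'.
  destruct (in_split k0 l I0) as [l1 [l2 ->]].
  destruct (Hl k0 I0) as [Nk0 Ak0].
  exists (- k0), (a k0). split; [lra|]. split; [assumption|].
  assert (N' := NoDup_remove_2 _ _ _ N).
  assert (L : forall k, In k (l1 ++ l2) -> k0 < k).
  { intros k Hk. assert (k <> k0) by (intros ->; contradiction).
    assert (k0 <= k); [|lra]. apply M0. apply in_app_iff in Hk. apply in_app_iff. simpl. tauto. }
  intros eps Hep.
  destruct (csum_relative_decay a k0 _ L (eps / 2) ltac:(lra)) as [Y1 H1].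
  destruct (exp_decay (2 * PI * - k0) K (eps / 2)) as [Y2 H2]; [|lra|].
  { generalize PI_RGT_0. intros. apply Rmult_lt_0_compat; lra. }
  exists (Rmax Y (Rmax Y1 Y2)). intros z Hz.
  assert (Hz' := Rle_lt_trans _ _ _ (Rmax_r _ _) Hz).
  specialize (HK z (Rle_lt_trans _ _ _ (Rmax_l _ _) Hz)).
  specialize (H1 z (Rle_lt_trans _ _ _ (Rmax_l _ _) Hz')).
  specialize (H2 (Im z) (Rle_lt_trans _ _ _ (Rmax_r _ _) Hz')).
  rewrite csum_app, csum_cons in HK. rewrite csum_app in H1.
  set (c1 := csum _ l1) in *. set (c2 := csum _ l2) in *.
  assert (E1 := ee_opp_l k0 z).
  replace (g z * ee (- k0) z - a k0)%C with
    ((g z - (c1 + (a k0 * ee k0 z + c2))) * ee (- k0) z + (c1 + c2) * ee (- k0) z)%C.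
  2:{ transitivity (g z * ee (- k0) z - a k0 * (ee (- k0) z * ee k0 z))%C; [ring|rewrite E1; ring]. }
  eapply Rle_lt_trans; [apply Cmod_triangle|].
  assert (E : Cmod ((g z - (c1 + (a k0 * ee k0 z + c2))) * ee (- k0) z) <= K * exp (- (2 * PI * - k0 * Im z))).
  { rewrite Cmod_mult, Cmod_ee. replace (- 2 * PI * - k0 * Im z) with (- (2 * PI * - k0 * Im z)) by ring.
    apply Rmult_le_compat_r; [left; apply exp_pos|assumption]. }
  lra.
Qed.

(** * The action of the modular group *)

Lemma SL2Z_eq (g h : SL2Z) :
  ma g = ma h -> mb g = mb h -> mc g = mc h -> md g = md h -> g = h.
Proof.
  destruct g as [a b c d p], h as [a' b' c' d' p']. simpl. intros <- <- <- <-.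
  f_equal. apply UIP_dec, Z.eq_dec.
Qed.

Lemma det_R (g : SL2Z) : IZR (ma g) * IZR (md g) - IZR (mb g) * IZR (mc g) = 1.
Proof. rewrite <- !mult_IZR, <- minus_IZR, SL2Z_det. reflexivity. Qed.

Lemma det_C (g : SL2Z) :
  (IZR (ma g) * IZR (md g) - IZR (mb g) * IZR (mc g) = 1)%C.
Proof. rewrite <- !RtoC_mult, <- RtoC_minus, det_R. reflexivity. Qed.

Lemma denom_neq_0 (g : SL2Z) (z : C) : 0 < Im z -> denom g z <> 0.
Proof.
  intros Hz H. unfold denom in H.
  assert (Hi := f_equal Im H). assert (Hr := f_equal Re H). unfold Re, Im in *. simpl in Hi, Hr.
  assert (D := det_R g).
  assert (c0 : IZR (mc g) = 0) by nra. rewrite c0 in *. nra.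
Qed.

Lemma Cmod_denom_pos (g : SL2Z) (z : C) : 0 < Im z -> 0 < Cmod (denom g z).
Proof. intros H. apply Cmod_gt_0. now apply denom_neq_0. Qed.

Lemma Cmod_denom_sqr (g : SL2Z) (x y : R) : Cmod (denom g (x, y)) * Cmod (denom g (x, y)) =
  (IZR (mc g) * x + IZR (md g)) * (IZR (mc g) * x + IZR (md g)) + (IZR (mc g) * y) * (IZR (mc g) * y).
Proof. rewrite Cmod_sqr. unfold denom, Re, Im. simpl. ring. Qed.

Lemma Im_Cdiv (n d : C) : d <> 0 ->
  Im (n / d) = (Im n * Re d - Re n * Im d) / (Cmod d * Cmod d).
Proof.
  intros Hd. assert (P := proj1 (Cmod_gt_0 d) Hd). assert (E := Cmod_sqr d).
  assert (P2 : 0 < Cmod d * Cmod d) by nra. rewrite E in *.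
  destruct n as [n1 n2], d as [d1 d2]. unfold Cdiv, Cinv, Re, Im in *. simpl in *.
  field. nra.
Qed.

Lemma Im_moebius (g : SL2Z) (z : C) : 0 < Im z ->
  Im (moebius g z) = Im z / (Cmod (denom g z) * Cmod (denom g z)).
Proof.
  intros Hz. unfold moebius. rewrite Im_Cdiv by now apply denom_neq_0.
  f_equal. destruct z as [x y]. unfold denom, Re, Im. simpl.
  transitivity (y * (IZR (ma g) * IZR (md g) - IZR (mb g) * IZR (mc g))); [ring|].
  rewrite det_R. ring.
Qed.

Lemma Im_moebius_pos (g : SL2Z) (z : C) : 0 < Im z -> 0 < Im (moebius g z).
Proof.
  intros Hz. rewrite Im_moebius by assumption. assert (P := Cmod_denom_pos g z Hz).
  apply Rdiv_lt_0_compat; nra.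
Qed.

Lemma denom_mul (g h : SL2Z) (z : C) : 0 < Im z ->
  denom (SL2Z_mul g h) z = (denom g (moebius h z) * denom h z)%C.
Proof.
  intros Hz. assert (H := denom_neq_0 h z Hz). unfold moebius.
  unfold denom at 1 2. simpl. rewrite !plus_IZR, !mult_IZR, !RtoC_plus, !RtoC_mult.
  transitivity (IZR (mc g) * (IZR (ma h) * z + IZR (mb h)) + IZR (md g) * denom h z)%C.
  - unfold denom. ring.
  - field. assumption.
Qed.

Lemma moebius_mul (g h : SL2Z) (z : C) : 0 < Im z ->
  moebius (SL2Z_mul g h) z = moebius g (moebius h z).
Proof.
  intros Hz. assert (H := denom_neq_0 h z Hz).
  assert (H' := denom_neq_0 g (moebius h z) (Im_moebius_pos h z Hz)).
  unfold moebius at 1 2. rewrite denom_mul by assumption.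
  replace (IZR (ma (SL2Z_mul g h)) * z + IZR (mb (SL2Z_mul g h)))%C
    with ((IZR (ma g) * moebius h z + IZR (mb g)) * denom h z)%C.
  - field. split; assumption.
  - unfold moebius. simpl. rewrite !plus_IZR, !mult_IZR, !RtoC_plus, !RtoC_mult.
    transitivity (IZR (ma g) * (IZR (ma h) * z + IZR (mb h)) + IZR (mb g) * denom h z)%C.
    + field. assumption.
    + unfold denom. ring.
Qed.

Lemma moebius_one (z : C) : moebius SL2Z_one z = z.
Proof. unfold moebius, denom. simpl. field. Qed.

Lemma SL2Z_mulKV (g h : SL2Z) : SL2Z_mul (SL2Z_mul h g) (SL2Z_inv g) = h.
Proof.
  assert (D := SL2Z_det g). apply SL2Z_eq; simpl;
  match goal with |- _ = ?r => transitivity (r * 1)%Z; [rewrite <- D; ring|ring] end.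
Qed.

Lemma SL2Z_inv_mul (g h : SL2Z) : SL2Z_inv (SL2Z_mul g h) = SL2Z_mul (SL2Z_inv h) (SL2Z_inv g).
Proof. apply SL2Z_eq; simpl; ring. Qed.

Lemma SL2Z_invK (g : SL2Z) : SL2Z_inv (SL2Z_inv g) = g.
Proof. apply SL2Z_eq; simpl; ring. Qed.

Lemma SL2Z_mulV (g : SL2Z) : SL2Z_mul g (SL2Z_inv g) = SL2Z_one.
Proof. assert (D := SL2Z_det g). apply SL2Z_eq; simpl; try ring; rewrite <- D; ring. Qed.

Lemma moebius_invK (g : SL2Z) (z : C) : 0 < Im z -> moebius g (moebius (SL2Z_inv g) z) = z.
Proof. intros Hz. rewrite <- moebius_mul, SL2Z_mulV by assumption. apply moebius_one. Qed.

(** * Unipotent matrices, reduction of points, finite index *)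

Lemma upper_det (n : Z) : (1 * 1 - n * 0 = 1)%Z.
Proof. ring. Qed.

Lemma lower_det (n : Z) : (1 * 1 - 0 * n = 1)%Z.
Proof. ring. Qed.

Definition upper_unipotent (n : Z) : SL2Z := mkSL2Z 1 n 0 1 (upper_det n).
Definition lower_unipotent (n : Z) : SL2Z := mkSL2Z 1 0 n 1 (lower_det n).

Lemma denom_upper (n : Z) (z : C) : denom (upper_unipotent n) z = 1.
Proof. unfold denom; simpl. ring. Qed.

Lemma moebius_upper (n : Z) (z : C) : moebius (upper_unipotent n) z = (z + IZR n)%C.
Proof. unfold moebius. rewrite denom_upper. simpl. field. Qed.

Lemma reduction_det (m : Z) : (m * 0 - (-1) * 1 = 1)%Z.
Proof. ring. Qed.

Lemma nearest_integer (x : R) : exists m : Z, Rabs (x - IZR m) <= 1 / 2.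
Proof.
  exists (up (x - 1 / 2)). destruct (archimed (x - 1 / 2)) as [H1 H2]. apply Rabs_le. lra.
Qed.

Lemma floor_integer (x : R) : exists m : Z, 0 <= x - IZR m <= 1.
Proof.
  exists (up x - 1)%Z. destruct (archimed x) as [H1 H2]. rewrite minus_IZR. lra.
Qed.

(* If [|Re z - m| <= 1/2] and [Im z < 1/2] then [|z - m|^2 < 1/2], so [z |-> -1/(z - m)]
   at least doubles the imaginary part. *)
Lemma reduction (z : C) : 0 < Im z ->
  exists (g : SL2Z) (w : C), 1 / 2 <= Im w /\ z = moebius g w.
Proof.
  assert (H : forall n z, 0 < Im z -> 1 / 2 <= Im z * 2 ^ n ->
    exists (g : SL2Z) (w : C), 1 / 2 <= Im w /\ z = moebius g w).
  { induction n as [|n IH]; intros z0 Hz Hn.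
    - exists SL2Z_one, z0. rewrite moebius_one. simpl in Hn. split; [lra|reflexivity].
    - destruct (Rle_dec (1 / 2) (Im z0)) as [L|L].
      { exists SL2Z_one, z0. rewrite moebius_one. split; [lra|reflexivity]. }
      destruct (nearest_integer (Re z0)) as [m Hm].
      (* [M] acts as w |-> m - 1/w, the inverse of z |-> -1/(z - m). The induction counts the
         doublings of the imaginary part still required. *)
      set (M := mkSL2Z m (-1) 1 0 (reduction_det m)).
      assert (Hz' := Im_moebius_pos (SL2Z_inv M) z0 Hz).
      destruct (IH (moebius (SL2Z_inv M) z0) Hz') as [g [w [Hw E]]].
      + rewrite Im_moebius by assumption.
        assert (P := Cmod_denom_pos (SL2Z_inv M) z0 Hz).
        destruct z0 as [x y]. assert (Q := Cmod_denom_sqr (SL2Z_inv M) x y).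
        unfold Re, Im in *. simpl in *.
        set (r := Cmod _ * Cmod _) in *.
        assert (r <= 1 / 2).
        { rewrite Q. apply Rabs_le_between in Hm. nra. }
        assert (0 < r) by (unfold r; nra).
        apply Rle_trans with (1 := Hn).
        replace (y * (2 * 2 ^ n)) with (y * 2 ^ n * 2) by ring.
        replace (y / r * 2 ^ n) with (y * 2 ^ n * / r) by (field; lra).
        assert (0 < 2 ^ n) by (apply pow_lt; lra).
        apply Rmult_le_compat_l; [nra|].
        replace 2 with (/ (1 / 2)) by field. apply Rinv_le_contravar; assumption.
      + exists (SL2Z_mul M g), w. split; [assumption|].
        rewrite moebius_mul by lra. rewrite <- E. symmetry. now apply moebius_invK. }
  intros Hz. destruct (pow_half_small (1 / 2) (Im z) Hz) as [n Hn].
  apply (H n); trivial.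
  assert (0 < 2 ^ n) by (apply pow_lt; lra). apply Rlt_div_l in Hn; lra.
Qed.

(** [finite_index] speaks of left cosets, while the invariance of |f| concerns matrices [h s] with
    [h] in the group on the left; inverting the representatives passes from one to the other. *)
Lemma coset_representative (G : SL2Z -> Prop) : is_subgroup G -> finite_index G ->
  exists l : list SL2Z, forall g, exists s h, In s l /\ G h /\ g = SL2Z_mul h s.
Proof.
  intros [G1 [Gm Gi]] [l Hl]. exists (map SL2Z_inv l). intros g.
  destruct (Hl (SL2Z_inv g)) as [s [Hs H]].
  exists (SL2Z_inv s), (SL2Z_mul g s). split; [now apply in_map|]. split.
  - apply Gi in H. rewrite SL2Z_inv_mul, !SL2Z_invK in H. exact H.
  - now rewrite SL2Z_mulKV.
Qed.

(** More elements than cosets force two into the same coset. It is applied to unipotent sequences,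
    for which the quotient of the terms [i] and [j] is the unipotent matrix with entry [j - i]. *)
Lemma finite_index_pigeonhole (G : SL2Z -> Prop) (x : nat -> SL2Z) :
  is_subgroup G -> finite_index G ->
  exists i j, (i < j)%nat /\ G (SL2Z_mul (SL2Z_inv (x i)) (x j)).
Proof.
  intros [G1 [Gm Gi]] [l Hl].
  destruct (choice (fun n s => In s l /\ G (SL2Z_mul (SL2Z_inv s) (x n)))) as [phi Hphi].
  { intros n. apply Hl. }
  apply NNPP. intros Hno.
  assert (K : forall i j, (i < j)%nat -> phi i <> phi j).
  { intros i j Hij E. apply Hno. exists i, j. split; [assumption|].
    destruct (Hphi i) as [_ Hi]. destruct (Hphi j) as [_ Hj]. rewrite <- E in Hj.
    assert (H := Gm _ _ (Gi _ Hi) Hj).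
    replace (SL2Z_mul (SL2Z_inv (x i)) (x j)) with
      (SL2Z_mul (SL2Z_inv (SL2Z_mul (SL2Z_inv (phi i)) (x i))) (SL2Z_mul (SL2Z_inv (phi i)) (x j)));
      [assumption|].
    rewrite SL2Z_inv_mul, SL2Z_invK.
    assert (D := SL2Z_det (phi i)). apply SL2Z_eq; simpl;
    match goal with |- _ = ?r => transitivity (r * 1)%Z; [rewrite <- D; ring|ring] end. }
  assert (N : NoDup (map phi (seq 0 (S (length l))))).
  { apply NoDup_map_NoDup_ForallPairs; [|apply seq_NoDup].
    intros i j _ _ E. destruct (Nat.lt_trichotomy i j) as [L|[L|L]]; [|assumption|].
    - exfalso. exact (K _ _ L E).
    - exfalso. exact (K _ _ L (eq_sym E)). }
  apply NoDup_incl_length with (l' := l) in N.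
  - rewrite length_map, length_seq in N. lia.
  - intros s Hs. apply in_map_iff in Hs as [n [<- _]]. apply Hphi.
Qed.

Lemma finite_index_upper (G : SL2Z -> Prop) : is_subgroup G -> finite_index G ->
  exists n, (1 <= n)%nat /\ G (upper_unipotent (Z.of_nat n)).
Proof.
  intros H1 H2.
  destruct (finite_index_pigeonhole G (fun n => upper_unipotent (Z.of_nat n)) H1 H2) as [i [j [Hij H]]].
  exists (j - i)%nat. split; [lia|]. refine (eq_ind _ G H _ _). apply SL2Z_eq;
  cbn [ma mb mc md SL2Z_mul SL2Z_inv upper_unipotent lower_unipotent]; lia.
Qed.

(** Serves to carry a pole at infinity to a finite cusp. *)
Lemma finite_index_lower (G : SL2Z -> Prop) : is_subgroup G -> finite_index G ->
  exists n, (1 <= n)%nat /\ G (lower_unipotent (Z.of_nat n)).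
Proof.
  intros H1 H2.
  destruct (finite_index_pigeonhole G (fun n => lower_unipotent (Z.of_nat n)) H1 H2) as [i [j [Hij H]]].
  exists (j - i)%nat. split; [lia|]. refine (eq_ind _ G H _ _). apply SL2Z_eq;
  cbn [ma mb mc md SL2Z_mul SL2Z_inv upper_unipotent lower_unipotent]; lia.
Qed.

(** * Moduli of real powers and of slashed functions *)

Lemma Cmod_Cpower (z : C) (k : R) : Cmod (Cpower z k) = Rpower (Cmod z) k.
Proof. unfold Cpower. rewrite Cmod_Cexp. unfold Rpower, Clog, Re. simpl. f_equal. ring. Qed.

Lemma Cpower_opp (z : C) (k : R) : (Cpower z k * Cpower z (- k) = 1)%C.
Proof.
  unfold Cpower. rewrite <- Cexp_plus, RtoC_opp.
  replace (_ + _)%C with (RtoC 0) by ring. apply Cexp_0.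
Qed.

Lemma Rpower_mult_base (x y k : R) : 0 < x -> 0 < y -> Rpower (x * y) k = Rpower x k * Rpower y k.
Proof. intros. symmetry. now apply Rpower_mult_distr. Qed.

Lemma Rpower_opp_mult (x k : R) : Rpower x (- k) * Rpower x k = 1.
Proof. rewrite <- Rpower_plus, Rplus_opp_l. unfold Rpower. rewrite Rmult_0_l. apply exp_0. Qed.

Lemma Cmod_slash (k : R) (f : C -> C) (g : SL2Z) (z : C) :
  Cmod (slash k f g z) = Rpower (Cmod (denom g z)) (- k) * Cmod (f (moebius g z)).
Proof. unfold slash. rewrite Cmod_mult, Cmod_Cpower. reflexivity. Qed.

Lemma slash_inverse (k : R) (f : C -> C) (g : SL2Z) (z : C) :
  f (moebius g z) = (Cpower (denom g z) k * slash k f g z)%C.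
Proof. unfold slash. rewrite Cmult_assoc, Cpower_opp. ring. Qed.

Lemma Cmod_slash_inverse (k : R) (f : C -> C) (g : SL2Z) (z : C) :
  Cmod (f (moebius g z)) = Rpower (Cmod (denom g z)) k * Cmod (slash k f g z).
Proof. rewrite (slash_inverse k), Cmod_mult, Cmod_Cpower. reflexivity. Qed.

(** * Poles at infinity *)

(** The order of a pole can be read off from the growth of the modulus alone. This makes it unique,
    and common to functions with equal moduli. *)
Lemma pole_lower_bound (g : C -> C) (mu : R) (b : C) (K Y mu' : R) : pole_at_infinity g mu b ->
  (forall z, Y < Im z -> Cmod (g z) <= K * exp (2 * PI * mu' * Im z)) -> mu <= mu'.
Proof.
  intros [Hmu [Hb H]] HK. apply Rnot_lt_le. intros L.
  assert (Pb : 0 < Cmod b) by now apply Cmod_gt_0.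
  destruct (H (Cmod b / 2) ltac:(lra)) as [Y1 H1].
  destruct (exp_decay (2 * PI * (mu - mu')) K (Cmod b / 2)) as [Y2 H2]; [|lra|].
  { generalize PI_RGT_0. intros. apply Rmult_lt_0_compat; lra. }
  set (y := Rmax Y (Rmax Y1 Y2) + 1).
  assert (y > Y /\ y > Y1 /\ y > Y2) as [A1 [A2 A3]].
  { unfold y. generalize (Rmax_l Y (Rmax Y1 Y2)) (Rmax_r Y (Rmax Y1 Y2)) (Rmax_l Y1 Y2) (Rmax_r Y1 Y2).
    lra. }
  specialize (HK (0, y) A1). specialize (H1 (0, y) A2). specialize (H2 y A3).
  simpl in HK.
  assert (X := Cmod_triangle_inv b (g (0, y) * ee mu (0, y))). rewrite Cmod_minus_sym in X.
  rewrite Cmod_mult, Cmod_ee in X. simpl in X.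
  assert (Q : Cmod (g (0, y)) * exp (-2 * PI * mu * y) <= K * exp (- (2 * PI * (mu - mu') * y))).
  { apply Rle_trans with (K * exp (2 * PI * mu' * y) * exp (-2 * PI * mu * y)).
    - apply Rmult_le_compat_r; [left; apply exp_pos|assumption].
    - rewrite Rmult_assoc, <- exp_plus. right. f_equal. f_equal. ring. }
  lra.
Qed.

Lemma pole_upper_bound (g : C -> C) (mu : R) (b : C) : pole_at_infinity g mu b ->
  exists K Y, forall z, Y < Im z -> Cmod (g z) <= K * exp (2 * PI * mu * Im z).
Proof.
  intros [Hmu [Hb H]]. destruct (H 1 Rlt_0_1) as [Y H1]. exists (Cmod b + 1), Y. intros z Hz.
  specialize (H1 z Hz).
  assert (X := Cmod_triangle_inv (g z * ee mu z) b). rewrite Cmod_mult, Cmod_ee in X.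
  replace (Cmod (g z)) with (Cmod (g z) * exp (-2 * PI * mu * Im z) * exp (2 * PI * mu * Im z)).
  - apply Rmult_le_compat_r; [left; apply exp_pos|lra].
  - rewrite Rmult_assoc, <- exp_plus.
    replace (_ + _) with 0 by ring. rewrite exp_0. ring.
Qed.

(** Within a coset the slashed functions differ by a factor of modulus 1 that is not identified, so
    the leading coefficient cannot be transported. Finite order of [g'] yields some leading term,
    and the two growth bounds force its order to be [mu]. *)
Lemma pole_transfer (g g' : C -> C) (mu : R) (b : C) :
  (forall z, 0 < Im z -> Cmod (g' z) = Cmod (g z)) -> finite_order g' ->
  pole_at_infinity g mu b -> exists b', pole_at_infinity g' mu b'.
Proof.
  intros E F H. destruct (finite_order_dichotomy g' F) as [[K [Y B]]|[mu' [b' H']]].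
  - exfalso. assert (mu <= 0); [|destruct H; lra].
    apply pole_lower_bound with g b K (Rmax 0 Y); trivial. intros z Hz.
    rewrite Rmult_0_r, Rmult_0_l, exp_0, Rmult_1_r, <- E.
    + apply B. apply Rle_lt_trans with (2 := Hz), Rmax_r.
    + apply Rle_lt_trans with (2 := Hz), Rmax_l.
  - exists b'. replace mu with mu'; [assumption|].
    destruct (pole_upper_bound _ _ _ H) as [K1 [Y1 B1]].
    destruct (pole_upper_bound _ _ _ H') as [K2 [Y2 B2]].
    apply Rle_antisym.
    + apply pole_lower_bound with g' b' K1 (Rmax 0 Y1); trivial. intros z Hz.
      rewrite E by (apply Rle_lt_trans with (2 := Hz), Rmax_l).
      apply B1. apply Rle_lt_trans with (2 := Hz), Rmax_r.
    + apply pole_lower_bound with g b K2 (Rmax 0 Y2); trivial. intros z Hz.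
      rewrite <- E by (apply Rle_lt_trans with (2 := Hz), Rmax_l).
      apply B2. apply Rle_lt_trans with (2 := Hz), Rmax_r.
Qed.

(** * Uniform growth near the cusps *)

Lemma moebius_diff (g : SL2Z) (z w : C) : 0 < Im z -> 0 < Im w ->
  (moebius g w - moebius g z = (w - z) / (denom g w * denom g z))%C.
Proof.
  intros Hz Hw. assert (A := denom_neq_0 g z Hz). assert (B := denom_neq_0 g w Hw).
  unfold moebius. transitivity
    (((IZR (ma g) * w + IZR (mb g)) * denom g z - (IZR (ma g) * z + IZR (mb g)) * denom g w)
     / (denom g w * denom g z))%C; [field; split; assumption|].
  f_equal. unfold denom.
  transitivity ((w - z) * (IZR (ma g) * IZR (md g) - IZR (mb g) * IZR (mc g)))%C; [ring|].
  rewrite det_C. ring.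
Qed.

(** Working with the modulus avoids any discussion of the branch of [Cpower]: near [z] the
    denominator stays between half and twice its modulus, and f at the image point stays within 1 of
    its value. Both ends enter [B1] since the sign of [k] is free here. *)
Lemma slash_locally_bounded (k : R) (f : C -> C) (g : SL2Z) (z : C) :
  holomorphic_on (half_plane 0) f -> 0 < Im z ->
  exists delta B, 0 < delta /\ forall w, 0 < Im w -> Cmod (w - z) < delta ->
    Cmod (slash k f g w) <= B.
Proof.
  intros Hf Hz.
  assert (Cf := cdiff_ccont _ _ (ex_derive_cdiff _ _ (Hf _ (Im_moebius_pos g z Hz)))).
  destruct (Cf 1 Rlt_0_1) as [d1 [Pd1 H1]].
  set (D := Cmod (denom g z)). assert (PD : 0 < D) by now apply Cmod_denom_pos.
  set (c := Rabs (IZR (mc g)) + 1). assert (Pc : 0 < c) by (unfold c; generalize (Rabs_pos (IZR (mc g))); lra).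
  set (B1 := Rmax (Rpower (D / 2) (- k)) (Rpower (2 * D) (- k))).
  exists (Rmin (D / (2 * c)) (d1 * (D * D) / 2)), (B1 * (Cmod (f (moebius g z)) + 1)).
  assert (PD2 : 0 < D * D) by nra.
  split. { apply Rmin_pos; [apply Rdiv_lt_0_compat; lra|]. nra. }
  intros w Hw Hwz.
  assert (W1 := Rlt_le_trans _ _ _ Hwz (Rmin_l _ _)).
  assert (W2 := Rlt_le_trans _ _ _ Hwz (Rmin_r _ _)).
  apply Rlt_div_r in W1; [|lra].
  assert (DD : Cmod (denom g w - denom g z) <= D / 2).
  { replace (denom g w - denom g z)%C with (IZR (mc g) * (w - z))%C by (unfold denom; ring).
    rewrite Cmod_mult, Cmod_R. assert (0 <= Cmod (w - z)) by apply Cmod_ge_0.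
    unfold c in W1. generalize (Rabs_pos (IZR (mc g))). nra. }
  assert (L1 : D / 2 <= Cmod (denom g w)).
  { assert (X := Cmod_triangle_inv (denom g z) (denom g w)). rewrite Cmod_minus_sym in X. fold D in X. lra. }
  assert (L2 : Cmod (denom g w) <= 2 * D).
  { assert (X := Cmod_triangle_inv (denom g w) (denom g z)). fold D in X. lra. }
  rewrite Cmod_slash. apply Rmult_le_compat.
  - left. apply exp_pos.
  - apply Cmod_ge_0.
  - unfold B1. destruct (Rle_dec 0 (- k)) as [S|S].
    + eapply Rle_trans; [|apply Rmax_r]. apply Rle_Rpower_l; lra.
    + eapply Rle_trans; [|apply Rmax_l].
      replace (- k) with (- (k)) by ring. rewrite !Rpower_Ropp.
      apply Rinv_le_contravar; [apply exp_pos|]. apply Rle_Rpower_l; lra.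
  - assert (Cmod (f (moebius g w) - f (moebius g z)) < 1).
    { apply H1. rewrite moebius_diff by assumption.
      assert (N : (denom g w * denom g z)%C <> 0).
      { apply Cmod_gt_0. rewrite Cmod_mult. fold D. nra. }
      rewrite Cmod_div by assumption. rewrite Cmod_mult. fold D.
      apply Rlt_div_l; [nra|]. assert (D * D / 2 <= Cmod (denom g w) * D) by nra. nra. }
    assert (X := Cmod_triangle_inv (f (moebius g w)) (f (moebius g z))). lra.
Qed.

Lemma slash_bounded_rectangle (k : R) (f : C -> C) (g : SL2Z) (a b c d : R) :
  holomorphic_on (half_plane 0) f -> a <= b -> 0 < c -> c <= d ->
  exists B, forall x y, a <= x <= b -> c <= y <= d -> Cmod (slash k f g (x, y)) <= B.
Proof.
  intros Hf Hab Hc Hcd.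
  apply (rect_bisection (fun a b c d => exists B, forall x y, a <= x <= b -> c <= y <= d ->
    Cmod (slash k f g (x, y)) <= B)); trivial.
  - intros a' b' c' d' _ _ _ _ _ _ [B1 H1] [B2 H2] [B3 H3] [B4 H4].
    exists (Rmax (Rmax B1 B2) (Rmax B3 B4)). intros x y Hx Hy.
    set (m := (a' + b') / 2) in *. set (n := (c' + d') / 2) in *.
    destruct (Rle_dec y n); destruct (Rle_dec x m).
    + eapply Rle_trans; [apply H1; lra|]. eapply Rle_trans; [apply Rmax_l|apply Rmax_l].
    + eapply Rle_trans; [apply H2; lra|]. eapply Rle_trans; [apply Rmax_r|apply Rmax_l].
    + eapply Rle_trans; [apply H3; lra|]. eapply Rle_trans; [apply Rmax_l|apply Rmax_r].
    + eapply Rle_trans; [apply H4; lra|]. eapply Rle_trans; [apply Rmax_r|apply Rmax_r].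
  - intros x y Hx Hy.
    destruct (slash_locally_bounded k f g (x, y) Hf) as [delta [B [Hd H]]]; [simpl; lra|].
    exists (delta / 2). split; [lra|].
    intros a' b' c' d' A1 A2 A3 A4 A5 A6. exists B. intros x' y' Hx' Hy'.
    apply H; [simpl; lra|]. eapply Rle_lt_trans; [apply Cmod_le_sum|]. simpl.
    assert (Rabs (x' + - x) <= b' - a') by (apply Rabs_le; lra).
    assert (Rabs (y' + - y) <= d' - c') by (apply Rabs_le; lra). lra.
Qed.

Lemma uniform_list_bound {T : Type} (P : T -> R -> Prop) (l : list T) :
  (forall s B B', B <= B' -> P s B -> P s B') -> (forall s, In s l -> exists B, P s B) ->
  exists B, forall s, In s l -> P s B.
Proof.
  intros M. induction l as [|s l IH]; intros H.
  - exists 0. intros s [].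
  - destruct IH as [B HB]; [intros; apply H; now right|].
    destruct (H s (or_introl eq_refl)) as [B' HB'].
    exists (Rmax B B'). intros t [<-|Ht].
    + apply M with B'; [apply Rmax_r|assumption].
    + apply M with B; [apply Rmax_l|auto].
Qed.

Section Growth.

Variables (k : R) (G : SL2Z -> Prop) (f : C -> C).
Hypothesis hsub : is_subgroup G.
Hypothesis hfin : finite_index G.
Hypothesis hhol : holomorphic_on (half_plane 0) f.
Hypothesis habs : forall g z, G g -> 0 < Im z ->
  Cmod (f (moebius g z)) = Rpower (Cmod (denom g z)) k * Cmod (f z).
Hypothesis hord : forall g, finite_order (slash k f g).

Lemma Cmod_slash_coset (h g : SL2Z) (z : C) : G h -> 0 < Im z ->
  Cmod (slash k f (SL2Z_mul h g) z) = Cmod (slash k f g z).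
Proof.
  intros Hh Hz. assert (Hg := Im_moebius_pos g z Hz).
  rewrite !Cmod_slash, moebius_mul, denom_mul, Cmod_mult, Rpower_mult_base, habs
    by auto using Cmod_denom_pos.
  replace (Rpower (Cmod (denom h (moebius g z))) (- k) * Rpower (Cmod (denom g z)) (- k) * _)
    with (Rpower (Cmod (denom h (moebius g z))) (- k) * Rpower (Cmod (denom h (moebius g z))) k
      * (Rpower (Cmod (denom g z)) (- k) * Cmod (f (moebius g z)))) by ring.
  rewrite Rpower_opp_mult. ring.
Qed.

Lemma Cmod_slash_translate (g : SL2Z) (n : Z) (z : C) : 0 < Im z ->
  Cmod (slash k f (SL2Z_mul g (upper_unipotent n)) z) = Cmod (slash k f g (z + IZR n)).
Proof.
  intros Hz. rewrite !Cmod_slash, moebius_mul, denom_mul, denom_upper, moebius_upper by assumption.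
  rewrite Cmult_1_r. reflexivity.
Qed.

(** A translation brings Re z into [0, 1]. It changes [g], but only the right coset of the product
    matters, so finitely many compact rectangles cover all [g]. *)
Lemma slash_bounded_strip (Y : R) :
  exists B, forall g z, 1 / 2 <= Im z <= Y -> Cmod (slash k f g z) <= B.
Proof.
  destruct (coset_representative G hsub hfin) as [l Hl].
  destruct (uniform_list_bound (fun s B => forall x y, 0 <= x <= 1 -> 1 / 2 <= y <= Rmax Y (1 / 2) ->
    Cmod (slash k f s (x, y)) <= B) l) as [B HB].
  - intros s B B' L H x y Hx Hy. apply Rle_trans with (2 := L); auto.
  - intros s _. apply slash_bounded_rectangle; trivial; try lra. apply Rmax_r.
  - exists B. intros g [x y] Hz. simpl in Hz.
    destruct (floor_integer x) as [n Hn].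
    destruct (Hl (SL2Z_mul g (upper_unipotent n))) as [s [h [Hs [Hh E]]]].
    replace (x, y) with (((x - IZR n)%R, y) + IZR n)%C by (apply C_eq; simpl; ring).
    rewrite <- Cmod_slash_translate, E, Cmod_slash_coset; trivial; try (simpl; lra).
    apply HB; trivial. split; [lra|]. apply Rle_trans with Y; [lra|apply Rmax_l].
Qed.

Definition has_pole (g : SL2Z) (mu : R) : Prop := exists b, pole_at_infinity (slash k f g) mu b.

Lemma has_pole_coset (h g : SL2Z) (mu : R) : G h -> has_pole g mu -> has_pole (SL2Z_mul h g) mu.
Proof.
  intros Hh [b Hb]. apply pole_transfer with (slash k f g) b; trivial.
  intros z Hz. now apply Cmod_slash_coset.
Qed.

(** Each coset representative has its own growth at infinity, valid above a common height [Y]; the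
    strip lemma fills the gap from 1/2 to [Y]. Invariance of the modulus spreads the bounds over the
    cosets, and [has_pole_coset] spreads the orders. *)
Lemma slash_uniform_growth : exists (D : list R) (B : R), forall g,
  (forall z, 1 / 2 <= Im z -> Cmod (slash k f g z) <= B) \/
  exists mu, In mu D /\ 0 < mu /\ has_pole g mu /\
    forall z, 1 / 2 <= Im z -> Cmod (slash k f g z) <= B * exp (2 * PI * mu * Im z).
Proof.
  destruct (coset_representative G hsub hfin) as [l Hl].
  destruct (choice (fun s o => match o with
    | None => bounded_at_infinity (slash k f s)
    | Some mu => has_pole s mu end)) as [order Hord].
  { intros s. destruct (finite_order_dichotomy _ (hord s)) as [H|[mu [b H]]].
    - exists None. exact H.
    - exists (Some mu). exists b. exact H. }
  set (growth := fun s z => match order s with None => 1 | Some mu => exp (2 * PI * mu * Im z) end).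
  assert (growth_ge_1 : forall s z, 0 <= Im z -> 1 <= growth s z).
  { intros s z Hz. unfold growth. specialize (Hord s). destruct (order s) as [mu|]; [|lra].
    destruct Hord as [b [Hmu _]]. rewrite <- exp_0. apply exp_monotone.
    assert (P := PI_RGT_0). apply Rmult_le_pos; [|assumption]. apply Rmult_le_pos; lra. }
  (* The same number is used as threshold for Im z and as constant, so that a single maximum over
     the list provides both. *)
  destruct (uniform_list_bound (fun s B => forall z, B < Im z -> Cmod (slash k f s z) <= B * growth s z) l)
    as [Y HY].
  { intros s B B' L H z Hz.
    destruct (Rle_dec 0 (Im z)) as [Pz|Pz].
    - eapply Rle_trans; [apply H; lra|]. apply Rmult_le_compat_r; [|assumption].
      generalize (growth_ge_1 s z Pz). lra.
    - eapply Rle_trans; [apply H; lra|]. apply Rmult_le_compat_r; [|assumption].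
      unfold growth. destruct (order s); [left; apply exp_pos|lra]. }
  { intros s _. specialize (Hord s). unfold growth. destruct (order s) as [mu|].
    - destruct Hord as [b Hb]. destruct (pole_upper_bound _ _ _ Hb) as [K [Y H]].
      exists (Rmax K Y). intros z Hz. eapply Rle_trans; [apply H|].
      + apply Rle_lt_trans with (2 := Hz), Rmax_r.
      + apply Rmult_le_compat_r; [left; apply exp_pos|apply Rmax_l].
    - destruct Hord as [K [Y H]]. exists (Rmax K Y). intros z Hz.
      rewrite Rmult_1_r. eapply Rle_trans; [apply H|apply Rmax_l].
      apply Rle_lt_trans with (2 := Hz), Rmax_r. }
  destruct (slash_bounded_strip Y) as [B0 HB0].
  set (B := Rmax (Rmax B0 Y) 0).
  assert (B1 : B0 <= B) by (unfold B; eapply Rle_trans; [|apply Rmax_l]; apply Rmax_l).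
  assert (B2 : Y <= B) by (unfold B; eapply Rle_trans; [|apply Rmax_l]; apply Rmax_r).
  assert (B3 : 0 <= B) by (unfold B; apply Rmax_r).
  assert (Bound : forall h s z, In s l -> G h -> 1 / 2 <= Im z ->
    Cmod (slash k f (SL2Z_mul h s) z) <= B * growth s z).
  { intros h s z Hs Hh Hz. assert (g1 := growth_ge_1 s z ltac:(lra)).
    destruct (Rle_dec (Im z) Y) as [L|L].
    - apply Rle_trans with (B * 1); [rewrite Rmult_1_r|apply Rmult_le_compat_l; assumption].
      apply Rle_trans with (2 := B1), HB0. lra.
    - rewrite Cmod_slash_coset by (trivial; lra).
      eapply Rle_trans; [apply HY; trivial; lra|]. apply Rmult_le_compat_r; lra. }
  exists (flat_map (fun s => match order s with None => nil | Some mu => mu :: nil end) l), B.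
  intros g. destruct (Hl g) as [s [h [Hs [Hh ->]]]].
  assert (Os := Hord s). destruct (order s) as [mu|] eqn:Eo.
  - right. exists mu. split; [|split; [|split]].
    + apply in_flat_map. exists s. split; [assumption|]. rewrite Eo. now left.
    + destruct Os as [b [Hmu _]]. exact Hmu.
    + now apply has_pole_coset.
    + intros z Hz. specialize (Bound h s z Hs Hh Hz). unfold growth in Bound. rewrite Eo in Bound. exact Bound.
  - left. intros z Hz. specialize (Bound h s z Hs Hh Hz). unfold growth in Bound.
    rewrite Eo, Rmult_1_r in Bound. exact Bound.
Qed.

End Growth.

(** * Dominant cusps and growth near the real axis *)

Lemma exists_max_element (l : list R) : l <> nil -> exists x, In x l /\ forall y, In y l -> y <= x.
Proof.
  intros Hl. destruct (exists_min_element (map Ropp l)) as [m [I H]].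
  - destruct l; [congruence|discriminate].
  - apply in_map_iff in I as [x [<- I]]. exists x. split; [assumption|].
    intros y Hy. specialize (H (- y) (in_map Ropp _ _ Hy)). lra.
Qed.

Lemma divide_fact (K : nat) (c : Z) : c <> 0%Z -> (Z.abs c <= Z.of_nat K)%Z ->
  exists q : Z, Z.of_nat (fact K) = (q * c)%Z.
Proof.
  intros Hc. induction K as [|K IH]; intros H; [lia|].
  destruct (Z.eq_dec (Z.abs c) (Z.of_nat (S K))) as [E|E].
  - exists (Z.sgn c * Z.of_nat (fact K))%Z.
    change (fact (S K)) with (S K * fact K)%nat. rewrite Nat2Z.inj_mul, <- E.
    nia.
  - destruct IH as [q Hq]; [lia|]. exists (Z.of_nat (S K) * q)%Z.
    change (fact (S K)) with (S K * fact K)%nat. rewrite Nat2Z.inj_mul, Hq. ring.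
Qed.

(* The numbers [mu / c^2] accumulate only at 0; [M0] is the largest one, [M1] separates the others from it. *)
Lemma extremal_orders (D : list R) (Q : R -> Z -> Prop) :
  (forall mu c, Q mu c -> In mu D /\ 0 < mu /\ c <> 0%Z) -> (exists mu c, Q mu c) ->
  exists (M0 M1 : R) (L : nat), 0 < M1 < M0 /\ (1 <= L)%nat /\
    (exists mu c, Q mu c /\ mu = M0 * (IZR c * IZR c)) /\
    forall mu c, Q mu c ->
      (mu = M0 * (IZR c * IZR c) /\ exists q : Z, Z.of_nat L = (q * c)%Z) \/
      mu <= M1 * (IZR c * IZR c).
Proof.
  intros HQ [mu0 [c0 H0]].
  destruct (HQ _ _ H0) as [I0 [P0 N0]].
  assert (sq : forall c : Z, c <> 0%Z -> 1 <= IZR c * IZR c).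
  { intros c Hc. rewrite <- mult_IZR. apply IZR_le. nia. }
  assert (val_eq : forall mu c, c <> 0%Z -> mu = mu / (IZR c * IZR c) * (IZR c * IZR c)).
  { intros mu c Hc. field. apply not_0_IZR; assumption. }
  set (v0 := mu0 / (IZR c0 * IZR c0)).
  assert (Pv0 : 0 < v0). { apply Rdiv_lt_0_compat; [assumption|]. generalize (sq c0 N0). lra. }
  destruct (exists_max_element D) as [Mx [IM HM]]; [intros ->; destruct I0|].
  (* [Mx] bounds all orders, so |c| > K gives mu/c^2 <= Mx/K < v0/2; only the finitely many
     quotients with |c| <= K compete for the maximum. *)
  destruct (nfloor_ex (2 * Mx / v0)) as [K0 [_ HK0]].
  { apply Rlt_le, Rdiv_lt_0_compat; [|assumption]. generalize (HM _ I0). lra. }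
  set (K := S K0).
  assert (HK : 2 * Mx < INR K * v0).
  { unfold K. rewrite S_INR. apply Rlt_div_l in HK0; lra. }
  assert (small : forall mu c, Q mu c -> (Z.of_nat K < Z.abs c)%Z -> mu < v0 / 2 * (IZR c * IZR c)).
  { intros mu c H L. destruct (HQ _ _ H) as [I [P N]].
    assert (A : INR K <= IZR c * IZR c).
    { rewrite INR_IZR_INZ, <- mult_IZR. apply IZR_le. nia. }
    assert (B := HM _ I). nra. }
  set (l := flat_map (fun mu => map (fun n => mu / (INR n * INR n)) (seq 1 K)) D).
  (* The list [l] also contains quotients that belong to no pole; filtering by [att] makes the
     maximum a value that is really attained. *)
  set (att := fun v => exists mu c, Q mu c /\ v = mu / (IZR c * IZR c)).
  assert (inl : forall mu c, Q mu c -> (Z.abs c <= Z.of_nat K)%Z -> In (mu / (IZR c * IZR c)) (sel att l)).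
  { intros mu c H L. destruct (HQ _ _ H) as [I [P N]]. apply sel_In. split; [|now exists mu, c].
    apply in_flat_map. exists mu. split; [assumption|].
    apply in_map_iff. exists (Z.abs_nat c). split.
    - f_equal. rewrite INR_IZR_INZ, <- !mult_IZR. f_equal. lia.
    - apply in_seq. lia. }
  assert (Iv0 : In v0 (sel att l)).
  { apply inl; [assumption|]. apply Z.nlt_ge. intros L. apply (small _ _ H0) in L.
    rewrite (val_eq mu0 c0 N0) in L at 1. fold v0 in L. generalize (sq c0 N0). nra. }
  destruct (exists_max_element (sel att l)) as [M0 [IM0 HM0]]; [intros E; rewrite E in Iv0; destruct Iv0|].
  assert (v0M : v0 <= M0) by auto.
  (* [M1] is the second largest attained value with |c| <= K, or v0/2 if that is larger; v0/2 takes
     care of all |c| > K. The factorial of [K] is divisible by every remaining [c]. *)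
  destruct (exists_max_element (v0 / 2 :: sel (fun v => v < M0) (sel att l))) as [M1 [IM1 HM1]]; [discriminate|].
  exists M0, M1, (fact K).
  assert (v0M1 : v0 / 2 <= M1) by (apply HM1; now left).
  split. { split; [lra|]. destruct IM1 as [<-|I]; [lra|]. apply sel_In in I. tauto. }
  split; [apply lt_O_fact|]. split.
  { apply sel_In in IM0 as [_ [mu [c [H E]]]]. exists mu, c. split; [assumption|].
    rewrite E. apply val_eq. apply (HQ _ _ H). }
  intros mu c H. destruct (HQ _ _ H) as [I [P N]]. assert (S1 := sq c N).
  destruct (Z_le_gt_dec (Z.abs c) (Z.of_nat K)) as [L|L].
  - assert (J := inl mu c H L). rewrite (val_eq mu c N).
    destruct (Rle_lt_or_eq_dec _ _ (HM0 _ J)) as [Lt|E].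
    + right. apply Rmult_le_compat_r; [lra|]. apply HM1. right. apply sel_In. split; assumption.
    + left. split; [rewrite E; reflexivity|]. apply divide_fact; assumption.
  - right. assert (X := small mu c H ltac:(lia)). nra.
Qed.

Definition cusp (g : SL2Z) : R := IZR (ma g) / IZR (mc g).

Lemma Cmod_denom_inv (g : SL2Z) (w : C) : 0 < Im w ->
  Im w = Im (moebius g w) * (Cmod (denom g w) * Cmod (denom g w)).
Proof.
  intros Hw. rewrite Im_moebius by assumption. assert (P := Cmod_denom_pos g w Hw). field. lra.
Qed.

Lemma moebius_invVK (g : SL2Z) (z : C) : 0 < Im z -> moebius (SL2Z_inv g) (moebius g z) = z.
Proof.
  intros Hz. assert (H := moebius_invK (SL2Z_inv g) z Hz). rewrite SL2Z_invK in H. exact H.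
Qed.

(** The inverse matrix has denominator -c z + a, whose modulus is |c| |z - a/c|. *)
Lemma Im_at_cusp (g : SL2Z) (w : C) : 0 < Im w -> mc g <> 0%Z ->
  let z := moebius g w in
  Im w = Im z / (IZR (mc g) * IZR (mc g) * ((Re z - cusp g) * (Re z - cusp g) + Im z * Im z)).
Proof.
  intros Hw Hc z. assert (Hz : 0 < Im z) by now apply Im_moebius_pos.
  rewrite <- (moebius_invVK g w Hw) at 1. fold z. rewrite Im_moebius by assumption.
  f_equal. destruct z as [x y]. rewrite Cmod_denom_sqr. simpl. rewrite opp_IZR.
  unfold cusp, Re, Im. simpl. apply not_0_IZR in Hc. field. assumption.
Qed.

Lemma Rpower_base_ge_1 (x k : R) : 1 <= x -> k < 0 -> Rpower x k <= 1.
Proof.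
  intros Hx Hk. rewrite <- (Rpower_O x) by lra. apply Rle_Rpower; lra.
Qed.

Section Cusps.

Variables (k : R) (G : SL2Z -> Prop) (f : C -> C).
Hypothesis hk : k < 0.
Hypothesis hsub : is_subgroup G.
Hypothesis hfin : finite_index G.
Hypothesis hhol : holomorphic_on (half_plane 0) f.
Hypothesis habs : forall g z, G g -> 0 < Im z ->
  Cmod (f (moebius g z)) = Rpower (Cmod (denom g z)) k * Cmod (f z).
Hypothesis hord : forall g, finite_order (slash k f g).

(** Write z = g w with Im w >= 1/2. The slashed function is bounded uniformly in [g], and |denom g
    w|^2 = Im w / Im z is large when Im z is small, so its power with exponent [k] is small. *)
Lemma small_near_real_axis_of_no_pole : (forall g mu, ~ has_pole k f g mu) ->
  forall eps, 0 < eps -> exists delta, 0 < delta /\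
    forall z, 0 < Im z < delta -> Cmod (f z) <= eps.
Proof.
  intros Hno eps He.
  destruct (slash_uniform_growth k G f hsub hfin hhol habs hord) as [D [B HB]].
  set (B' := Rmax B 1). assert (B'1 : 1 <= B') by apply Rmax_r. assert (B'B : B <= B') by apply Rmax_l.
  (* Chosen so that R0^k = eps/B'; the bound on Im z below then forces |denom g w| >= R0. *)
  set (R0 := exp (ln (eps / B') / k)).
  assert (R0p : 0 < R0) by apply exp_pos.
  exists (1 / (2 * (R0 * R0))). split; [apply Rdiv_lt_0_compat; nra|].
  intros z Hz. destruct (reduction z) as [g [w [Hw ->]]]; [lra|].
  assert (Sl : Cmod (slash k f g w) <= B').
  { destruct (HB g) as [H|[mu [_ [_ [H _]]]]].
    - apply Rle_trans with B; auto.
    - exfalso. exact (Hno g mu H). }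
  rewrite (Cmod_slash_inverse k).
  assert (P := Cmod_denom_pos g w ltac:(lra)).
  assert (E := Cmod_denom_inv g w ltac:(lra)).
  set (d := Cmod (denom g w)) in *. set (y := Im (moebius g w)) in *.
  assert (R0d : R0 <= d).
  { apply Rnot_lt_le. intros L. destruct Hz as [Hz1 Hz2]. apply Rlt_div_r in Hz2; nra. }
  assert (Pk : Rpower d k <= eps / B').
  { apply Rle_trans with (Rpower R0 k).
    - replace k with (- - k) by ring. rewrite !(Rpower_Ropp _ (- k)).
      apply Rinv_le_contravar; [apply exp_pos|]. apply Rle_Rpower_l; lra.
    - unfold Rpower, R0. rewrite ln_exp. replace (k * _) with (ln (eps / B')) by (field; lra).
      rewrite exp_ln; [lra|]. apply Rdiv_lt_0_compat; lra. }
  apply Rle_trans with (eps / B' * B').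
  - apply Rmult_le_compat; auto using Cmod_ge_0. left; apply exp_pos.
  - right. field. lra.
Qed.

Section Dominant.

Variables (M0 M1 : R).
Hypothesis hM : 0 < M1 < M0.
Hypothesis hdom : forall g mu, mc g <> 0%Z -> has_pole k f g mu ->
  mu = M0 * (IZR (mc g) * IZR (mc g)) \/ mu <= M1 * (IZR (mc g) * IZR (mc g)).

Definition dominant (g : SL2Z) : Prop :=
  mc g <> 0%Z /\ has_pole k f g (M0 * (IZR (mc g) * IZR (mc g))).

(** Here E = mu Im w for the reduced point w, or 0 without a pole. By [Im_at_cusp], Im w = y/(c^2 |z
    - x0|^2); the order M0 c^2 of a dominant cusp cancels c^2, and otherwise mu <= M1 c^2 together
    with |z - x0| >= y gives M1/y. *)
Lemma growth_near_real_axis : exists B, 0 < B /\ forall z, 0 < Im z < 1 / 2 ->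
  exists E, Cmod (f z) <= B * exp (2 * PI * E) /\
    (E <= M1 / Im z \/ exists g, dominant g /\
      E = M0 * Im z / ((Re z - cusp g) * (Re z - cusp g) + Im z * Im z)).
Proof.
  destruct (slash_uniform_growth k G f hsub hfin hhol habs hord) as [D [B HB]].
  set (B' := Rmax B 1). assert (B'1 : 1 <= B') by apply Rmax_r. assert (B'B : B <= B') by apply Rmax_l.
  exists B'. split; [lra|]. intros z Hz.
  destruct (reduction z) as [g [w [Hw ->]]]; [lra|].
  assert (P := Cmod_denom_pos g w ltac:(lra)).
  assert (E := Cmod_denom_inv g w ltac:(lra)).
  assert (Fs : Cmod (f (moebius g w)) <= Cmod (slash k f g w)).
  { rewrite (Cmod_slash_inverse k). rewrite <- (Rmult_1_l (Cmod (slash k f g w))) at 2.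
    apply Rmult_le_compat_r; [apply Cmod_ge_0|]. apply Rpower_base_ge_1; [|assumption].
    apply Rnot_lt_le. intros L. nra. }
  (* With c = 0 the imaginary part would be unchanged, hence at least 1/2. *)
  assert (Hc : mc g <> 0%Z).
  { intros Hc. set (m := Im (moebius g w)) in *. destruct w as [x y].
    rewrite Cmod_denom_sqr, Hc in E. simpl in Hw, E.
    assert (D1 : IZR (md g) * IZR (md g) = 1).
    { rewrite <- mult_IZR. apply (f_equal IZR). assert (D2 := SL2Z_det g). rewrite Hc in D2.
      assert (D3 : (ma g * md g = 1)%Z) by lia.
      assert (md g = 1 \/ md g = -1)%Z as [-> | ->]; [|reflexivity|reflexivity].
      apply (Z.mul_eq_1 (md g) (ma g)). lia. }
    replace (m * _) with (m * (IZR (md g) * IZR (md g))) in E by ring.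
    rewrite D1 in E. lra. }
  assert (Iw := Im_at_cusp g w ltac:(lra) Hc). cbv zeta in Iw.
  set (z := moebius g w) in *. assert (Hy : 0 < Im z) by lra.
  set (x' := Re z - cusp g) in *. set (y := Im z) in *.
  assert (c0 : 0 < IZR (mc g) * IZR (mc g)).
  { apply not_0_IZR in Hc. nra. }
  set (c2 := IZR (mc g) * IZR (mc g)) in *.
  assert (Q1 : 0 < y * y) by nra. assert (Q2 : y * y <= x' * x' + y * y) by nra.
  destruct (HB g) as [H|[mu [_ [Hmu [Hp H]]]]].
  - exists 0. split.
    + rewrite Rmult_0_r, exp_0, Rmult_1_r. specialize (H w Hw). lra.
    + left. apply Rlt_le, Rdiv_lt_0_compat; lra.
  - exists (mu * Im w). split.
    { specialize (H w Hw). apply Rle_trans with (1 := Fs). apply Rle_trans with (1 := H).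
      replace (2 * PI * (mu * Im w)) with (2 * PI * mu * Im w) by ring.
      apply Rmult_le_compat_r; [left; apply exp_pos|assumption]. }
    destruct (hdom g mu Hc Hp) as [Em|Lm].
    + right. exists g. split; [split; [assumption|]; rewrite <- Em; assumption|].
      rewrite Iw, Em. fold c2 x' y. field. split; nra.
    + left. rewrite Iw. fold c2 in Lm.
      apply Rle_trans with (M1 * c2 * (y / (c2 * (x' * x' + y * y)))).
      { apply Rmult_le_compat_r; [|assumption]. apply Rlt_le, Rdiv_lt_0_compat; nra. }
      replace (M1 * c2 * _) with (M1 * y * / (x' * x' + y * y)) by (field; split; nra).
      replace (M1 / y) with (M1 * y * / (y * y)) by (field; lra).
      apply Rmult_le_compat_l; [nra|]. apply Rinv_le_contravar; assumption.
Qed.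

End Dominant.

End Cusps.

(** * Asymptotics in a sector at a dominant cusp *)

Lemma acos_near_0 (eps : R) : 0 < eps -> exists delta, 0 < delta /\
  forall v, Rabs v <= delta -> Rabs (acos v - PI / 2) < eps.
Proof.
  intros He.
  assert (C0 : continuity_pt acos 0).
  { apply derivable_continuous_pt, derivable_pt_acos. lra. }
  destruct (C0 eps He) as [delta [Hd H]]. exists (delta / 2). split; [lra|].
  intros v Hv. destruct (Req_dec v 0) as [->|N].
  - rewrite acos_0, Rminus_diag, Rabs_R0. assumption.
  - rewrite <- acos_0. apply H. split; [split; [exact I|auto]|].
    simpl. unfold Rdist. rewrite Rminus_0_r. lra.
Qed.

Definition cis (s : R) : C := Cexp (0, s).

Lemma Cmod_cis (s : R) : Cmod (cis s) = 1.
Proof. unfold cis. rewrite Cmod_Cexp. apply exp_0. Qed.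

Lemma Cmod_phase_diff (s t : R) : Rabs (s - t) <= 1 / 2 ->
  Cmod (cis s - cis t)%C <= 9 * Rabs (s - t).
Proof.
  intros H. assert (E' : cis s = (cis t * Cexp (RtoC (s - t)%R * Ci))%C).
  { unfold cis. rewrite <- Cexp_plus. f_equal. apply C_eq; simpl; ring. }
  rewrite E'.
  replace (_ - _)%C with (cis t * (Cexp (RtoC (s - t)%R * Ci) - 1))%C by ring.
  assert (E : Cmod (RtoC (s - t)%R * Ci) = Rabs (s - t)) by (rewrite Cmod_mult, Cmod_R, Cmod_Ci; ring).
  rewrite Cmod_mult, Cmod_cis, Rmult_1_l.
  eapply Rle_trans; [apply Cexp_minus_1_bound|]; rewrite E; lra.
Qed.

Lemma Cpower_polar (z : C) (k : R) : Cpower z k = (RtoC (Rpower (Cmod z) k) * cis (k * Carg z)%R)%C.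
Proof.
  unfold Cpower, Clog.
  replace (RtoC k * _)%C with (RtoC (k * ln (Cmod z))%R + (0%R, (k * Carg z)%R))%C
    by (apply C_eq; simpl; ring).
  rewrite Cexp_plus. unfold cis. f_equal. unfold Cexp, Rpower. apply C_eq; unfold Re, Im; simpl;
  rewrite ?cos_0, ?sin_0; ring.
Qed.

Definition model (k M0 : R) (t : C) : C := (RtoC (Rpower (Cmod t) (- k)) * ee M0 (/ t))%C.

(** [model] has the real power |t|^(-k) in place of a branch of t^(-k). The opening [delta] of the
    sector may shrink with [eps], and in a narrow sector around the vertical the two differ by a
    nearly constant phase, which is part of [A]. *)
Definition sector_estimate (k M0 : R) (f : C -> C) (x0 : R) (A : C) : Prop :=
  forall eps, 0 < eps -> exists delta, 0 < delta /\
    forall u y, 0 < y < delta -> Rabs u <= delta * y ->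
      Cmod (f (x0 + (u, y))%C - A * model k M0 (u, y)) <= eps * Cmod (model k M0 (u, y)).

(** For t close to the direction i, -1/(c t) is close to the direction i/c, which points up or down
    according to the sign of [c]. *)
Lemma Carg_near_imaginary_axis (c : R) (u y : R) : c <> 0 -> 0 < y ->
  forall eps delta, (forall v, Rabs v <= delta -> Rabs (acos v - PI / 2) < eps) ->
  Rabs u <= delta * y ->
  Rabs (Carg (- / (c * (u, y)))%C - (if Rlt_dec 0 c then PI / 2 else - (PI / 2))) < eps.
Proof.
  intros Hc Hy eps delta Ha Hu.
  set (r := Cmod (u, y)). assert (Q := Cmod_sqr (u, y)). fold r in Q. unfold Re, Im in Q; simpl in Q.
  assert (r0 : 0 < r). { apply Cmod_gt_0. intros E. injection E. lra. }
  assert (ry : y <= r) by nra.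
  assert (N : (c * (u, y))%C <> 0).
  { apply Cmod_gt_0. rewrite Cmod_mult, Cmod_R. apply Rmult_lt_0_compat; [now apply Rabs_pos_lt|assumption]. }
  assert (E : (- / (c * (u, y)))%C = (- u / (c * (r * r)), y / (c * (r * r)))).
  { assert (N2 : r * r <> 0) by nra.
    set (X := (- u / (c * (r * r)), y / (c * (r * r))) : C).
    assert (EX : (X * (c * (u, y)) = - (1))%C).
    { unfold X. rewrite Q in *. apply C_eq; simpl; field; split; assumption. }
    transitivity (- (1) * / (c * (u, y)))%C; [ring|]. rewrite <- EX. field.
    split; [intros E; injection E; lra|]. intros E; apply RtoC_inj in E; contradiction. }
  assert (Em : Cmod (- / (c * (u, y)))%C = / (Rabs c * r)).
  { rewrite Cmod_opp, Cmod_inv, Cmod_mult, Cmod_R by assumption. reflexivity. }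
  unfold Carg. rewrite Em, E. unfold Re, Im; simpl.
  assert (K : forall s, Rabs (s * (u / r)) = Rabs s * (Rabs u / r)).
  { intros s. rewrite Rabs_mult, Rabs_div by lra. rewrite (Rabs_right r) by lra. reflexivity. }
  assert (B : Rabs u / r <= delta).
  { apply Rle_div_l; [lra|]. assert (0 <= Rabs u) by apply Rabs_pos. nra. }
  destruct (Rlt_dec 0 c) as [Pc|Nc].
  - destruct (Rle_dec 0 (y / (c * (r * r)))) as [L|L].
    + apply Ha. rewrite (Rabs_right c) by lra.
      replace (_ / _) with ((-1) * (u / r)) by (field; lra).
      rewrite K, Rabs_left by lra. lra.
    + exfalso. apply L, Rlt_le, Rdiv_lt_0_compat; [assumption|]. apply Rmult_lt_0_compat; nra.
  - destruct (Rle_dec 0 (y / (c * (r * r)))) as [L|L].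
    + exfalso. assert (Nc2 : c < 0) by (destruct (Rtotal_order c 0) as [?|[?|?]]; tauto).
      assert (rr : 0 < r * r) by nra. assert (0 < - (c * (r * r))) by nra.
      assert (0 < y / - (c * (r * r))) by (apply Rdiv_lt_0_compat; assumption).
      replace (y / - (c * (r * r))) with (- (y / (c * (r * r)))) in H0 by (field; split; nra). lra.
    + match goal with |- Rabs (- acos ?v - - (PI / 2)) < _ =>
        replace (- acos v - - (PI / 2)) with (- (acos v - PI / 2)) by ring end.
      rewrite Rabs_Ropp. apply Ha. rewrite (Rabs_left1 c) by lra.
      replace (_ / _) with (1 * (u / r)) by (field; lra).
      rewrite K, Rabs_R1. lra.
Qed.

(** Put z = cusp + t and w = g^(-1) z. Then w = -d/c - 1/(c^2 t) and denom g w = -1/(c t). With mu =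
    M0 c^2 the leading term b exp(-2 pi i mu w) becomes a constant [kappa] times b exp(2 pi i M0/t),
    and the power of the denominator becomes |c|^(-k) |t|^(-k) times a phase close to
    [cis (k * theta)]. [A] collects the constants. *)
Lemma sector_asymptotics (k M0 : R) (f : C -> C) (g : SL2Z) : dominant k f M0 g ->
  exists A : C, A <> 0 /\ sector_estimate k M0 f (cusp g) A.
Proof.
  intros [Hc [b [Hmu [Hb Hlim]]]].
  set (c := IZR (mc g)) in *. assert (c0 : c <> 0) by now apply not_0_IZR.
  assert (ac : 0 < Rabs c) by now apply Rabs_pos_lt.
  set (mu := M0 * (c * c)) in *.
  set (theta := if Rlt_dec 0 c then PI / 2 else - (PI / 2)).
  set (kappa := ee (- mu) (RtoC (- (IZR (md g) / c)))).
  set (ck := Rpower (Rabs c) (- k)). assert (ckp : 0 < ck) by apply exp_pos.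
  exists (RtoC ck * cis (k * theta)%R * b * kappa)%C. split.
  { repeat apply Cmult_neq_0; trivial; try apply Cexp_neq_0.
    intros E. apply RtoC_inj in E. lra. }
  intros eps He.
  set (Bb := Cmod b). assert (Bbp : 0 < Bb) by now apply Cmod_gt_0.
  set (e1 := eps / (2 * ck)). assert (e1p : 0 < e1) by (apply Rdiv_lt_0_compat; lra).
  destruct (Hlim e1 e1p) as [Y HY].
  (* The phase k (phi - theta) must stay below 1/2 for [Cmod_phase_diff], and 9 |b| times it below
     [e1]; the added 1 keeps the divisor positive when k = 0. *)
  set (e2 := Rmin (1 / 2) (e1 / (9 * Bb)) / (Rabs k + 1)).
  assert (kp : 0 < Rabs k + 1) by (generalize (Rabs_pos k); lra).
  assert (e2p : 0 < e2).
  { apply Rdiv_lt_0_compat; [|assumption]. apply Rmin_pos; [lra|]. apply Rdiv_lt_0_compat; lra. }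
  destruct (acos_near_0 e2 e2p) as [d1 [Pd1 Hd1]].
  set (Y' := Rmax Y 0 + 1).
  assert (Y'p : 0 < Y' /\ Y < Y').
  { unfold Y'. generalize (Rmax_l Y 0) (Rmax_r Y 0). lra. }
  (* Since |u| <= y gives r^2 <= 2 y^2, one has Im w = y/(c^2 r^2) >= 1/(2 c^2 y), which is at least
     Y' when y <= d2. *)
  set (d2 := 1 / (2 * (c * c) * Y')). assert (cc : 0 < c * c) by nra.
  assert (d2p : 0 < d2).
  { unfold d2. apply Rdiv_lt_0_compat; [lra|]. apply Rmult_lt_0_compat; lra. }
  exists (Rmin 1 (Rmin d1 d2)). split; [repeat apply Rmin_pos; lra|].
  intros u y [Hy Hyd] Hu.
  assert (L1 : Rmin 1 (Rmin d1 d2) <= 1) by apply Rmin_l.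
  assert (L2 : Rmin 1 (Rmin d1 d2) <= d1) by (eapply Rle_trans; [apply Rmin_r|apply Rmin_l]).
  assert (L3 : Rmin 1 (Rmin d1 d2) <= d2) by (eapply Rle_trans; [apply Rmin_r|apply Rmin_r]).
  set (t := (u, y) : C) in *. set (z := (cusp g + t)%C).
  assert (Hz : 0 < Im z) by (unfold z, t; simpl; lra).
  set (w := moebius (SL2Z_inv g) z). assert (Hw : 0 < Im w) by now apply Im_moebius_pos.
  assert (Ez : moebius g w = z) by now apply moebius_invK.
  assert (tn : t <> 0). { intros E. injection E. lra. }
  assert (c0C : RtoC c <> 0). { intros E. apply RtoC_inj in E. contradiction. }
  assert (Ed : denom (SL2Z_inv g) z = (- (c * t))%C).
  { unfold denom, z, cusp. simpl. rewrite opp_IZR. fold c. rewrite RtoC_div, RtoC_opp by assumption.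
    field. assumption. }
  assert (Ew : w = (RtoC (- (IZR (md g) / c)) - / (c * c * t))%C).
  { unfold w, moebius. rewrite Ed. simpl. rewrite opp_IZR. unfold z, cusp. fold c.
    rewrite !RtoC_opp, !RtoC_div by assumption.
    assert (D := det_C g). fold c in D.
    assert (Num : (IZR (md g) * (IZR (ma g) / c + t) + - IZR (mb g) = IZR (md g) * t + 1 / c)%C).
    { rewrite <- D. field. assumption. }
    rewrite Num. field. split; assumption. }
  assert (Edw : denom g w = (- / (c * t))%C).
  { unfold denom. fold c. rewrite Ew, RtoC_opp, RtoC_div by assumption. field. split; assumption. }
  set (r := Cmod t). assert (rp : 0 < r) by now apply Cmod_gt_0.
  assert (Q := Cmod_sqr t). fold r in Q. unfold t, Re, Im in Q. simpl in Q.
  assert (uy : Rabs u <= y) by nra. apply Rabs_le_between in uy.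
  assert (Iw : Im w = y / (c * c * (r * r))).
  { assert (H := Im_at_cusp g w Hw Hc). cbv zeta in H. rewrite Ez in H. rewrite H. fold c.
    rewrite Q. unfold z, t, Re, Im; simpl. f_equal; ring. }
  assert (IwY : Y < Im w).
  { apply Rlt_le_trans with Y'; [tauto|]. rewrite Iw.
    apply Rle_div_r; [apply Rmult_lt_0_compat; nra|].
    assert (y * (2 * (c * c) * Y') <= 1).
    { apply Rle_div_r; [apply Rmult_lt_0_compat; lra|]. fold d2. lra. }
    assert (r * r <= 2 * (y * y)) by nra.
    apply Rle_trans with (Y' * (c * c * (2 * (y * y)))).
    - apply Rmult_le_compat_l; [lra|]. apply Rmult_le_compat_l; lra.
    - nra. }
  specialize (HY w IwY).
  set (s := slash k f g w) in *.
  set (eta := (s * ee mu w - b)%C) in *.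
  assert (Es : s = ((b + eta) * (kappa * ee M0 (/ t)))%C).
  { replace (kappa * ee M0 (/ t))%C with (ee (- mu) w).
    - unfold eta. transitivity (s * (ee (- mu) w * ee mu w))%C; [|ring]. rewrite ee_opp_l. ring.
    - rewrite Ew. unfold Cminus. rewrite ee_plus_r. unfold kappa. f_equal.
      unfold ee. f_equal. unfold mu. rewrite RtoC_opp, !RtoC_mult. field. split; assumption. }
  set (phi := Carg (- / (c * t))%C).
  assert (Ef : f z = (RtoC ck * RtoC (Rpower r (- k)) * cis (k * phi)%R * s)%C).
  { rewrite <- Ez, (slash_inverse k). fold s. rewrite Cpower_polar, Edw. fold phi.
    f_equal. f_equal. rewrite <- RtoC_mult. f_equal.
    rewrite Cmod_opp, Cmod_inv, Cmod_mult, Cmod_R.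
    2:{ apply Cmult_neq_0; assumption. }
    fold r. unfold ck. rewrite <- Rpower_mult_base by assumption.
    unfold Rpower. rewrite ln_Rinv by (apply Rmult_lt_0_compat; assumption). f_equal. ring. }
  rewrite Ef, Es. unfold model. fold r.
  replace (_ - _)%C with (RtoC ck * kappa * ((cis (k * phi)%R - cis (k * theta)%R) * b + cis (k * phi)%R * eta)
    * (RtoC (Rpower r (- k)) * ee M0 (/ t)))%C by ring.
  rewrite (Cmod_mult _ (RtoC (Rpower r (- k)) * _)%C).
  apply Rmult_le_compat_r; [apply Cmod_ge_0|].
  rewrite !Cmod_mult, Cmod_R, Rabs_right by lra.
  unfold kappa. rewrite Cmod_ee_real, Rmult_1_r.
  assert (Ph : Cmod (cis (k * phi)%R - cis (k * theta)%R)%C <= 9 * (e1 / (9 * Bb))).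
  { assert (X : Rabs (phi - theta) < e2).
    { apply Carg_near_imaginary_axis with d1; trivial. nra. }
    assert (X2 : Rabs (k * phi - k * theta) <= Rmin (1 / 2) (e1 / (9 * Bb))).
    { replace (k * phi - k * theta) with (k * (phi - theta)) by ring. rewrite Rabs_mult.
      apply Rle_trans with ((Rabs k + 1) * e2).
      - assert (0 <= Rabs (phi - theta)) by apply Rabs_pos. generalize (Rabs_pos k). nra.
      - right. unfold e2. field. lra. }
    assert (X3 := Rmin_l (1 / 2) (e1 / (9 * Bb))). assert (X4 := Rmin_r (1 / 2) (e1 / (9 * Bb))).
    eapply Rle_trans; [apply Cmod_phase_diff; lra|]. lra. }
  apply Rle_trans with (ck * (2 * e1)).
  - apply Rmult_le_compat_l; [lra|]. eapply Rle_trans; [apply Cmod_triangle|].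
    rewrite !Cmod_mult. fold Bb. rewrite (Cmod_cis (k * phi)), Rmult_1_l.
    assert (Cmod (cis (k * phi)%R - cis (k * theta)%R)%C * Bb <= 9 * (e1 / (9 * Bb)) * Bb)
      by (apply Rmult_le_compat_r; lra).
    replace (9 * (e1 / (9 * Bb)) * Bb) with e1 in H by (field; lra). lra.
  - right. unfold e1. field. lra.
Qed.

(** * The saddle point estimate *)

(* The modulus of [model k M0 t * ee (- lambda) t] for [t = u + i y] and [lambda = M0 / y^2],
   the choice of [y] which puts the saddle point at [u = 0]. *)
Definition omega (k M0 y u : R) : R :=
  Rpower (Cmod (u, y)) (- k) * exp (2 * PI * M0 * (y / (u * u + y * y)) + 2 * PI * (M0 / y)).

Lemma omega_pos (k M0 y u : R) : 0 < omega k M0 y u.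
Proof. apply Rmult_lt_0_compat; apply exp_pos. Qed.

(** The value M0/y^2 makes the linear term in [u] of the phase vanish: u/(u^2 + y^2) - u/y^2 is
    cubic in [u]. *)
Lemma model_saddle (k M0 u y : R) : 0 < y ->
  (model k M0 (u, y) * ee (- (M0 / (y * y))) (u, y))%C =
  (RtoC (omega k M0 y u) * cis (2 * PI * M0 * (u * (/ (u * u + y * y) - / (y * y)))))%C.
Proof.
  intros Hy. assert (D : 0 < u * u + y * y) by nra.
  set (X := 2 * PI * M0 * (y / (u * u + y * y)) + 2 * PI * (M0 / y)).
  set (phi := 2 * PI * M0 * (u * (/ (u * u + y * y) - / (y * y)))).
  assert (E : RtoC (exp X) = Cexp (RtoC X)).
  { unfold Cexp, Re, Im. simpl. rewrite cos_0, sin_0. apply C_eq; simpl; ring. }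
  unfold model, omega. fold X. rewrite RtoC_mult, E.
  transitivity (RtoC (Rpower (Cmod (u, y)) (- k)) * (ee M0 (/ (u, y)) * ee (- (M0 / (y * y))) (u, y)))%C; [ring|].
  transitivity (RtoC (Rpower (Cmod (u, y)) (- k)) * (Cexp X * cis phi))%C; [|ring].
  f_equal. unfold ee, cis. rewrite <- !Cexp_plus. f_equal. rewrite !ee_arg. unfold X, phi.
  assert (Ei : (/ (u, y))%C = (u / (u * u + y * y), - y / (u * u + y * y))).
  { unfold Cinv. apply C_eq; unfold Re, Im; simpl; field; try split; nra. }
  rewrite Ei. unfold Re, Im; simpl. apply C_eq; unfold Re, Im; simpl; field; try split; nra.
Qed.

Lemma Cmod_model (k M0 u y : R) : 0 < y ->
  Cmod (model k M0 (u, y)) * exp (2 * PI * (M0 / y)) = omega k M0 y u.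
Proof.
  intros Hy. assert (H := f_equal Cmod (model_saddle k M0 u y Hy)).
  rewrite !Cmod_mult, Cmod_cis, Cmod_R, Cmod_ee in H.
  rewrite Rabs_right, Rmult_1_r in H by (generalize (omega_pos k M0 y u); lra).
  rewrite <- H. f_equal. f_equal. unfold Im; simpl. field. lra.
Qed.

(** The exponent y/(u^2 + y^2) falls from 1/y by about u^2/y^3, and the phase varies by about
    u^3/y^4. So the cut must lie between the Gaussian width y^(3/2) and y^(4/3). With y = tau^(-5)
    these are tau^(-7.5) and tau^(-20/3), and the integer power tau^(-7) lies between them: there
    the exponent has lost at least tau/2. *)
Lemma saddle_far (tau u y : R) : 1 <= tau -> y * tau ^ 5 = 1 -> 1 <= Rabs u * tau ^ 7 ->
  y / (u * u + y * y) <= tau ^ 5 - tau / 2.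
Proof.
  intros Ht Hy Hu. set (v := Rabs u) in *.
  assert (uu : u * u = v * v) by (unfold v; rewrite <- Rabs_mult, Rabs_right; nra).
  assert (T : forall n, 1 <= tau ^ n) by (intros n; apply pow_R1_Rle; assumption).
  assert (T5 := T 5%nat). assert (T7 := T 7%nat). assert (T4 := T 4%nat).
  assert (y0 : 0 < y) by nra.
  assert (v1 : y * y <= v * v * tau ^ 4).
  { assert (v * tau ^ 7 * (v * tau ^ 7) >= 1) by nra.
    assert (E : v * tau ^ 7 * (v * tau ^ 7) = v * v * tau ^ 4 * (tau ^ 5 * tau ^ 5)) by ring.
    assert (y * y * (tau ^ 5 * tau ^ 5) = 1) by (replace (y * y * (tau ^ 5 * tau ^ 5)) with ((y * tau ^ 5) * (y * tau ^ 5)) by ring; rewrite Hy; ring).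
    assert (0 < tau ^ 5 * tau ^ 5) by nra.
    apply Rmult_le_reg_r with (tau ^ 5 * tau ^ 5); lra. }
  apply Rle_div_l; [nra|]. rewrite uu.
  assert (A : (tau ^ 5 - tau / 2) * (y * y) = y - tau / 2 * (y * y)).
  { rewrite Rmult_minus_distr_r. f_equal. replace (tau ^ 5 * (y * y)) with (y * tau ^ 5 * y) by ring.
    rewrite Hy. ring. }
  rewrite Rmult_plus_distr_l, A.
  assert (B : tau / 2 * (y * y) <= (tau ^ 5 - tau / 2) * (v * v)).
  { apply Rle_trans with (tau / 2 * (v * v * tau ^ 4)).
    - apply Rmult_le_compat_l; lra.
    - replace (tau / 2 * (v * v * tau ^ 4)) with (tau ^ 5 / 2 * (v * v)) by field.
      apply Rmult_le_compat_r; [nra|]. replace (tau ^ 5) with (tau * tau ^ 4) by ring. nra. }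
  lra.
Qed.

(** The cubic term at the cut is tau^(-21)/y^4 = 1/tau. *)
Lemma saddle_phase (tau u y : R) : 1 <= tau -> y * tau ^ 5 = 1 -> Rabs u * tau ^ 7 <= 1 ->
  Rabs (u * (/ (u * u + y * y) - / (y * y))) <= / tau.
Proof.
  intros Ht Hy Hu.
  assert (T : forall n, 1 <= tau ^ n) by (intros n; apply pow_R1_Rle; assumption).
  assert (T5 := T 5%nat). assert (T7 := T 7%nat).
  assert (y0 : 0 < y) by nra. assert (yy : 0 < y * y) by nra.
  assert (D : 0 < u * u + y * y) by nra.
  set (v := Rabs u) in *. assert (v0 : 0 <= v) by apply Rabs_pos.
  assert (uu : u * u = v * v) by (unfold v; rewrite <- Rabs_mult, Rabs_right; nra).
  rewrite Rabs_mult. fold v.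
  replace (/ (u * u + y * y) - / (y * y)) with (- ((v * v) / ((u * u + y * y) * (y * y))))
    by (rewrite uu; field; rewrite <- uu; split; lra).
  rewrite Rabs_Ropp, Rabs_right.
  2:{ apply Rle_ge, Rle_div_r; [nra|]. nra. }
  replace (v * (v * v / ((u * u + y * y) * (y * y)))) with (v * v * v / ((u * u + y * y) * (y * y)))
    by (field; lra).
  apply Rle_div_l; [nra|].
  apply Rle_trans with (/ tau * (y * y * (y * y))).
  2:{ apply Rmult_le_compat_l; [left; apply Rinv_0_lt_compat; lra|]. apply Rmult_le_compat_r; nra. }
  assert (Y : forall a, 0 <= a -> a * tau ^ 21 <= 1 -> a <= / tau * (y * y * (y * y))).
  { intros a Ha H. apply Rmult_le_reg_r with (tau ^ 21); [generalize (T 21%nat); lra|].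
    apply Rle_trans with (1 := H). right.
    replace (tau ^ 21) with (tau * ((tau ^ 5) * (tau ^ 5) * (tau ^ 5) * (tau ^ 5))) by ring.
    transitivity ((y * tau ^ 5) * (y * tau ^ 5) * (y * tau ^ 5) * (y * tau ^ 5)); [rewrite Hy; ring|].
    field. lra. }
  apply Y; [apply Rmult_le_pos; nra|].
  replace (v * v * v * tau ^ 21) with ((v * tau ^ 7) * (v * tau ^ 7) * (v * tau ^ 7)) by ring.
  assert (0 <= v * tau ^ 7) by nra. assert ((v * tau ^ 7) * (v * tau ^ 7) <= 1) by nra. nra.
Qed.

(** tau^(-8) is inside the Gaussian width, so the loss u^2/y^3 in the exponent stays below 1. This
    yields the lower bound for the saddle integral. *)
Lemma saddle_near (tau u y : R) : 1 <= tau -> y * tau ^ 5 = 1 -> Rabs u * tau ^ 8 <= 1 ->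
  tau ^ 5 - 1 <= y / (u * u + y * y).
Proof.
  intros Ht Hy Hu.
  assert (T : forall n, 1 <= tau ^ n) by (intros n; apply pow_R1_Rle; assumption).
  assert (T5 := T 5%nat). assert (T8 := T 8%nat).
  assert (y0 : 0 < y) by nra.
  set (v := Rabs u) in *. assert (v0 : 0 <= v) by apply Rabs_pos.
  assert (uu : u * u = v * v) by (unfold v; rewrite <- Rabs_mult, Rabs_right; nra).
  apply Rle_div_r; [nra|]. rewrite uu.
  assert (A : (tau ^ 5 - 1) * (y * y) = y - y * y).
  { replace ((tau ^ 5 - 1) * (y * y)) with (y * tau ^ 5 * y - y * y) by ring. rewrite Hy. ring. }
  rewrite Rmult_plus_distr_l, A.
  assert (B : tau ^ 5 * (v * v) <= y * y); [|nra].
  apply Rmult_le_reg_r with (tau ^ 5 * tau ^ 5 * tau); [nra|].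
  replace (tau ^ 5 * (v * v) * (tau ^ 5 * tau ^ 5 * tau)) with ((v * tau ^ 8) * (v * tau ^ 8)) by ring.
  replace (y * y * (tau ^ 5 * tau ^ 5 * tau)) with ((y * tau ^ 5) * (y * tau ^ 5) * tau) by ring.
  rewrite Hy. assert (0 <= v * tau ^ 8) by nra. nra.
Qed.

Section Saddle.

Variables (k M0 M1 B : R) (f : C -> C) (Dom : R -> Prop) (L : nat).
Hypothesis hk : k < 0.
Hypothesis hM : 0 < M1 < M0.
Hypothesis hL : (1 <= L)%nat.
Hypothesis hB : 0 < B.
Hypothesis hgrowth : forall z, 0 < Im z < 1 / 2 ->
  exists E, Cmod (f z) <= B * exp (2 * PI * E) /\
    (E <= M1 / Im z \/ exists x0, Dom x0 /\
      E = M0 * Im z / ((Re z - x0) * (Re z - x0) + Im z * Im z)).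
Hypothesis hsector : forall x0, Dom x0 ->
  exists A : C, A <> 0 /\ sector_estimate k M0 f x0 A.
Hypothesis hDom : forall x0, Dom x0 -> exists q : Z, x0 = IZR q / INR L.

(* The size of all contributions away from the saddle points. *)
Definition minor (tau : R) : R :=
  exp (2 * PI * M0 * (tau ^ 5 - tau / 2) + 2 * PI * M0 * tau ^ 5).

(** The error is relative to [omega] in the core of the saddle and absolute outside, where [omega]
    itself may be smaller than the available bound for f. *)
Definition saddle_estimate (x0 : R) (A : C) (K : R) : Prop :=
  forall eps, 0 < eps -> exists tau0, forall tau u y, tau0 <= tau -> 1 <= tau ->
    y * tau ^ 5 = 1 -> Rabs u <= / (2 * INR L) ->
    Cmod (f (x0 + (u, y))%C * ee (- (M0 / (y * y))) (u, y) - A * omega k M0 y u)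
      <= eps * omega k M0 y u + K * minor tau.

(** Points of (1/L) Z that are not dominant are included, with A = 0, so that all cells of width 1/L
    can be treated alike. *)
Lemma saddle_pointwise (q : Z) : let x0 := IZR q / INR L in
  exists A : C, (Dom x0 -> A <> 0) /\ exists K, 0 < K /\
  saddle_estimate x0 A K.
Proof.
  intros x0.
  assert (L1 : 1 <= INR L) by (apply (le_INR 1); assumption).
  assert (Ppi := PI_RGT_0). assert (PM : 0 < PI * M0) by (apply Rmult_lt_0_compat; lra).
  assert (HA : exists A : C, (Dom x0 -> A <> 0) /\ (~ Dom x0 -> A = 0) /\
    (Dom x0 -> sector_estimate k M0 f x0 A)).
  { destruct (classic (Dom x0)) as [H|H].
    - destruct (hsector x0 H) as [A [A0 HA]]. exists A. repeat split; tauto.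
    - exists 0. repeat split; tauto. }
  destruct HA as [A [A1 [A2 A3]]]. exists A. split; [assumption|].
  assert (R2 : 0 < Rpower 2 (- k)) by apply exp_pos.
  assert (A0 := Cmod_ge_0 A).
  (* Away from the core, f contributes [B] and the subtracted main term contributes the rest,
     because |t| <= 2 there. *)
  exists (B + Cmod A * Rpower 2 (- k)). split; [nra|].
  intros eps He.
  set (e1 := eps / 2).
  assert (Hdelta : exists delta, 0 < delta /\ (Dom x0 -> forall u y, 0 < y < delta -> Rabs u <= delta * y ->
      Cmod (f (x0 + (u, y))%C - A * model k M0 (u, y)) <= e1 * Cmod (model k M0 (u, y)))).
  { destruct (classic (Dom x0)) as [H|H].
    - destruct (A3 H e1) as [d [Pd Hd]]; [unfold e1; lra|]. exists d. split; [assumption|]. intros _. exact Hd.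
    - exists 1. split; [lra|tauto]. }
  destruct Hdelta as [delta [Pd Hd]].
  (* Thresholds for tau. T1: a distance 1/(2L) lies beyond the cut. T2: M1 tau^5 <= M0 (tau^5 -
     tau/2). T3: the core lies in the sector. T4: the phase is below 1/2. T5: the phase error times
     |A| is at most eps/2. *)
  set (T1 := 2 * INR L). set (T2 := M0 / (M0 - M1)). set (T3 := 2 / delta).
  set (T4 := 4 * PI * M0). set (T5 := (Cmod A + 1) * (36 * PI * M0) / eps).
  exists (3 + Rabs T1 + Rabs T2 + Rabs T3 + Rabs T4 + Rabs T5).
  intros tau u y Ht0 Ht Hy Hu. unfold T1 in Hu.
  assert (Q1 := Rle_abs T1). assert (Q2 := Rle_abs T2). assert (Q3 := Rle_abs T3).
  assert (Q4 := Rle_abs T4). assert (Q5 := Rle_abs T5).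
  assert (G1 := Rabs_pos T1). assert (G2 := Rabs_pos T2). assert (G3 := Rabs_pos T3).
  assert (G4 := Rabs_pos T4). assert (G5 := Rabs_pos T5).
  assert (B1 : T1 <= tau) by lra. assert (B2 : T2 <= tau) by lra. assert (B3 : T3 <= tau) by lra.
  assert (B4 : T4 <= tau) by lra. assert (B5 : T5 <= tau) by lra. assert (B6 : 3 <= tau) by lra.
  clear Ht0 Q1 Q2 Q3 Q4 Q5 G1 G2 G3 G4 G5.
  assert (T : forall n, 1 <= tau ^ n) by (intros n; apply pow_R1_Rle; assumption).
  assert (Tt : forall n, tau <= tau ^ S n).
  { intros n. simpl. generalize (T n). nra. }
  assert (y0 : 0 < y) by (generalize (T 5%nat); nra).
  assert (yi : / y = tau ^ 5). { apply Rmult_eq_reg_l with y; [|lra]. rewrite Rinv_r, Hy; lra. }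
  assert (ysm : y * tau <= 1).
  { rewrite <- Hy. apply Rmult_le_compat_l; [lra|apply Tt]. }
  assert (yh : y < 1 / 2) by nra.
  set (t := (u, y) : C).
  assert (EZ : Cmod (ee (- (M0 / (y * y))) t) = exp (2 * PI * M0 * tau ^ 5)).
  { rewrite Cmod_ee. f_equal. rewrite <- yi. unfold t; simpl. field. lra. }
  assert (Eo : 2 * PI * (M0 / y) = 2 * PI * M0 * tau ^ 5) by (rewrite <- yi; field; lra).
  assert (om := omega_pos k M0 y u).
  assert (u1 : Rabs u <= 1).
  { apply Rle_trans with (1 := Hu). apply Rmult_le_reg_l with (2 * INR L); [lra|]. rewrite Rinv_r by lra. lra. }
  assert (tb : Cmod t <= 2).
  { eapply Rle_trans; [apply Cmod_le_sum|]. unfold t, Re, Im; simpl. rewrite (Rabs_right y); lra. }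
  assert (tp : 0 < Cmod t). { apply Cmod_gt_0. intros E. injection E. lra. }
  destruct (classic (Dom x0 /\ Rabs u * tau ^ 7 < 1)) as [[HD Hu7]|Hn].
  - assert (sec : Rabs u <= delta * y).
    { apply Rmult_le_reg_r with (tau ^ 7); [generalize (T 7%nat); lra|].
      replace (delta * y * tau ^ 7) with (delta * (y * tau ^ 5) * tau ^ 2) by ring. rewrite Hy.
      assert (2 <= delta * tau) by (unfold T3 in B3; apply Rle_div_l in B3; lra).
      simpl. nra. }
    assert (yd : y < delta).
    { apply Rmult_lt_reg_r with tau; [lra|].
      assert (2 <= delta * tau) by (unfold T3 in B3; apply Rle_div_l in B3; lra). lra. }
    specialize (Hd HD u y (conj y0 yd) sec).
    set (phi := 2 * PI * M0 * (u * (/ (u * u + y * y) - / (y * y)))).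
    assert (Es := model_saddle k M0 u y y0). fold phi t in Es.
    replace (_ - _)%C with ((f (x0 + t)%C - A * model k M0 t) * ee (- (M0 / (y * y))) t
      + A * omega k M0 y u * (cis phi - 1))%C.
    2:{ transitivity (f (x0 + t)%C * ee (- (M0 / (y * y))) t - A * (model k M0 t * ee (- (M0 / (y * y))) t)
          + A * omega k M0 y u * (cis phi - 1))%C; [ring|]. rewrite Es. ring. }
    eapply Rle_trans; [apply Cmod_triangle|].
    rewrite !Cmod_mult, EZ, Cmod_R, (Rabs_right (omega _ _ _ _)) by lra.
    assert (Ph : Cmod (cis phi - 1)%C <= 18 * PI * M0 / tau).
    { replace (RtoC 1) with (cis 0). 2:{ unfold cis. apply Cexp_0. }
      assert (PP : Rabs (phi - 0) <= 2 * PI * M0 * / tau).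
      { rewrite Rminus_0_r. unfold phi. rewrite Rabs_mult, (Rabs_right (2 * PI * M0)) by lra.
        apply Rmult_le_compat_l; [nra|]. apply saddle_phase; trivial. lra. }
      assert (PP2 : 2 * PI * M0 * / tau <= 1 / 2).
      { apply Rmult_le_reg_r with tau; [lra|]. rewrite Rmult_assoc, Rinv_l by lra. unfold T4 in B4. lra. }
      eapply Rle_trans; [apply Cmod_phase_diff; lra|].
      apply Rle_trans with (9 * (2 * PI * M0 * / tau)); [lra|]. right. field. lra. }
    assert (X1 : Cmod (f (x0 + t)%C - A * model k M0 t) * exp (2 * PI * M0 * tau ^ 5) <= e1 * omega k M0 y u).
    { rewrite <- (Cmod_model k M0 u y y0), Eo, <- Rmult_assoc.
      apply Rmult_le_compat_r; [left; apply exp_pos|]. exact Hd. }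
    assert (X2 : Cmod A * Cmod (cis phi - 1)%C <= e1).
    { apply Rle_trans with (Cmod A * (18 * PI * M0 / tau)); [apply Rmult_le_compat_l; assumption|].
      unfold e1. apply Rmult_le_reg_r with tau; [lra|].
      replace (Cmod A * (18 * PI * M0 / tau) * tau) with (Cmod A * (18 * PI * M0)) by (field; lra).
      unfold T5 in B5. apply Rle_div_l in B5; [|assumption].
      assert (0 <= PI * M0) by nra. nra. }
    assert (0 < minor tau) by apply exp_pos.
    assert (0 <= (B + Cmod A * Rpower 2 (- k)) * minor tau) by (apply Rmult_le_pos; nra).
    unfold e1 in *. nra.
  (* Outside the core every dominant point is beyond the cut: [x0] itself by the case hypothesis,
     any other one because it is at least 1/L from [x0] while |u| <= 1/(2L). *)
  - assert (far : forall x1, Dom x1 -> y / ((x0 + u - x1) * (x0 + u - x1) + y * y) <= tau ^ 5 - tau / 2).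
    { intros x1 H1. apply saddle_far; trivial.
      destruct (hDom x1 H1) as [q1 E1].
      destruct (Z.eq_dec q1 q) as [E|E].
      - assert (Ex : x1 = x0) by (unfold x0; rewrite E1, E; reflexivity).
        rewrite Ex in H1 |- *. replace (x0 + u - x0) with u by ring.
        apply Rnot_lt_le. intros Lt. apply Hn. split; assumption.
      - assert (X : / (2 * INR L) <= Rabs (x0 + u - x1)).
        { assert (Y : / INR L <= Rabs (x0 - x1)).
          { unfold x0. rewrite E1. replace (IZR q / INR L - IZR q1 / INR L) with (IZR (q - q1) * / INR L)
              by (rewrite minus_IZR; field; lra).
            rewrite Rabs_mult, (Rabs_right (/ INR L)) by (left; apply Rinv_0_lt_compat; lra).
            rewrite <- (Rmult_1_l (/ INR L)) at 1. apply Rmult_le_compat_r.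
            - left; apply Rinv_0_lt_compat; lra.
            - rewrite <- abs_IZR. apply IZR_le. lia. }
          assert (W := Rabs_triang_inv (x0 - x1) (- u)). rewrite Rabs_Ropp in W.
          replace (x0 - x1 - - u) with (x0 + u - x1) in W by ring.
          rewrite Rinv_mult in Hu |- *. lra. }
        apply Rle_trans with (/ (2 * INR L) * tau ^ 7).
        + apply Rmult_le_reg_l with (2 * INR L); [lra|]. rewrite <- Rmult_assoc, Rinv_r, Rmult_1_l, Rmult_1_r by lra.
          apply Rle_trans with tau; [assumption|apply Tt].
        + apply Rmult_le_compat_r; [generalize (T 7%nat); lra|assumption]. }
    assert (Fb : Cmod (f (x0 + t)%C) <= B * exp (2 * PI * M0 * (tau ^ 5 - tau / 2))).
    { destruct (hgrowth (x0 + t)%C) as [E [HE Hcase]]; [unfold t; simpl; lra|].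
      apply Rle_trans with (1 := HE). apply Rmult_le_compat_l; [lra|]. apply exp_monotone.
      rewrite (Rmult_assoc (2 * PI)). apply Rmult_le_compat_l; [lra|].
      unfold t in Hcase. unfold Re, Im in Hcase; simpl in Hcase.
      destruct Hcase as [C1|[x1 [H1 E1]]].
      - rewrite Rplus_0_l in C1. apply Rle_trans with (1 := C1). unfold Rdiv. rewrite yi.
        unfold T2 in B2. apply Rle_div_l in B2; [|lra].
        replace (tau ^ 5) with (tau * tau ^ 4) by ring.
        assert (tau <= tau ^ 4) by apply Tt.
        assert (M0 <= (M0 - M1) * tau ^ 4) by nra. nra.
      - rewrite !Rplus_0_l in E1. rewrite E1. apply Rle_trans with (M0 * (tau ^ 5 - tau / 2)).
        + unfold Rdiv. rewrite Rmult_assoc. apply Rmult_le_compat_l; [lra|]. apply (far x1 H1).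
        + lra. }
    assert (X1 : Cmod (f (x0 + t)%C * ee (- (M0 / (y * y))) t) <= B * minor tau).
    { rewrite Cmod_mult, EZ. unfold minor. rewrite exp_plus, <- Rmult_assoc.
      apply Rmult_le_compat_r; [left; apply exp_pos|assumption]. }
    assert (X2 : Cmod (A * omega k M0 y u) <= Cmod A * Rpower 2 (- k) * minor tau).
    { rewrite Cmod_mult, Cmod_R, Rabs_right by lra.
      destruct (classic (Dom x0)) as [HD|HD].
      - rewrite Rmult_assoc. apply Rmult_le_compat_l; [assumption|].
        unfold omega, minor. apply Rmult_le_compat; try (left; apply exp_pos).
        + apply Rle_Rpower_l; [lra|]. split; assumption.
        + apply exp_monotone. rewrite Eo. apply Rplus_le_compat_r, Rmult_le_compat_l; [nra|].
          assert (H := far x0 HD). replace (x0 + u - x0) with u in H by ring. exact H.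
      - rewrite (A2 HD), Cmod_0. lra. }
    unfold Cminus. eapply Rle_trans; [apply Cmod_triangle|]. rewrite Cmod_opp. fold t. nra.
Qed.

End Saddle.

(** * The saddle integral against the minor contributions *)

Lemma omega_continuous (k M0 y u : R) : 0 < y -> continuous (omega k M0 y) u.
Proof.
  intros Hy. apply (@ex_derive_continuous R_AbsRing R_NormedModule).
  unfold omega, Rpower, Cmod. simpl. auto_derive.
  assert (0 < u * (u * 1) + y * (y * 1)) by nra. assert (0 < u * u + y * y) by nra.
  repeat split; trivial; try lra. now apply sqrt_lt_R0.
Qed.

Lemma ex_RInt_omega (k M0 y a b : R) : 0 < y -> ex_RInt (omega k M0 y) a b.
Proof. intros Hy. apply (@ex_RInt_continuous R_CompleteNormedModule). intros; now apply omega_continuous. Qed.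

Lemma RInt_symmetric_lower (g : R -> R) (c d m : R) : (forall x, continuous g x) ->
  (forall x, 0 <= g x) -> 0 <= c <= d -> (forall x, - c <= x <= c -> m <= g x) ->
  2 * c * m <= RInt g (- d) d.
Proof.
  intros Hg Hp Hc Hm.
  assert (E : forall a b, ex_RInt g a b).
  { intros a b. apply (@ex_RInt_continuous R_CompleteNormedModule). auto. }
  rewrite <- (RInt_Chasles _ (- d) c d) by auto. rewrite <- (RInt_Chasles _ (- d) (- c) c) by auto.
  unfold plus; simpl.
  assert (P : forall a b, a <= b -> 0 <= RInt g a b) by (intros; apply RInt_ge_0; auto).
  assert (P1 := P (- d) (- c) ltac:(lra)). assert (P2 := P c d ltac:(lra)).
  assert (2 * c * m <= RInt g (- c) c); [|lra].
  replace (2 * c * m) with (RInt (fun _ => m) (- c) c).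
  - apply RInt_le; auto; try lra. + apply ex_RInt_const. + intros x Hx. apply Hm. lra.
  - rewrite RInt_const. unfold scal; simpl. unfold mult; simpl. ring.
Qed.

Lemma ln_le_linear (s x : R) : 0 < s -> 0 < x -> ln x <= s * x - ln s.
Proof.
  intros Hs Hx. assert (H := exp_ineq1_le (ln (s * x))).
  rewrite exp_ln, ln_mult in H by nra. lra.
Qed.

(** On |u| <= tau^(-8) alone the integral is at least 2 tau^(5k - 8) exp(4 pi M0 tau^5 - 2 pi M0),
    whereas [minor] is exp(4 pi M0 tau^5 - pi M0 tau). The gain exp(pi M0 tau) beats any power of
    tau. *)
Lemma minor_negligible (k M0 d eta : R) : k < 0 -> 0 < M0 -> 0 < d -> 0 < eta ->
  exists tau0, forall tau y, tau0 <= tau -> 1 <= tau -> y * tau ^ 5 = 1 ->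
    minor M0 tau <= eta * RInt (omega k M0 y) (- d) d.
Proof.
  intros Hk HM Hd He.
  assert (PM : 0 < PI * M0) by (apply Rmult_lt_0_compat; [apply PI_RGT_0|assumption]).
  (* [p] is the power of tau to be beaten. By the choice of [s], half of the gain pi M0 tau pays for
     it; the other half pays for the constants in [X]. The term 1/d in the threshold ensures
     tau^(-8) <= d. *)
  set (p := 8 - 5 * k). set (s := PI * M0 / (2 * p)).
  assert (p0 : 0 < p) by (unfold p; lra).
  assert (s0 : 0 < s) by (apply Rdiv_lt_0_compat; lra).
  set (X := Rabs (2 * PI * M0) + Rabs (ln (2 * eta)) + Rabs (p * ln s)).
  exists (2 * X / (PI * M0) + / d). intros tau y Ht0 Ht Hy.
  assert (X0 : 0 <= X).
  { unfold X. generalize (Rabs_pos (2 * PI * M0)) (Rabs_pos (ln (2 * eta))) (Rabs_pos (p * ln s)). lra. }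
  assert (di : 0 < / d) by now apply Rinv_0_lt_compat.
  assert (Q0 : 0 <= 2 * X / (PI * M0)) by (apply Rle_div_r; lra).
  assert (tX : 2 * X <= tau * (PI * M0)) by (apply Rle_div_l; lra).
  assert (T : forall n, 1 <= tau ^ n) by (intros n; apply pow_R1_Rle; assumption).
  assert (T5 := T 5%nat). assert (T8 := T 8%nat). assert (T7 := T 7%nat).
  assert (y0 : 0 < y) by nra.
  assert (yE : y = exp (- 5 * ln tau)).
  { apply Rmult_eq_reg_r with (tau ^ 5); [|lra]. rewrite Hy.
    replace (- 5 * ln tau) with (- (INR 5 * ln tau)) by (simpl; ring).
    rewrite exp_Ropp. change (exp (INR 5 * ln tau)) with (Rpower tau (INR 5)).
    rewrite Rpower_pow by lra. field. lra. }
  set (c := / tau ^ 8).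
  assert (cE : c = exp (- 8 * ln tau)).
  { unfold c. replace (- 8 * ln tau) with (- (INR 8 * ln tau)) by (simpl; ring).
    rewrite exp_Ropp. change (exp (INR 8 * ln tau)) with (Rpower tau (INR 8)).
    rewrite Rpower_pow by lra. reflexivity. }
  assert (c0 : 0 < c) by (apply Rinv_0_lt_compat; lra).
  assert (cd : c <= d).
  { unfold c. rewrite <- (Rinv_inv d). apply Rinv_le_contravar; [assumption|].
    apply Rle_trans with tau; [lra|]. replace (tau ^ 8) with (tau * tau ^ 7) by ring. nra. }
  set (m := exp (5 * k * ln tau) * exp (2 * PI * M0 * (tau ^ 5 - 1) + 2 * PI * M0 * tau ^ 5)).
  assert (yi : / y = tau ^ 5). { apply Rmult_eq_reg_l with y; [|lra]. rewrite Rinv_r, Hy; lra. }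
  assert (Low : 2 * c * m <= RInt (omega k M0 y) (- d) d).
  { apply RInt_symmetric_lower; [intros; now apply omega_continuous|intros; left; apply omega_pos|lra|].
    intros u Hu. unfold m, omega.
    apply Rmult_le_compat; try (left; apply exp_pos).
    - replace (5 * k * ln tau) with (- k * (- 5 * ln tau)) by ring.
      rewrite <- (ln_exp (- 5 * ln tau)), <- yE. change (exp (- k * ln y)) with (Rpower y (- k)).
      apply Rle_Rpower_l; [lra|]. split; [assumption|].
      assert (H := im_le_Cmod (u, y)). unfold Im in H; simpl in H. rewrite Rabs_right in H by lra. exact H.
    - apply exp_monotone. unfold Rdiv at 2. rewrite yi.
      assert (tau ^ 5 - 1 <= y / (u * u + y * y)).
      { apply saddle_near; trivial. apply Rmult_le_reg_r with c; [assumption|].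
        rewrite Rmult_assoc. unfold c at 1. rewrite Rinv_r by lra.
        rewrite Rmult_1_r, Rmult_1_l. apply Rabs_le. lra. }
      assert (2 * PI * M0 * (tau ^ 5 - 1) <= 2 * PI * M0 * (y / (u * u + y * y)))
        by (apply Rmult_le_compat_l; lra). lra. }
  apply Rle_trans with (eta * (2 * c * m)); [|apply Rmult_le_compat_l; lra].
  replace (eta * (2 * c * m)) with ((2 * eta) * c * m) by ring.
  rewrite <- (exp_ln (2 * eta)) by lra. rewrite cE. unfold m, minor. rewrite <- !exp_plus.
  apply exp_monotone.
  assert (Ln := ln_le_linear s tau s0 ltac:(lra)).
  assert (Lp : p * ln tau <= PI * M0 / 2 * tau - p * ln s).
  { replace (PI * M0 / 2 * tau) with (p * (s * tau)) by (unfold s; field; lra). nra. }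
  assert (A1 := Rle_abs (2 * PI * M0)). assert (A2 := Rle_abs (- ln (2 * eta))).
  assert (A3 := Rle_abs (- (p * ln s))). rewrite Rabs_Ropp in A2, A3.
  unfold X in tX. unfold p in Lp, A3, tX. lra.
Qed.

Lemma CInt_pieces (g : R -> C) (alpha d : R) (n : nat) : 0 <= d -> (forall x, rcont g x) ->
  is_CInt g alpha (alpha + INR n * d)
    (csum (fun i => CInt g (alpha + INR i * d) (alpha + INR i * d + d)) (seq 0 n)).
Proof.
  intros Hd Hg. induction n as [|n IH].
  - unfold csum; simpl. rewrite Rmult_0_l, Rplus_0_r. apply (@is_RInt_point C_R_NormedModule).
  - rewrite seq_S, csum_app. apply is_CInt_Chasles with (alpha + INR n * d); [assumption|].
    rewrite S_INR. replace (alpha + (INR n + 1) * d) with (alpha + INR n * d + d) by ring.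
    rewrite csum_cons. unfold csum at 1; simpl. rewrite Cplus_0_r.
    apply CInt_correct, ex_CInt_rcont; [lra|auto].
Qed.

(** * Asymptotics of the coefficients *)

Section Coefficients.

Variables (k M0 M1 B : R) (f : C -> C) (Dom : R -> Prop) (L N : nat) (u : C) (a : R -> C).
Hypothesis hk : k < 0.
Hypothesis hM : 0 < M1 < M0.
Hypothesis hL : (1 <= L)%nat.
Hypothesis hN : (1 <= N)%nat.
Hypothesis hB : 0 < B.
Hypothesis hf : forall z, half_plane 0 z -> cdiff f z.
Hypothesis hgrowth : forall z, 0 < Im z < 1 / 2 ->
  exists E, Cmod (f z) <= B * exp (2 * PI * E) /\
    (E <= M1 / Im z \/ exists x0, Dom x0 /\
      E = M0 * Im z / ((Re z - x0) * (Re z - x0) + Im z * Im z)).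
Hypothesis hsector : forall x0, Dom x0 ->
  exists A : C, A <> 0 /\ sector_estimate k M0 f x0 A.
Hypothesis hDom : forall x0, Dom x0 -> exists q : Z, x0 = IZR q / INR L.
Hypothesis hcoef : forall l x y, 0 < y -> exponents (INR N) u l ->
  is_CInt (fun x => f (x, y) * ee (- l) (x, y))%C x (x + INR N) (INR N * a l)%C.

(** Numbering starts at a dominant point, so that the coefficient with index 0 does not vanish; the
    indices below N L cover one period. *)
Definition grid (q : Z) (i : nat) : R := IZR (q + Z.of_nat i) / INR L.

(** The integral over a period is cut into N L cells centred at the grid points. Translating a cell
    to the origin produces the factor [ee (- l)] at its grid point, of modulus 1, and the saddle
    estimate replaces the cell by A i times [P], the same for all cells. *)
Lemma coefficient_asymptotics (q : Z) : Dom (IZR q / INR L) ->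
  exists A : nat -> C, A 0%nat <> 0 /\ forall eta, 0 < eta -> exists tau0, forall tau,
    tau0 <= tau -> 1 <= tau -> exponents (INR N) u (M0 * tau ^ 10) ->
    exists P, 0 < P /\
      Cmod (INR N * a (M0 * tau ^ 10)
        - csum (fun i => ee (- (M0 * tau ^ 10)) (grid q i) * A i)%C (seq 0 (N * L)) * P) <= eta * P.
Proof.
  intros Hq.
  assert (L1 : 1 <= INR L) by (apply (le_INR 1); assumption).
  assert (N1 : 1 <= INR N) by (apply (le_INR 1); assumption).
  destruct (choice (fun (i : nat) (A : C) => (Dom (grid q i) -> A <> 0) /\ exists K, 0 < K /\
    saddle_estimate k M0 f L (grid q i) A K)) as [A HA].
  { intros i. exact (saddle_pointwise k M0 M1 B f Dom L hk hM hL hB hgrowth hsector hDom (q + Z.of_nat i)). }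
  exists A. split.
  { apply (HA 0%nat). unfold grid. rewrite Z.add_0_r. exact Hq. }
  set (n := (N * L)%nat). assert (n1 : 1 <= INR n) by (apply (le_INR 1); unfold n; nia).
  destruct (uniform_list_bound (fun i K => 0 < K /\
    saddle_estimate k M0 f L (grid q i) (A i) K) (seq 0 n)) as [K HK].
  { intros i K K' Le [K0 H]. split; [lra|]. intros eps He. destruct (H eps He) as [tau0 H'].
    exists tau0. intros tau u0 y X1 X2 X3 X4. eapply Rle_trans; [exact (H' tau u0 y X1 X2 X3 X4)|].
    apply Rplus_le_compat_l, Rmult_le_compat_r; [left; apply exp_pos|assumption]. }
  { intros i _. destruct (HA i) as [_ [K HK]]. exists K. exact HK. }
  assert (K0 : 0 < K). { apply (HK 0%nat). apply in_seq. unfold n. nia. }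
  intros eta He.
  (* One half of [eta] is shared by the relative errors of the cells, the other half by their minor
     contributions. *)
  set (eps := eta / (2 * INR n)). assert (eps0 : 0 < eps) by (apply Rdiv_lt_0_compat; lra).
  destruct (uniform_list_bound (fun i tau0 => forall tau u y, tau0 <= tau -> 1 <= tau ->
    y * tau ^ 5 = 1 -> Rabs u <= / (2 * INR L) ->
    Cmod (f (grid q i + (u, y))%C * ee (- (M0 / (y * y))) (u, y) - A i * omega k M0 y u)
      <= eps * omega k M0 y u + K * minor M0 tau) (seq 0 n)) as [tau1 Htau1].
  { intros i t t' Le H tau u0 y X1. apply H. lra. }
  { intros i Hi. apply (HK i Hi). assumption. }
  set (d := / (2 * INR L)). assert (d0 : 0 < d) by (apply Rinv_0_lt_compat; lra).
  destruct (minor_negligible k M0 d (eta / (2 * INR n * K))) as [tau2 Htau2]; trivial; try lra.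
  { apply Rdiv_lt_0_compat; [lra|]. apply Rmult_lt_0_compat; lra. }
  exists (Rmax tau1 tau2). intros tau Ht0 Ht Hl. set (l := M0 * tau ^ 10) in *.
  assert (Ht1 : tau1 <= tau) by (apply Rle_trans with (2 := Ht0), Rmax_l).
  assert (Ht2 : tau2 <= tau) by (apply Rle_trans with (2 := Ht0), Rmax_r).
  assert (T5 : 1 <= tau ^ 5) by (apply pow_R1_Rle; assumption).
  set (y := / tau ^ 5). assert (Hy : y * tau ^ 5 = 1) by (apply Rinv_l; lra).
  assert (y0 : 0 < y) by (apply Rinv_0_lt_compat; lra).
  assert (El : M0 / (y * y) = l). { unfold l, y. field. lra. }
  set (P := RInt (omega k M0 y) (- d) d).
  assert (P0 : 0 < P).
  { apply RInt_gt_0; [lra|intros; apply omega_pos|intros; now apply omega_continuous]. }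
  assert (Hmin : minor M0 tau <= eta / (2 * INR n * K) * P) by (apply Htau2; assumption).
  exists P. split; [assumption|].
  set (g := fun x => (f (x, y) * ee (- l) (x, y))%C).
  assert (Hg : forall x, rcont g x).
  { intros x. apply (rcont_horizontal (fun z => f z * ee (- l) z)%C), cdiff_ccont, cdiff_mult.
    - apply hf. exact y0.
    - apply cdiff_ee. }
  (* Starting half a cell to the left of the dominant point centres every cell of width 2d = 1/L at
     a grid point. *)
  set (alpha := IZR q / INR L - d).
  set (I := fun i : nat => CInt (fun v => f (grid q i + (v, y))%C * ee (- l) (v, y))%C (- d) d).
  assert (HI : forall i, is_CInt (fun v => f (grid q i + (v, y))%C * ee (- l) (v, y))%C (- d) d (I i)).
  { intros i. apply CInt_correct, ex_CInt_rcont; [lra|]. intros v _.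
    intros e Hep. destruct (Hg (v + grid q i) e Hep) as [de [Pd Hd]].
    exists de. split; [assumption|]. intros t Ht'. specialize (Hd (t + grid q i)).
    assert (G : forall t, (f (grid q i + (t, y))%C * ee (- l) (t, y) = ee l (grid q i) * g (t + grid q i)%R)%C).
    { intros t'. unfold g. replace ((t' + grid q i)%R, y) with (grid q i + (t', y))%C by (apply C_eq; simpl; ring).
      rewrite ee_plus_r. transitivity (f (grid q i + (t', y)) * ee (- l) (t', y) * (ee (- l) (grid q i) * ee l (grid q i)))%C; [rewrite ee_opp_l; ring|ring]. }
    rewrite !G. replace (_ - _)%C with (ee l (grid q i) * (g (t + grid q i)%R - g (v + grid q i)%R))%C by ring.
    rewrite Cmod_mult, Cmod_ee_real, Rmult_1_l. apply Hd. replace (t + grid q i - (v + grid q i)) with (t - v) by ring.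
    assumption. }
  assert (Ed : 2 * d = / INR L) by (unfold d; field; lra).
  assert (Piece : forall i, CInt g (alpha + INR i * (2 * d)) (alpha + INR i * (2 * d) + 2 * d)
    = (ee (- l) (grid q i) * I i)%C).
  { intros i. apply is_CInt_unique.
    assert (Eg : grid q i = alpha + INR i * (2 * d) + d).
    { unfold grid, alpha. rewrite plus_IZR, <- INR_IZR_INZ, Ed. field. lra. }
    replace (alpha + INR i * (2 * d)) with (- d + grid q i) by (rewrite Eg; ring).
    replace (- d + grid q i + 2 * d) with (d + grid q i) by ring.
    assert (J := is_CInt_scal (ee (- l) (grid q i)) _ _ _ _ (HI i)).
    set (G := fun v => (ee (- l) (grid q i) * (f (grid q i + (v, y))%C * ee (- l) (v, y)))%C) in J.
    replace g with (fun x => G (x + - grid q i)).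
    - apply (is_CInt_translate G (- d + grid q i) (d + grid q i) (- grid q i)).
      replace (- d + grid q i + - grid q i) with (- d) by ring.
      replace (d + grid q i + - grid q i) with d by ring. exact J.
    - apply functional_extensionality. intros x. unfold g, G. cbv beta.
      replace (x, y) with (grid q i + ((x + - grid q i)%R, y))%C by (apply C_eq; simpl; ring).
      rewrite (ee_plus_r (- l) (grid q i)). ring. }
  assert (Tot : (INR N * a l = csum (fun i => ee (- l) (grid q i) * I i) (seq 0 n))%C).
  { assert (S1 := hcoef l alpha y y0 Hl). fold g in S1.
    assert (S2 := CInt_pieces g alpha (2 * d) n ltac:(lra) Hg).
    replace (INR n * (2 * d)) with (INR N) in S2.
    2:{ unfold n. rewrite mult_INR, Ed. field. lra. }
    apply is_CInt_unique in S1. apply is_CInt_unique in S2. rewrite <- S1, S2.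
    apply csum_ext. intros i _. apply Piece. }
  rewrite Tot.
  assert (Om : is_CInt (fun v => RtoC (omega k M0 y v)) (- d) d (RtoC P)).
  { apply is_CInt_components; unfold Re, Im; simpl.
    - apply (@RInt_correct R_CompleteNormedModule). now apply ex_RInt_omega.
    - assert (Z := @is_RInt_const R_NormedModule (- d) d 0).
      unfold scal in Z; simpl in Z; unfold mult in Z; simpl in Z. rewrite Rmult_0_r in Z. exact Z. }
  assert (Dif : forall i, In i (seq 0 n) -> Cmod (I i - A i * P) <= eps * P + 2 * d * (K * minor M0 tau)).
  { intros i Hi.
    assert (J := is_CInt_minus _ _ _ _ _ _ (HI i) (is_CInt_scal (A i) _ _ _ _ Om)).
    apply is_CInt_bound with (g := fun v => eps * omega k M0 y v + K * minor M0 tau)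
      (m := eps * P + 2 * d * (K * minor M0 tau)) in J; [exact J|lra|..].
    - intros v Hv. rewrite <- El. apply (Htau1 i Hi); trivial. apply Rabs_le. fold d. lra.
    - apply (is_RInt_plus (V := R_NormedModule) (fun v => scal eps (omega k M0 y v)) (fun _ => K * minor M0 tau)
        (- d) d (scal eps P) (2 * d * (K * minor M0 tau))).
      + apply (@is_RInt_scal R_NormedModule), (@RInt_correct R_CompleteNormedModule). now apply ex_RInt_omega.
      + replace (2 * d * (K * minor M0 tau)) with (scal (d - - d) (K * minor M0 tau));
          [apply (@is_RInt_const R_NormedModule)|]. unfold scal; simpl; unfold mult; simpl; ring. }
  assert (Sd : (csum (fun i => ee (- l) (grid q i) * I i) (seq 0 n)
      - csum (fun i => ee (- l) (grid q i) * A i) (seq 0 n) * P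
      = csum (fun i => ee (- l) (grid q i) * (I i - A i * P)) (seq 0 n))%C).
  { clear. induction (seq 0 n) as [|i s IH]; [unfold csum; simpl; ring|].
    rewrite !csum_cons, <- IH. ring. }
  rewrite Sd. eapply Rle_trans; [apply csum_bound|].
  set (W := eps * P + 2 * d * (K * minor M0 tau)) in *.
  apply Rle_trans with (rsum (fun _ => W) (seq 0 n)).
  { apply rsum_le. intros i Hi. rewrite Cmod_mult, Cmod_ee_real, Rmult_1_l. apply Dif. assumption. }
  assert (Ec : forall s : list nat, rsum (fun _ => W) s = INR (length s) * W).
  { clear. induction s as [|x s IH]; [unfold rsum; simpl; ring|]. rewrite rsum_cons, IH.
    cbn [length]. rewrite S_INR. ring. }
  rewrite Ec, length_seq. unfold W, eps.
  assert (d1 : 2 * d <= 1). { rewrite Ed. rewrite <- Rinv_1. apply Rinv_le_contravar; lra. }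
  assert (KM : INR n * (K * minor M0 tau) <= eta / 2 * P).
  { apply Rle_trans with (INR n * (K * (eta / (2 * INR n * K) * P))).
    - apply Rmult_le_compat_l; [lra|]. apply Rmult_le_compat_l; lra.
    - right. field. lra. }
  assert (0 <= INR n * (K * minor M0 tau)).
  { apply Rmult_le_pos; [lra|]. apply Rmult_le_pos; [lra|]. left; apply exp_pos. }
  replace (INR n * (eta / (2 * INR n) * P + 2 * d * (K * minor M0 tau)))
    with (eta / 2 * P + 2 * d * (INR n * (K * minor M0 tau))) by (field; lra).
  nra.
Qed.

End Coefficients.

(** * Uniqueness of Fourier coefficients *)

Definition kernel (N v : R) : R := (1 + cos (2 * PI * v / N)) / 2.

Lemma kernel_ee (N v : R) : N <> 0 ->
  RtoC (kernel N v) = (/ 2 + / 4 * ee (/ N) v + / 4 * ee (- / N) v)%C.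
Proof.
  intros HN. unfold ee. rewrite !ee_arg. unfold kernel, Cexp.
  replace (2 * PI * v / N) with (2 * PI * / N * v) by (field; assumption).
  unfold Re, Im; simpl. replace (-2 * PI * / N * 0) with 0 by ring.
  replace (-2 * PI * - / N * 0) with 0 by ring.
  replace (2 * PI * - / N * v) with (- (2 * PI * / N * v)) by ring.
  rewrite exp_0, cos_neg, sin_neg. apply C_eq; simpl; field.
Qed.

Lemma kernel_bounds (N v : R) : 0 <= kernel N v <= 1.
Proof. unfold kernel. generalize (COS_bound (2 * PI * v / N)). lra. Qed.

Lemma kernel_decreasing (N v w : R) : 0 < N -> Rabs v <= w -> w <= N / 2 -> kernel N w <= kernel N v.
Proof.
  intros HN Hv Hw. unfold kernel.
  assert (P := PI_RGT_0). assert (v0 := Rabs_pos v).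
  assert (C : cos (2 * PI * v / N) = cos (2 * PI * Rabs v / N)).
  { unfold Rabs. destruct (Rcase_abs v); [|reflexivity].
    replace (2 * PI * - v / N) with (- (2 * PI * v / N)) by (field; lra). now rewrite cos_neg. }
  rewrite C. assert (iN : 0 < / N) by now apply Rinv_0_lt_compat.
  assert (M : forall s t, s <= t -> 2 * PI * s / N <= 2 * PI * t / N).
  { intros s t H. apply Rmult_le_compat_r; [lra|]. apply Rmult_le_compat_l; lra. }
  assert (H1 := M _ _ Hv). assert (H2 := M _ _ Hw). assert (H3 := M _ _ v0).
  replace (2 * PI * (N / 2) / N) with PI in H2 by (field; lra).
  replace (2 * PI * 0 / N) with 0 in H3 by (field; lra).
  assert (cos (2 * PI * w / N) <= cos (2 * PI * Rabs v / N)); [|lra].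
  apply cos_decr_1; lra.
Qed.

Lemma kernel_strict (N v w : R) : 0 < N -> 0 <= v -> v < w -> w <= N / 2 -> kernel N w < kernel N v.
Proof.
  intros HN Hv Hvw Hw. unfold kernel.
  assert (P := PI_RGT_0). assert (iN : 0 < / N) by now apply Rinv_0_lt_compat.
  assert (M : forall s t, s <= t -> 2 * PI * s / N <= 2 * PI * t / N).
  { intros s t H. apply Rmult_le_compat_r; [lra|]. apply Rmult_le_compat_l; lra. }
  assert (H1 : 2 * PI * v / N < 2 * PI * w / N).
  { apply Rmult_lt_compat_r; [lra|]. apply Rmult_lt_compat_l; lra. }
  assert (H2 := M _ _ Hw). assert (H3 := M _ _ Hv).
  replace (2 * PI * (N / 2) / N) with PI in H2 by (field; lra).
  replace (2 * PI * 0 / N) with 0 in H3 by (field; lra).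
  assert (cos (2 * PI * w / N) < cos (2 * PI * v / N)); [|lra].
  apply cos_decreasing_1; lra.
Qed.

Lemma kernel_pow_continuous (N : R) (m : nat) (v : R) : N <> 0 -> continuous (fun v => kernel N v ^ m) v.
Proof.
  intros HN. apply (@ex_derive_continuous R_AbsRing R_NormedModule).
  unfold kernel. auto_derive. trivial.
Qed.

Lemma rcont_bounded (G : R -> C) (a b : R) : a <= b -> (forall x, rcont G x) ->
  exists K, forall x, a <= x <= b -> Cmod (G x) <= K.
Proof.
  intros Hab HG.
  destruct (continuity_ab_maj (fun x => Cmod (G x)) a b Hab) as [M [HM _]].
  - intros x _ eps He. destruct (HG x eps He) as [delta [Hd H]].
    exists delta. split; [assumption|]. intros t [_ Ht]. simpl in *. unfold Rdist in *.
    specialize (H t Ht). apply Rabs_def1.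
    + eapply Rle_lt_trans; [apply Cmod_triangle_inv|assumption].
    + assert (X := Cmod_triangle_inv (G x) (G t)). rewrite Cmod_minus_sym in X. lra.
  - exists (Cmod (G M)). exact HM.
Qed.

(* The powers of the nonnegative kernel [(1 + cos (2 pi v / N)) / 2] are trigonometric polynomials
   concentrating at [v = 0]. *)
Lemma zero_of_vanishing_coefficients (N : R) (G : R -> C) : 0 < N -> (forall x, rcont G x) ->
  (forall j : Z, is_CInt (fun v => G v * ee (IZR j / N) v)%C (- (N / 2)) (N / 2) 0) -> G 0 = 0.
Proof.
  intros HN HG Hj. apply NNPP. intros b0. set (b := G 0) in *.
  assert (bp : 0 < Cmod b) by now apply Cmod_gt_0.
  (* The kernel is a combination of characters of index -1, 0 and 1, so multiplication by it only
     shifts [j]; this drives the induction on the power. *)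
  assert (K : forall m j, is_CInt (fun v => G v * RtoC (kernel N v ^ m) * ee (IZR j / N) v)%C (- (N / 2)) (N / 2) 0).
  { induction m as [|m IH]; intros j.
    - eapply is_CInt_ext; [lra| |apply (Hj j)]. intros x _. simpl. ring.
    - assert (S1 := is_CInt_scal (/ 2) _ _ _ _ (IH j)).
      assert (S2 := is_CInt_scal (/ 4) _ _ _ _ (IH (j + 1)%Z)).
      assert (S3 := is_CInt_scal (/ 4) _ _ _ _ (IH (j - 1)%Z)).
      assert (S := is_CInt_plus _ _ _ _ _ _ (is_CInt_plus _ _ _ _ _ _ S1 S2) S3).
      rewrite !Cmult_0_r, !Cplus_0_r in S.
      eapply is_CInt_ext; [lra| |exact S]. intros x _. cbv beta.
      rewrite plus_IZR, minus_IZR. simpl.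
      replace ((IZR j + 1) / N) with (IZR j / N + / N) by (field; lra).
      replace ((IZR j - 1) / N) with (IZR j / N + - / N) by (field; lra).
      rewrite !ee_plus_l, RtoC_mult, (kernel_ee N x) by lra. ring. }
  destruct (HG 0 (Cmod b / 2) ltac:(lra)) as [d0 [Pd0 Hd0]].
  set (d := Rmin (d0 / 2) (N / 2)). assert (Pd : 0 < d) by (apply Rmin_pos; lra).
  assert (dd0 : d <= d0 / 2) by apply Rmin_l. assert (dN : d <= N / 2) by apply Rmin_r.
  destruct (rcont_bounded G (- (N / 2)) (N / 2) ltac:(lra) HG) as [B HB].
  assert (B0 : 0 <= B) by (eapply Rle_trans; [apply Cmod_ge_0|apply (HB 0); lra]).
  set (k1 := kernel N d). set (k2 := kernel N (d / 2)).
  assert (k12 : k1 < k2) by (apply kernel_strict; lra).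
  assert (k10 : 0 <= k1) by apply kernel_bounds.
  (* The integral of (G - b) times the m-th power equals -b Q. Near 0 the integrand is at most |b|/2
     times that power, so half of |b| Q is bounded by the part away from 0, of order k1^m. But Q is
     at least d k2^m with k2 > k1, which fails for large [m]. *)
  assert (Main : forall m, Cmod b / 2 * (d * k2 ^ m) <= N * ((B + Cmod b) * k1 ^ m)).
  { intros m. set (Q := RInt (fun v => kernel N v ^ m) (- (N / 2)) (N / 2)).
    assert (HQ : is_RInt (fun v => kernel N v ^ m) (- (N / 2)) (N / 2) Q).
    { apply (@RInt_correct R_CompleteNormedModule), (@ex_RInt_continuous R_CompleteNormedModule).
      intros; apply kernel_pow_continuous; lra. }
    assert (CQ : is_CInt (fun v => RtoC (kernel N v ^ m)) (- (N / 2)) (N / 2) (RtoC Q)).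
    { apply is_CInt_components; unfold Re, Im; simpl; [exact HQ|].
      assert (Z := @is_RInt_const R_NormedModule (- (N / 2)) (N / 2) 0).
      unfold scal in Z; simpl in Z; unfold mult in Z; simpl in Z. rewrite Rmult_0_r in Z. exact Z. }
    assert (Z := K m 0%Z).
    assert (D := is_CInt_minus _ _ _ _ _ _ Z (is_CInt_scal b _ _ _ _ CQ)).
    apply is_CInt_bound with (g := fun v => Cmod b / 2 * kernel N v ^ m + (B + Cmod b) * k1 ^ m)
      (m := Cmod b / 2 * Q + N * ((B + Cmod b) * k1 ^ m)) in D; [|lra|..].
    - replace (0 - b * Q)%C with (- (b * Q))%C in D by ring. rewrite Cmod_opp, Cmod_mult, Cmod_R in D.
      assert (Low : 2 * (d / 2) * k2 ^ m <= Q).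
      { apply RInt_symmetric_lower.
        - intros; apply kernel_pow_continuous; lra.
        - intros; apply pow_le, kernel_bounds.
        - lra.
        - intros x Hx. apply pow_incr. split; [apply kernel_bounds|].
          apply kernel_decreasing; [assumption| |lra]. apply Rabs_le. lra. }
      assert (Q0 : 0 <= Q).
      { apply Rle_trans with (2 := Low). apply Rmult_le_pos; [lra|]. apply pow_le, kernel_bounds. }
      rewrite Rabs_right in D by lra.
      assert (Cmod b / 2 * (d * k2 ^ m) <= Cmod b / 2 * Q) by (apply Rmult_le_compat_l; lra). lra.
    - intros v Hv. cbv beta.
      replace (IZR 0 / N) with 0 by (unfold Rdiv; ring). rewrite ee_0_l.
      replace (_ - _)%C with ((G v - b) * RtoC (kernel N v ^ m))%C by ring.
      assert (kp : 0 <= kernel N v ^ m) by apply pow_le, kernel_bounds.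
      assert (kq : 0 <= k1 ^ m) by now apply pow_le.
      rewrite Cmod_mult, Cmod_R, Rabs_right by lra.
      destruct (Rle_dec (Rabs v) d) as [L|L].
      + assert (Cmod (G v - b) < Cmod b / 2) by (apply Hd0; rewrite Rminus_0_r; lra).
        assert (0 <= (B + Cmod b) * k1 ^ m) by (apply Rmult_le_pos; lra). nra.
      + assert (kernel N v ^ m <= k1 ^ m).
        { apply pow_incr. split; [apply kernel_bounds|].
          assert (KA : kernel N v = kernel N (Rabs v)).
          { unfold kernel, Rabs. destruct (Rcase_abs v); [|reflexivity].
            replace (2 * PI * - v / N) with (- (2 * PI * v / N)) by (field; lra). now rewrite cos_neg. }
          rewrite KA. apply kernel_decreasing; [assumption|rewrite Rabs_right; lra|].
          apply Rabs_le. lra. }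
        assert (X : Cmod (G v - b) <= B + Cmod b).
        { unfold Cminus. eapply Rle_trans; [apply Cmod_triangle|]. rewrite Cmod_opp.
          apply Rplus_le_compat_r, HB, Hv. }
        assert (Cmod (G v - b) * kernel N v ^ m <= (B + Cmod b) * k1 ^ m)
          by (apply Rmult_le_compat; auto using Cmod_ge_0).
        assert (0 <= Cmod b / 2 * kernel N v ^ m) by (apply Rmult_le_pos; lra). lra.
    - apply (is_RInt_plus (V := R_NormedModule) (fun v => scal (Cmod b / 2) (kernel N v ^ m))
        (fun _ => (B + Cmod b) * k1 ^ m) (- (N / 2)) (N / 2) (scal (Cmod b / 2) Q)).
      + now apply (@is_RInt_scal R_NormedModule).
      + replace (N * ((B + Cmod b) * k1 ^ m)) with (scal (N / 2 - - (N / 2)) ((B + Cmod b) * k1 ^ m));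
          [apply (@is_RInt_const R_NormedModule)|]. unfold scal; simpl; unfold mult; simpl; field. }
  assert (k2p : 0 < k2) by lra.
  set (T := N * (B + Cmod b)). assert (T0 : 0 < T) by (apply Rmult_lt_0_compat; lra).
  assert (E0 : 0 < Cmod b / 2 * d / (2 * T)).
  { apply Rdiv_lt_0_compat; [|lra]. apply Rmult_lt_0_compat; lra. }
  destruct (pow_lt_1_zero (k1 / k2)) with (y := Cmod b / 2 * d / (2 * T)) as [m0 Hm]; [|assumption|].
  { rewrite Rabs_right; [|apply Rle_ge, Rle_div_r; lra]. apply Rlt_div_l; lra. }
  specialize (Hm m0 (le_n _)). specialize (Main m0).
  assert (kk : 0 < k2 ^ m0) by now apply pow_lt.
  unfold Rdiv in Hm at 1. rewrite Rpow_mult_distr, pow_inv in Hm.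
  rewrite Rabs_right in Hm.
  2:{ apply Rle_ge, Rle_div_r; [assumption|]. rewrite Rmult_0_l. now apply pow_le. }
  apply (proj1 (Rlt_div_l _ _ _ kk)) in Hm.
  assert (X : T * k1 ^ m0 < T * (Cmod b / 2 * d / (2 * T) * k2 ^ m0)) by (apply Rmult_lt_compat_l; assumption).
  replace (T * (Cmod b / 2 * d / (2 * T) * k2 ^ m0)) with (Cmod b / 2 * (d * k2 ^ m0) / 2) in X by (field; lra).
  assert (0 < Cmod b / 2 * (d * k2 ^ m0)) by (repeat apply Rmult_lt_0_compat; lra).
  unfold T in X. lra.
Qed.

(** * Holomorphic functions of constant modulus *)

(** A nonzero derivative would allow a step that increases the modulus to first order, so the
    derivative vanishes everywhere; bisection then integrates this to constancy. *)
Lemma constant_of_constant_modulus (j : C -> C) :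
  (forall z, half_plane 0 z -> cdiff j z) -> (forall z, half_plane 0 z -> Cmod (j z) = 1) ->
  forall z, half_plane 0 z -> j z = j (0, 1).
Proof.
  intros Hd Hm.
  assert (D0 : forall z, half_plane 0 z -> forall eps, 0 < eps -> exists delta, 0 < delta /\
    forall w, Cmod (w - z) < delta -> Cmod (j w - j z) <= eps * Cmod (w - z)).
  { intros z Hz. destruct (Hd z Hz) as [d H].
    assert (d0 : d = 0).
    { apply NNPP. intros dn. assert (dp : 0 < Cmod d) by now apply Cmod_gt_0.
      destruct (H (Cmod d / 2) ltac:(lra)) as [delta [Pd H1]].
      (* Moving in the direction [j z * conj d] increases the modulus of [j]. *)
      set (s := Rmin (delta / 2) (Im z / 2) / Cmod d).
      assert (zp : 0 < Im z) by exact Hz.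
      assert (Pm : 0 < Rmin (delta / 2) (Im z / 2)) by (apply Rmin_pos; lra).
      assert (s0 : 0 < s) by (apply Rdiv_lt_0_compat; assumption).
      set (v := (RtoC s * (j z * Cconj d))%C).
      assert (Ev : Cmod v = s * Cmod d).
      { unfold v. rewrite !Cmod_mult, Cmod_R, Cmod_conj, Hm, Rabs_right by (trivial; lra). ring. }
      assert (sd : s * Cmod d = Rmin (delta / 2) (Im z / 2)) by (unfold s; field; lra).
      assert (m1 := Rmin_l (delta / 2) (Im z / 2)). assert (m2 := Rmin_r (delta / 2) (Im z / 2)).
      specialize (H1 (z + v)%C). replace (z + v - z)%C with v in H1 by ring.
      specialize (H1 ltac:(lra)).
      assert (Hw : half_plane 0 (z + v)%C).
      { unfold half_plane. assert (I := im_le_Cmod v). apply Rabs_le_between in I.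
        change (0 < Im z + Im v). lra. }
      assert (E : (j z + d * v = j z * (1 + s * (Cmod d * Cmod d)))%C).
      { unfold v. assert (X := Cmod2_conj d). rewrite <- RtoC_mult.
        replace (Cmod d * Cmod d) with (Cmod d ^ 2) by ring. rewrite X. ring. }
      assert (Q : Cmod (j z + d * v) = 1 + s * (Cmod d * Cmod d)).
      { rewrite E, Cmod_mult, Hm, <- !RtoC_mult, <- RtoC_plus, Cmod_R, Rabs_right by (trivial; nra). ring. }
      assert (R := Cmod_triangle_inv (j z + d * v) (j (z + v)%C)).
      replace (j z + d * v - j (z + v))%C with (- (j (z + v) - j z - d * v))%C in R by ring.
      rewrite Cmod_opp, Q, (Hm _ Hw) in R. rewrite Ev in H1.
      assert (0 < s * (Cmod d * Cmod d)) by (apply Rmult_lt_0_compat; nra). nra. }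
    subst d. intros eps He. destruct (H eps He) as [delta [Pd H1]]. exists delta. split; [assumption|].
    intros w Hw. specialize (H1 w Hw). replace (j w - j z - 0 * (w - z))%C with (j w - j z)%C in H1 by ring.
    exact H1. }
  (* Opposite corners are compared because their difference is additive along the diagonal: of the
     four quarters only the lower left and the upper right are used. *)
  assert (Diag : forall a b c d, a <= b -> 0 < c -> c <= d -> j (b, d) = j (a, c)).
  { intros a b c d Hab Hc Hcd.
    assert (Small : forall eps, 0 < eps -> Cmod (j (b, d) - j (a, c))%C <= eps * ((b - a) + (d - c))).
    { intros eps He.
      apply (rect_bisection (fun a b c d => Cmod (j (b, d) - j (a, c))%C <= eps * ((b - a) + (d - c)))); trivial.
      - intros a' b' c' d' _ _ _ _ _ _ H1 _ _ H4.
        eapply Rle_trans; [apply Cmod_triangle_minus with (y := j ((a' + b') / 2, (c' + d') / 2))|]. lra.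
      - intros x y Hx Hy. destruct (D0 (x, y)) with (eps := eps) as [delta [Pd H]];
          [unfold half_plane; simpl; lra|assumption|].
        exists (delta / 2). split; [lra|]. intros a' b' c' d' A1 A2 A3 A4 A5 A6.
        eapply Rle_trans; [apply Cmod_triangle_minus with (y := j (x, y))|].
        assert (B1 : Cmod ((b', d') - (x, y))%C <= (b' - x) + (d' - y)).
        { eapply Rle_trans; [apply Cmod_le_sum|]. simpl. apply Rplus_le_compat; apply Rabs_le; lra. }
        assert (B2 : Cmod ((a', c') - (x, y))%C <= (x - a') + (y - c')).
        { eapply Rle_trans; [apply Cmod_le_sum|]. simpl. apply Rplus_le_compat; apply Rabs_le; lra. }
        assert (C1 := H (b', d') ltac:(lra)). assert (C2 := H (a', c') ltac:(lra)).
        rewrite (Cmod_minus_sym (j (x, y))).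
        assert (eps * Cmod ((b', d') - (x, y))%C <= eps * ((b' - x) + (d' - y))) by (apply Rmult_le_compat_l; lra).
        assert (eps * Cmod ((a', c') - (x, y))%C <= eps * ((x - a') + (y - c'))) by (apply Rmult_le_compat_l; lra).
        lra. }
    assert (Z : Cmod (j (b, d) - j (a, c))%C = 0).
    { apply Rle_antisym; [|apply Cmod_ge_0]. apply Rnot_lt_le. intros P.
      set (S := (b - a) + (d - c)) in *. assert (S0 : 0 <= S) by (unfold S; lra).
      specialize (Small (Cmod (j (b, d) - j (a, c))%C / (2 * (S + 1)))).
      assert (P' : 0 < Cmod (j (b, d) - j (a, c))%C / (2 * (S + 1))) by (apply Rdiv_lt_0_compat; lra).
      specialize (Small P').
      replace (_ / _ * S) with (Cmod (j (b, d) - j (a, c))%C * (S / (2 * (S + 1)))) in Small by (field; lra).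
      assert (S / (2 * (S + 1)) < 1) by (apply Rlt_div_l; lra). nra. }
    apply Cmod_eq_0 in Z. replace (j (b, d)) with (j (b, d) - j (a, c) + j (a, c))%C by ring. rewrite Z. ring. }
  intros [x y] Hz. unfold half_plane, Im in Hz; simpl in Hz.
  (* The given point and (0, 1) are both lower left corners of rectangles with the same upper right
     corner. *)
  rewrite <- (Diag x (Rmax x 0) y (Rmax y 1)) by (trivial; apply Rmax_l).
  apply Diag; [apply Rmax_r|lra|apply Rmax_r].
Qed.

(** * A nonvanishing character sum *)

Lemma csum_exchange {S T : Type} (F : S -> T -> C) (l : list S) (m : list T) :
  csum (fun s => csum (F s) m) l = csum (fun t => csum (fun s => F s t) l) m.
Proof.
  induction l as [|s l IH].
  - unfold csum at 1; simpl. induction m as [|t m IHm]; [reflexivity|].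
    rewrite csum_cons, <- IHm. unfold csum; simpl. ring.
  - rewrite csum_cons, IH. clear. induction m as [|t m IH]; [unfold csum; simpl; ring|].
    rewrite !csum_cons, <- IH. ring.
Qed.

Lemma geometric_sum (z : C) (n : nat) : (csum (fun j => z ^ j) (seq 0 n) * (z - 1) = z ^ n - 1)%C.
Proof.
  induction n as [|n IH]; [unfold csum; simpl; ring|].
  rewrite seq_S, csum_app, Cmult_plus_distr_r, IH. unfold csum; simpl. ring.
Qed.

Lemma ee_INR (n : nat) (l : R) (z : C) : ee (INR n * l) z = (ee l z ^ n)%C.
Proof.
  induction n as [|n IH].
  - simpl. rewrite Rmult_0_l. apply ee_0_l.
  - rewrite S_INR, Rmult_plus_distr_r, Rmult_1_l, ee_plus_l, IH, Cpow_S. ring.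
Qed.

Lemma ee_integer (l x : R) (q : Z) : l * x = IZR q -> ee l x = 1.
Proof.
  intros H. unfold ee. rewrite ee_arg. unfold Cexp, Re, Im; simpl.
  replace (-2 * PI * l * 0) with 0 by ring. replace (2 * PI * l * x) with (2 * IZR q * PI) by (rewrite <- H; ring).
  rewrite exp_0.
  assert (C : cos (2 * IZR q * PI) = 1 /\ sin (2 * IZR q * PI) = 0).
  { assert (K : forall n, cos (2 * INR n * PI) = 1 /\ sin (2 * INR n * PI) = 0).
    { intros n. assert (A := cos_period 0 n). assert (B := sin_period 0 n).
      rewrite Rplus_0_l in A, B. rewrite cos_0 in A. rewrite sin_0 in B. tauto. }
    destruct (Z_le_gt_dec 0 q) as [L|L].
    - specialize (K (Z.to_nat q)). rewrite INR_IZR_INZ, Z2Nat.id in K by assumption. exact K.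
    - specialize (K (Z.to_nat (- q))). rewrite INR_IZR_INZ, Z2Nat.id, opp_IZR in K by lia.
      replace (2 * - IZR q * PI) with (- (2 * IZR q * PI)) in K by ring.
      rewrite cos_neg, sin_neg in K. lra. }
  destruct C as [-> ->]. apply C_eq; simpl; ring.
Qed.

Lemma ee_not_1 (l x : R) : - 1 < l * x < 0 -> ee l x <> 1.
Proof.
  intros H E. unfold ee in E. rewrite ee_arg in E.
  assert (Er := f_equal Re E). unfold Cexp, Re, Im in Er; simpl in Er.
  replace (-2 * PI * l * 0) with 0 in Er by ring. rewrite exp_0, Rmult_1_l in Er.
  replace (2 * PI * l * x) with (2 * (PI * (l * x))) in Er by ring. rewrite cos_2a_sin in Er.
  assert (P := PI_RGT_0).
  assert (S : 0 < sin (- (PI * (l * x)))) by (apply sin_gt_0; nra).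
  rewrite sin_neg in S. nra.
Qed.

(** Discrete Fourier inversion: multiplying the sums by the inverse characters at the grid point 0
    and adding over N L values of [j] cancels all terms with i > 0 and leaves N L times a unit times
    A 0. *)
Lemma character_sum_nonzero (N L : nat) (q : Z) (A : nat -> C) (l0 : R) :
  (1 <= N)%nat -> (1 <= L)%nat -> A 0%nat <> 0 ->
  exists j : nat, csum (fun i => ee (- (l0 + INR j / INR N)) (grid L q i) * A i)%C (seq 0 (N * L)) <> 0.
Proof.
  intros HN HL HA. apply NNPP. intros Hno.
  assert (N1 : 1 <= INR N) by (apply (le_INR 1); assumption).
  assert (L1 : 1 <= INR L) by (apply (le_INR 1); assumption).
  set (n := (N * L)%nat) in *. assert (n1 : (1 <= n)%nat) by (unfold n; nia).
  set (S := fun j => csum (fun i => ee (- (l0 + INR j / INR N)) (grid L q i) * A i)%C (seq 0 n)) in *.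
  assert (Z : csum (fun j => ee (INR j / INR N) (grid L q 0) * S j)%C (seq 0 n) = 0).
  { rewrite (csum_ext _ (fun _ => 0 * 0)%C).
    - rewrite csum_scal. ring.
    - intros j _. replace (S j) with (RtoC 0); [ring|]. symmetry. apply NNPP. intros K. apply Hno. now exists j. }
  (* [zeta i] is exp(-2 pi i/(N L)) raised to the index: a root of unity of order dividing N L,
     different from 1 for 0 < i < N L, so its powers sum to 0. *)
  set (zeta := fun i : nat => ee (/ INR N) (RtoC (- (INR i / INR L)))).
  assert (E : csum (fun j => ee (INR j / INR N) (grid L q 0) * S j)%C (seq 0 n)
    = csum (fun i => ee (- l0) (grid L q i) * A i * csum (fun j => zeta i ^ j) (seq 0 n))%C (seq 0 n)).
  { unfold S.
    rewrite (csum_ext _ (fun j => csum (fun i => ee (- l0) (grid L q i) * A i * zeta i ^ j)%C (seq 0 n))).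
    - rewrite csum_exchange. apply csum_ext. intros i _. rewrite csum_scal. reflexivity.
    - intros j _. rewrite <- csum_scal. apply csum_ext. intros i _.
      unfold zeta. rewrite <- ee_INR.
      replace (- (l0 + INR j / INR N)) with (- l0 + - (INR j / INR N)) by ring.
      rewrite ee_plus_l.
      assert (G : RtoC (grid L q 0) = (grid L q i + RtoC (- (INR i / INR L)))%C).
      { rewrite <- RtoC_plus. f_equal. unfold grid. rewrite !plus_IZR, <- !INR_IZR_INZ. simpl. field. lra. }
      rewrite G, ee_plus_r. change (INR j * / INR N) with (INR j / INR N).
      transitivity (ee (- l0) (grid L q i) * A i * ee (INR j / INR N) (RtoC (- (INR i / INR L)))
        * (ee (- (INR j / INR N)) (grid L q i) * ee (INR j / INR N) (grid L q i)))%C; [ring|].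
      rewrite ee_opp_l. ring. }
  rewrite E in Z. assert (nR : INR n = INR N * INR L) by apply mult_INR.
  destruct n as [|n']; [lia|]. cbn [seq] in Z. rewrite csum_cons in Z.
  rewrite (csum_ext _ (fun _ => 0 * 0)%C (seq 1 n')) in Z.
  - rewrite csum_scal, Cmult_0_l, Cplus_0_r in Z.
    assert (z0 : zeta 0%nat = 1).
    { unfold zeta. replace (- (INR 0 / INR L)) with 0 by (simpl; unfold Rdiv; ring). apply ee_0_r. }
    assert (c1 : forall s : list nat, csum (fun j => zeta 0%nat ^ j)%C s = RtoC (INR (length s))).
    { induction s as [|x s IH]; [reflexivity|]. rewrite csum_cons, IH, z0, Cpow_1_l.
      cbn [length]. rewrite S_INR, RtoC_plus. ring. }
    rewrite c1 in Z. revert Z.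
    apply Cmult_neq_0; [apply Cmult_neq_0; [apply ee_neq_0|exact HA]|].
    intros K. apply RtoC_inj in K. cbn [length] in K. rewrite S_INR in K.
    generalize (pos_INR (length (seq 1 n'))). lra.
  - intros i Hi. apply in_seq in Hi.
    assert (iR : 0 < INR i < INR N * INR L).
    { rewrite <- nR. split; [apply lt_0_INR; lia|apply lt_INR; lia]. }
    assert (P2 : 0 < INR N * INR L) by lra.
    assert (Ex : / INR N * - (INR i / INR L) = - (INR i / (INR N * INR L))) by (field; lra).
    assert (z1 : zeta i <> 1).
    { apply ee_not_1. rewrite Ex.
      assert (0 < INR i / (INR N * INR L)) by (apply Rdiv_lt_0_compat; lra).
      assert (INR i / (INR N * INR L) < 1) by (apply Rlt_div_l; lra). lra. }
    assert (zn : (zeta i ^ Datatypes.S n' = 1)%C).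
    { unfold zeta. rewrite <- ee_INR. apply ee_integer with (- Z.of_nat i)%Z.
      rewrite Rmult_assoc, Ex, nR, opp_IZR, <- INR_IZR_INZ. field. lra. }
    assert (GS := geometric_sum (zeta i) (Datatypes.S n')). rewrite zn in GS.
    assert (W : csum (fun j => zeta i ^ j)%C (seq 0 (Datatypes.S n')) = 0).
    { apply NNPP. intros K. assert (z2 : (zeta i - 1)%C <> 0).
      { intros K2. apply z1. replace (zeta i) with (zeta i - 1 + 1)%C by ring. rewrite K2. ring. }
      apply (Cmult_neq_0 _ _ K z2). rewrite GS. ring. }
    cbn [seq] in W. rewrite W. ring.
Qed.

(** * Change of period *)

Lemma csum_zero (F : R -> C) (l : list R) : (forall x, In x l -> F x = 0) -> csum F l = 0.
Proof.
  induction l as [|x l IH]; intros H; [reflexivity|].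
  rewrite csum_cons, (H x) by now left. rewrite IH by (intros; apply H; now right). ring.
Qed.

(** Finite sets for [P] and for [P'] are matched by deleting and adding elements at which [F]
    vanishes. *)
Lemma is_sum_over_support (P P' : R -> Prop) (F : R -> C) (s : C) :
  (forall x, ~ P x -> F x = 0) -> (forall x, ~ P' x -> F x = 0) ->
  is_sum_over P F s -> is_sum_over P' F s.
Proof.
  intros HP HP' H eps. destruct (H eps) as [l0 [P0 H0]].
  exists (sel P' l0). split; [intros x Hx; now apply sel_In in Hx|].
  intros l N Pl Il.
  set (l2 := nodup Req_EM_T (sel (fun x => ~ P' x) l0)).
  assert (I2 : forall x, In x l2 -> In x l0 /\ ~ P' x).
  { intros x Hx. apply nodup_In in Hx. now apply sel_In in Hx. }
  specialize (H0 (sel P l ++ l2)).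
  change (Cmod (csum F l - s) < eps).
  replace (csum F l) with (csum F (sel P l ++ l2)).
  - apply H0.
    + apply NoDup_app; [now apply sel_NoDup|apply NoDup_nodup|].
      intros x Hx Hx'. apply sel_In in Hx as [Hx _]. apply I2 in Hx' as [_ Hx']. auto.
    + intros x Hx. apply in_app_iff in Hx as [Hx|Hx]; [now apply sel_In in Hx|]. apply I2 in Hx. apply P0, Hx.
    + intros x Hx. apply in_app_iff. destruct (classic (P' x)) as [K|K].
      * left. apply sel_In. split; [|auto]. apply Il, sel_In. now split.
      * right. apply nodup_In, sel_In. now split.
  - rewrite csum_app, (csum_zero F l2), (csum_sel F P l), (csum_zero F (sel (fun x => ~ P x) l)); trivial.
    + intros x Hx. apply sel_In in Hx. now apply HP.
    + intros x Hx. apply I2 in Hx. now apply HP'.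
Qed.

(** The period [h] hidden in the finite order condition has no given relation to [N]. Shifting the
    coefficient integral over a length [h] by [N] multiplies it by u ee(- l)(N) but leaves its value
    h a(l) unchanged, so a(l) <> 0 makes l an exponent for [N] and [u]. *)
Lemma expansion_change_period (f : C -> C) (h N : R) (u' u : C) (a : R -> C) :
  is_expansion f h u' a -> holomorphic_on (half_plane 0) f -> 0 < N -> Cmod u = 1 ->
  (forall z, half_plane 0 z -> f (z + N)%C = (u * f z)%C) -> is_expansion f N u a.
Proof.
  intros [r [Hq [H0 HS]]] Hf HN Hu Hp.
  assert (Supp : forall l, ~ exponents N u l -> a l = 0).
  { intros l Hl. apply NNPP. intros al. apply Hl.
    assert (El : exponents h u' l) by (apply NNPP; intros K; apply al, H0, K).
    assert (Hh : 0 < h) by apply Hq.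
    set (y := Rmax r 0 + 1).
    assert (yr : r < y /\ 0 < y) by (unfold y; generalize (Rmax_l r 0) (Rmax_r r 0); lra).
    assert (I0 := expansion_coefficient f h u' a r 0 y l Hq HS (proj1 yr) El).
    assert (I1 := expansion_coefficient f h u' a r N y l Hq HS (proj1 yr) El).
    assert (I2 := is_CInt_scal (u * ee (- l) N)%C _ _ _ _ I0).
    assert (I3 : is_CInt (fun x => u * ee (- l) N * (f (x, y) * ee (- l) (x, y)))%C 0 (0 + h) (h * a l)%C).
    { replace (fun x => u * ee (- l) N * (f (x, y) * ee (- l) (x, y)))%C
        with (fun x => (fun x => f (x, y) * ee (- l) (x, y))%C (x + N)).
      - apply (is_CInt_translate (fun x => f (x, y) * ee (- l) (x, y))%C).
        rewrite Rplus_0_l. replace (0 + h + N) with (N + h) by ring. exact I1.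
      - apply functional_extensionality. intros x. cbv beta.
        replace ((x + N)%R, y) with ((x, y) + N)%C by (apply C_eq; simpl; ring).
        rewrite Hp, ee_plus_r by (unfold half_plane; simpl; lra). ring. }
    apply is_CInt_unique in I2. apply is_CInt_unique in I3. rewrite I2 in I3.
    assert (hal : (h * a l)%C <> 0).
    { apply Cmult_neq_0; [intros K; apply RtoC_inj in K; lra|assumption]. }
    assert (K : (u * ee (- l) N = 1)%C).
    { transitivity (u * ee (- l) N * (h * a l) * / (h * a l))%C; [field; split; [assumption|intros K; apply RtoC_inj in K; lra]|].
      rewrite I3. field. split; [assumption|intros K; apply RtoC_inj in K; lra]. }
    change (ee l N = u).
    transitivity (u * ee (- l) N * ee l N)%C; [rewrite K; ring|].
    rewrite <- Cmult_assoc, ee_opp_l. ring. }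
  exists (Rmax r 0). split; [|split; [exact Supp|]].
  - split; [assumption|]. split; [assumption|]. split.
    + intros z Hz. apply Hf. unfold half_plane in *. generalize (Rmax_r r 0). lra.
    + intros z Hz. apply Hp. unfold half_plane in *. generalize (Rmax_r r 0). lra.
  - intros z Hz. apply is_sum_over_support with (exponents h u').
    + intros x Hx. rewrite H0 by assumption. ring.
    + intros x Hx. rewrite Supp by assumption. ring.
    + apply HS. unfold half_plane in *. generalize (Rmax_l r 0). lra.
Qed.

(** The formula is known above some height [r]. Multiplied by the character, f becomes periodic, and
    [CInt_period_shift] extends the formula to every positive height, as the saddle heights
    require. *)
Lemma coefficient_integral (f : C -> C) (N : R) (u : C) (a : R -> C) :
  is_expansion f N u a -> holomorphic_on (half_plane 0) f ->
  (forall z, half_plane 0 z -> f (z + N)%C = (u * f z)%C) ->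
  forall l x y, 0 < y -> exponents N u l ->
    is_CInt (fun x => f (x, y) * ee (- l) (x, y))%C x (x + N) (N * a l)%C.
Proof.
  intros [r [Hq [H0 HS]]] Hf Hp l x y Hy Hl.
  assert (HN : 0 < N) by apply Hq.
  set (F := fun z => (f z * ee (- l) z)%C).
  assert (HF : forall z, half_plane 0 z -> cdiff F z).
  { intros z Hz. apply cdiff_mult; [now apply ex_derive_cdiff, Hf|apply cdiff_ee]. }
  assert (FN : forall z, half_plane 0 z -> F (z + N)%C = F z).
  { intros z Hz. unfold F. rewrite Hp, ee_plus_r by assumption. change (ee l N = u) in Hl. rewrite <- Hl.
    transitivity (f z * ee (- l) z * (ee (- l) N * ee l N))%C; [ring|]. rewrite ee_opp_l. ring. }
  set (y1 := Rmax r 0 + 1).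
  assert (yr : r < y1 /\ 0 < y1) by (unfold y1; generalize (Rmax_l r 0) (Rmax_r r 0); lra).
  assert (I1 := expansion_coefficient f N u a r x y1 l Hq HS (proj1 yr) Hl).
  apply is_CInt_unique in I1. rewrite <- I1.
  change (CInt (fun x => f (x, y1) * ee (- l) (x, y1))%C x (x + N)) with (CInt (fun x => F (x, y1)) x (x + N)).
  rewrite <- (CInt_period_shift F N HF HN FN x y y1 Hy (proj2 yr)).
  apply CInt_correct, CInt_period_horizontal; assumption.
Qed.

Lemma exists_exponent (N : R) (u : C) : 0 < N -> Cmod u = 1 -> exists l, exponents N u l.
Proof.
  intros HN Hu. destruct u as [c s].
  assert (Q := Cmod_sqr (c, s)). rewrite Hu in Q. unfold Re, Im in Q; simpl in Q.
  assert (Hc : -1 <= c <= 1) by (split; nra).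
  set (theta := if Rle_dec 0 s then acos c else - acos c).
  assert (T : cos theta = c /\ sin theta = s).
  { unfold theta. assert (S : sin (acos c) = Rabs s).
    { rewrite sin_acos by assumption. rewrite <- sqrt_Rsqr_abs. f_equal. unfold Rsqr. lra. }
    destruct (Rle_dec 0 s).
    - rewrite cos_acos, S, Rabs_right by (trivial; lra). tauto.
    - rewrite cos_neg, sin_neg, cos_acos, S, Rabs_left by (trivial; lra). split; [reflexivity|ring]. }
  exists (theta / (2 * PI * N)). unfold exponents.
  rewrite (ee_arg (theta / (2 * PI * N)) N). unfold Cexp, Re, Im; simpl.
  assert (P := PI_RGT_0).
  replace (2 * PI * (theta / (2 * PI * N)) * N) with theta by (field; lra).
  rewrite Rmult_0_r, exp_0. destruct T as [-> ->]. apply C_eq; simpl; ring.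
Qed.

Lemma exponents_shift (N : R) (u : C) (l : R) (q : Z) : 0 < N ->
  exponents N u l -> exponents N u (l + IZR q / N).
Proof.
  intros HN H. change (ee (l + IZR q / N) N = u). rewrite ee_plus_l, (ee_integer (IZR q / N) N q).
  - change (ee l N = u) in H. rewrite H. ring.
  - field. lra.
Qed.

Lemma zero_of_zero_expansion (f : C -> C) (N : R) (u : C) (a : R -> C) :
  is_expansion f N u a -> holomorphic_on (half_plane 0) f ->
  (forall z, half_plane 0 z -> f (z + N)%C = (u * f z)%C) ->
  (forall l, exponents N u l -> a l = 0) -> forall z, half_plane 0 z -> f z = 0.
Proof.
  intros He Hf Hp Ha [x1 y1] Hz. unfold half_plane, Im in Hz; simpl in Hz.
  assert (HN : 0 < N) by (destruct He as [r [[H _] _]]; exact H).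
  assert (Hu : Cmod u = 1) by (destruct He as [r [[_ [H _]] _]]; exact H).
  destruct (exists_exponent N u HN Hu) as [l0 Hl0].
  (* The factor with exponent [l0] makes f periodic, and centring at [x1] turns the point under
     study into 0. *)
  set (G := fun v => (f ((v + x1)%R, y1) * ee (- l0) ((v + x1)%R, y1))%C).
  assert (G0 : G 0 = 0).
  { apply (zero_of_vanishing_coefficients N G HN).
    - intros v. apply (rcont_comp (fun z => f z * ee (- l0) z)%C (fun v => ((v + x1)%R, y1))).
      + apply cdiff_ccont, cdiff_mult; [|apply cdiff_ee].
        apply ex_derive_cdiff, Hf. unfold half_plane; simpl; assumption.
      + intros t. replace (_ - _)%C with (RtoC (t - v)) by (apply C_eq; simpl; ring).
        rewrite Cmod_R. lra.
    - intros j. set (l := l0 + IZR (- j) / N).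
      assert (I1 := coefficient_integral f N u a He Hf Hp l (- (N / 2) + x1) y1 Hz (exponents_shift N u l0 (- j) HN Hl0)).
      rewrite (Ha l) in I1 by now apply exponents_shift. rewrite Cmult_0_r in I1.
      replace (- (N / 2) + x1 + N) with (N / 2 + x1) in I1 by field.
      apply is_CInt_translate in I1.
      assert (I2 := is_CInt_scal (ee (- (IZR j / N)) (x1, y1)) _ _ _ _ I1). rewrite Cmult_0_r in I2.
      eapply is_CInt_ext; [lra| |exact I2]. intros v _. cbv beta. unfold G, l. rewrite opp_IZR.
      replace (- (l0 + - IZR j / N)) with (- l0 + IZR j / N) by (field; lra).
      rewrite ee_plus_l.
      assert (E : ee (IZR j / N) ((v + x1)%R, y1) = (ee (IZR j / N) v * ee (IZR j / N) (x1, y1))%C).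
      { rewrite <- ee_plus_r. f_equal. apply C_eq; simpl; ring. }
      rewrite E. set (F := f _).
      transitivity (F * ee (- l0) ((v + x1)%R, y1) * ee (IZR j / N) v
        * (ee (- (IZR j / N)) (x1, y1) * ee (IZR j / N) (x1, y1)))%C; [ring|].
      rewrite ee_opp_l. ring. }
  unfold G in G0. rewrite Rplus_0_l in G0.
  apply NNPP. intros K. revert G0. apply Cmult_neq_0; [assumption|apply ee_neq_0].
Qed.

(** * Existence of a pole and the nonvanishing progression *)

Lemma slash_one (k : R) (f : C -> C) : slash k f SL2Z_one = f.
Proof.
  apply functional_extensionality. intros z. unfold slash. rewrite moebius_one.
  replace (denom SL2Z_one z) with (RtoC 1) by (unfold denom; simpl; ring).
  rewrite Cpower_polar, Cmod_1. unfold Carg.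
  destruct (Rle_dec 0 (Im 1)) as [L|L]; [|exfalso; apply L; unfold Im; simpl; lra].
  rewrite Cmod_1. replace (Re 1 / 1) with 1 by (unfold Re; simpl; field).
  rewrite acos_1, Rmult_0_r. unfold Rpower. rewrite ln_1, Rmult_0_r, exp_0.
  replace (cis 0) with (RtoC 1) by (symmetry; apply Cexp_0). ring.
Qed.

Section Assembly.

Variables (k : R) (G : SL2Z -> Prop) (f : C -> C).
Hypothesis hk : k < 0.
Hypothesis hsub : is_subgroup G.
Hypothesis hfin : finite_index G.
Hypothesis hhol : holomorphic_on (half_plane 0) f.
Hypothesis habs : forall g z, G g -> 0 < Im z ->
  Cmod (f (moebius g z)) = Rpower (Cmod (denom g z)) k * Cmod (f z).
Hypothesis hord : forall g, finite_order (slash k f g).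

Lemma has_pole_unique (g : SL2Z) (mu mu' : R) : has_pole k f g mu -> has_pole k f g mu' -> mu = mu'.
Proof.
  intros [b H] [b' H'].
  destruct (pole_upper_bound _ _ _ H) as [K [Y B]]. destruct (pole_upper_bound _ _ _ H') as [K' [Y' B']].
  apply Rle_antisym; eapply pole_lower_bound; eassumption.
Qed.

(** If c = 0 then a is nonzero, and a lower unipotent element of the group with entry n >= 1 changes
    c into n a without changing the order. *)
Lemma pole_off_infinity : (exists g mu, has_pole k f g mu) ->
  exists g mu, mc g <> 0%Z /\ has_pole k f g mu.
Proof.
  intros [g [mu H]]. destruct (Z.eq_dec (mc g) 0) as [E|E]; [|now exists g, mu].
  destruct (finite_index_lower G hsub hfin) as [n [Hn Gn]].
  exists (SL2Z_mul (lower_unipotent (Z.of_nat n)) g), mu. split.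
  - cbn [mc SL2Z_mul lower_unipotent]. rewrite E. assert (D := SL2Z_det g). rewrite E in D.
    intros Z. assert (ma g <> 0%Z) by (intros Z'; rewrite Z' in D; lia). nia.
  - now apply has_pole_coset with G.
Qed.

Lemma dominant_orders : (exists g mu, has_pole k f g mu) ->
  exists (M0 M1 : R) (L : nat), 0 < M1 < M0 /\ (1 <= L)%nat /\
    (exists g, dominant k f M0 g) /\
    (forall g mu, mc g <> 0%Z -> has_pole k f g mu ->
      mu = M0 * (IZR (mc g) * IZR (mc g)) \/ mu <= M1 * (IZR (mc g) * IZR (mc g))) /\
    (forall g, dominant k f M0 g -> exists q : Z, cusp g = IZR q / INR L).
Proof.
  intros Hex. destruct (pole_off_infinity Hex) as [g0 [mu0 [Hg0 Hp0]]].
  destruct (slash_uniform_growth k G f hsub hfin hhol habs hord) as [D [B HB]].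
  set (Q := fun mu c => exists g, mc g = c /\ c <> 0%Z /\ has_pole k f g mu).
  destruct (extremal_orders D Q) as [M0 [M1 [L [HM [HL [[mu [c [[g [Ec [Hc Hp]]] Em]]] HQ]]]]]].
  - intros mu c [g [Ec [Hc Hp]]].
    destruct (HB g) as [H|[mu' [I' [P' [Hp' _]]]]].
    + exfalso. destruct Hp as [b Hb]. assert (mu <= 0); [|destruct Hb; lra].
      apply pole_lower_bound with (slash k f g) b B (1 / 2); trivial. intros z Hz.
      rewrite Rmult_0_r, Rmult_0_l, exp_0, Rmult_1_r. apply H. lra.
    + rewrite (has_pole_unique g mu mu' Hp Hp'). tauto.
  - exists mu0, (mc g0), g0. tauto.
  - exists M0, M1, L. split; [assumption|]. split; [assumption|]. split; [|split].
    + exists g. split; rewrite Ec; [assumption|]. rewrite <- Em. assumption.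
    + intros g1 mu1 Hc1 Hp1. destruct (HQ mu1 (mc g1)) as [[E _]|E]; [now exists g1|now left|now right].
    (* From L = q c one gets a/c = q a/L. The other alternative would give M0 <= M1. *)
    + intros g1 [Hc1 Hp1]. destruct (HQ _ (mc g1) (ex_intro _ g1 (conj eq_refl (conj Hc1 Hp1)))) as [[_ [q Eq]]|E].
      * exists (q * ma g1)%Z. unfold cusp. rewrite INR_IZR_INZ, Eq, !mult_IZR.
        assert (q <> 0%Z) by (intros Z; rewrite Z in Eq; lia).
        field. split; now apply not_0_IZR.
      * exfalso. apply not_0_IZR in Hc1. assert (0 < IZR (mc g1) * IZR (mc g1)) by nra. nra.
Qed.

Lemma exists_pole (N : R) (u : C) (a : R -> C) : is_expansion f N u a ->
  (forall z, half_plane 0 z -> f (z + N)%C = (u * f z)%C) ->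
  (exists z, half_plane 0 z /\ f z <> 0) -> exists g mu, has_pole k f g mu.
Proof.
  intros He Hp [z0 [Hz0 Hnz]]. apply NNPP. intros Hno. apply Hnz.
  apply (zero_of_zero_expansion f N u a); trivial.
  assert (HN : 0 < N) by (destruct He as [r [[H _] _]]; exact H).
  assert (Small := small_near_real_axis_of_no_pole k G f hk hsub hfin hhol habs hord
    (fun g mu H => Hno (ex_intro _ g (ex_intro _ mu H)))).
  intros l Hl. apply NNPP. intros al. assert (alp : 0 < Cmod (a l)) by now apply Cmod_gt_0.
  (* [W] bounds the character [ee (- l)] at heights up to 1, so the integrand is at most |a l|/2,
     while the mean over the period is a l. *)
  set (W := exp (2 * PI * Rabs l)). assert (W0 : 0 < W) by apply exp_pos.
  destruct (Small (Cmod (a l) / (2 * W))) as [delta [Pd Hd]]; [apply Rdiv_lt_0_compat; lra|].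
  set (y := Rmin (delta / 2) 1). assert (y0 : 0 < y) by (apply Rmin_pos; lra).
  assert (y1 : y <= delta / 2) by apply Rmin_l. assert (y2 : y <= 1) by apply Rmin_r.
  assert (I1 := coefficient_integral f N u a He hhol Hp l 0 y y0 Hl).
  apply is_CInt_bound_const with (M := Cmod (a l) / (2 * W) * W) in I1; [|lra|].
  - rewrite Cmod_mult, Cmod_R, Rabs_right in I1 by lra.
    replace ((0 + N - 0) * (Cmod (a l) / (2 * W) * W)) with (N * (Cmod (a l) / 2)) in I1 by (field; lra).
    apply Rmult_le_reg_l in I1; lra.
  - intros x _. rewrite Cmod_mult. apply Rmult_le_compat; auto using Cmod_ge_0.
    + apply Hd. simpl. lra.
    + rewrite Cmod_ee. simpl. apply exp_monotone.
      replace (-2 * PI * - l * y) with (2 * PI * (l * y)) by ring.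
      apply Rmult_le_compat_l; [generalize PI_RGT_0; lra|].
      assert (H := Rle_abs l). assert (H0 := Rabs_pos l). nra.
Qed.

Theorem nonvanishing_progression (N : nat) (u : C) (a : R -> C) : (1 <= N)%nat ->
  is_expansion f (INR N) u a ->
  (forall z, half_plane 0 z -> f (z + INR N)%C = (u * f z)%C) ->
  (exists z, half_plane 0 z /\ f z <> 0) ->
  exists (L : nat) (l0 : R), (1 <= L)%nat /\ forall n : nat,
    exponents (INR N) u (l0 + INR L * INR n) /\ a (l0 + INR L * INR n) <> 0.
Proof.
  intros HN He Hp Hnz.
  assert (N1 : 1 <= INR N) by (apply (le_INR 1); assumption).
  destruct (dominant_orders (exists_pole _ u a He Hp Hnz)) as [M0 [M1 [L [HM [HL [[g Hg] [Hdom Hcusp]]]]]]].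
  assert (L1 : 1 <= INR L) by (apply (le_INR 1); assumption).
  destruct (growth_near_real_axis k G f hk hsub hfin hhol habs hord M0 M1 HM Hdom) as [B [HB HBz]].
  set (Dom := fun x0 => exists g, dominant k f M0 g /\ x0 = cusp g).
  destruct (Hcusp g Hg) as [q Eq].
  destruct (coefficient_asymptotics k M0 M1 B f Dom L N u a hk HM HL HN HB) with (q := q)
    as [A [A0 HA]].
  { intros z Hz. now apply ex_derive_cdiff, hhol. }
  { intros z Hz. destruct (HBz z Hz) as [E [H1 [H2|[g' [H2 H3]]]]]; exists E; split; trivial; [now left|].
    right. exists (cusp g'). split; [now exists g'|assumption]. }
  { intros x0 [g' [Hg' ->]]. now apply sector_asymptotics. }
  { intros x0 [g' [Hg' ->]]. now apply Hcusp. }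
  { now apply coefficient_integral. }
  { exists g. split; [assumption|]. now symmetry. }
  assert (Hu : Cmod u = 1) by (destruct He as [r [[_ [H _]] _]]; exact H).
  destruct (exists_exponent (INR N) u ltac:(lra) Hu) as [l1 Hl1].
  destruct (character_sum_nonzero N L q A l1 HN HL A0) as [j Hj].
  set (l2 := l1 + INR j / INR N) in *.
  assert (Hl2 : exponents (INR N) u l2).
  { unfold l2. rewrite (INR_IZR_INZ j). apply exponents_shift; [lra|assumption]. }
  set (S := fun l => csum (fun i => ee (- l) (grid L q i) * A i)%C (seq 0 (N * L))).
  (* Grid points are multiples of 1/L, so a shift of the exponent by a multiple of L changes no
     character value at them. *)
  assert (Sp : forall n : nat, S (l2 + INR L * INR n) = S l2).
  { intros n. unfold S. apply csum_ext. intros i _. f_equal.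
    replace (- (l2 + INR L * INR n)) with (- l2 + - (INR L * INR n)) by ring. rewrite ee_plus_l.
    rewrite (ee_integer (- (INR L * INR n)) (grid L q i) (- (Z.of_nat n * (q + Z.of_nat i)))%Z); [ring|].
    unfold grid. rewrite opp_IZR, mult_IZR, <- (INR_IZR_INZ n). field. lra. }
  assert (S0 : 0 < Cmod (S l2)) by now apply Cmod_gt_0.
  destruct (HA (Cmod (S l2) / 2) ltac:(lra)) as [tau0 Htau].
  set (T := Rmax tau0 1). assert (T1 : 1 <= T) by apply Rmax_r. assert (T0 : tau0 <= T) by apply Rmax_l.
  (* The progression has to start beyond M0 T^10, the range of validity of the asymptotics; [n0 + 1]
     steps are enough because L >= 1. *)
  destruct (nfloor_ex (Rabs (M0 * T ^ 10 - l2))) as [n0 [_ Hn0]]; [apply Rabs_pos|].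
  assert (Hn1 : M0 * T ^ 10 - l2 < INR n0 + 1) by (eapply Rle_lt_trans; [apply Rle_abs|eassumption]).
  assert (Ex : forall n : nat, exponents (INR N) u (l2 + INR L * INR n)).
  { intros n. replace (INR L * INR n) with (IZR (Z.of_nat (N * L * n)) / INR N).
    - apply exponents_shift; [lra|assumption].
    - rewrite <- INR_IZR_INZ, !mult_INR. field. lra. }
  exists L, (l2 + INR L * INR (n0 + 1)). split; [assumption|]. intros n.
  replace (l2 + INR L * INR (n0 + 1) + INR L * INR n) with (l2 + INR L * INR (n0 + 1 + n))
    by (rewrite (plus_INR (n0 + 1)); ring).
  split; [apply Ex|]. set (n1 := (n0 + 1 + n)%nat). set (l := l2 + INR L * INR n1).
  assert (T10 : 1 <= T ^ 10) by (apply pow_R1_Rle; assumption).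
  assert (Hl : M0 * T ^ 10 <= l).
  { unfold l. assert (INR n0 + 1 <= INR n1).
    { unfold n1. rewrite !plus_INR. simpl. generalize (pos_INR n). lra. }
    generalize (pos_INR n0). intros P0. nra. }
  (* The parameter with M0 tau^10 = l, that is, the saddle height y = tau^(-5) belonging to l. *)
  set (tau := Rpower (l / M0) (/ INR 10)).
  assert (lM : T ^ 10 <= l / M0) by (apply (proj1 (Rle_div_r _ _ M0 ltac:(lra))); lra).
  assert (tau10 : tau ^ 10 = l / M0).
  { unfold tau. rewrite <- Rpower_pow by apply exp_pos. rewrite Rpower_mult, Rinv_l, Rpower_1; [reflexivity|lra|].
    apply not_0_INR. lia. }
  assert (tauT : T <= tau).
  { rewrite <- (Rpower_1 T) by lra. rewrite <- (Rinv_r (INR 10)) by (apply not_0_INR; lia).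
    rewrite <- Rpower_mult, Rpower_pow by lra. apply Rle_Rpower_l; [|lra].
    left. apply Rinv_0_lt_compat, lt_0_INR. lia. }
  assert (El : M0 * tau ^ 10 = l) by (rewrite tau10; field; lra).
  destruct (Htau tau ltac:(lra) ltac:(lra)) as [P [P0 HP]]; [rewrite El; apply Ex|].
  rewrite El in HP. fold (S l) in HP. unfold l at 2 in HP. rewrite Sp in HP.
  intros Z. rewrite Z in HP. replace (INR N * 0 - S l2 * P)%C with (- (S l2 * P))%C in HP by ring.
  rewrite Cmod_opp, Cmod_mult, Cmod_R, Rabs_right in HP by lra. nra.
Qed.

End Assembly.

Theorem theorem2 (k : R) (G : SL2Z -> Prop) (f : C -> C)
    (hsub : is_subgroup G) (hfin : finite_index G)
    (hmod : modular_function k G f)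
    (hhol : holomorphic_on (half_plane 0) f)
    (hnz : exists z : C, half_plane 0 z /\ f z <> RtoC 0)
    (hk : k < 0) :
  strongly_non_lacunary f.
Proof.
  destruct hmod as [_ [[j Hj] Hord]].
  (* From here on the factors enter through their moduli, except for that of the translation [T]. *)
  assert (habs : forall g z, G g -> 0 < Im z ->
    Cmod (f (moebius g z)) = Rpower (Cmod (denom g z)) k * Cmod (f z)).
  { intros g z Hg Hz. destruct (Hj g Hg) as [[_ Hm] Hf]. rewrite Hf, Cmod_mult, Hm by exact Hz.
    reflexivity. }
  assert (hord : forall g, finite_order (slash k f g)) by (intros g; apply Hord).
  destruct (finite_index_upper G hsub hfin) as [N [HN GN]].
  assert (N1 : 1 <= INR N) by (apply (le_INR 1); assumption).
  set (T := upper_unipotent (Z.of_nat N)) in *.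
  destruct (Hj T GN) as [[Hjhol Hjmod] Hjf].
  assert (Jm : forall z, half_plane 0 z -> Cmod (j T z) = 1).
  { intros z Hz. rewrite Hjmod by assumption. unfold T. rewrite denom_upper, Cmod_1.
    unfold Rpower. rewrite ln_1, Rmult_0_r. apply exp_0. }
  assert (Jc := constant_of_constant_modulus (j T) (fun z Hz => ex_derive_cdiff _ _ (Hjhol z Hz)) Jm).
  set (u := j T (0, 1)) in *.
  assert (Hu : Cmod u = 1) by (apply Jm; unfold half_plane; simpl; lra).
  assert (Hp : forall z, half_plane 0 z -> f (z + INR N)%C = (u * f z)%C).
  { intros z Hz. rewrite INR_IZR_INZ, <- (moebius_upper (Z.of_nat N)). fold T.
    rewrite Hjf, Jc by assumption. reflexivity. }
  assert (Fo := hord SL2Z_one). rewrite slash_one in Fo. destruct Fo as [h [u' [a [He Hfin]]]].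
  assert (He' := expansion_change_period f h (INR N) u' u a He hhol ltac:(lra) Hu Hp).
  destruct (nonvanishing_progression k G f hk hsub hfin hhol habs hord N u a HN He' Hp hnz)
    as [L [l0 [HL H]]].
  exists (INR N), u, a. split; [assumption|]. split; [assumption|].
  (* The step of the progression is measured in units of 1/h with h = N, so a step of L corresponds
     to m = N L. *)
  exists (N * L)%nat, l0. split; [nia|]. intros n.
  replace (INR (N * L) * / INR N * INR n) with (INR L * INR n); [apply H|].
  rewrite mult_INR. field. lra.
Qed.
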